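(* Let $\Theta\subseteq\mathbb{R}^q$ be the parameter space, $\theta_0\in\Theta$, $\alpha\in(0,1)$. For each sample size $T$ let $g_T(\cdot)$ be an $\mathbb{R}^k$-valued stochastic process on $\Theta$ whose distribution is described by a probability measure $P\in\mathcal{P}_0$, where $\mathcal{P}_0$ is the family of distributions consistent with the null hypothesis $m_T(\theta_0)=0$; to each $P\in\mathcal{P}_0$ are associated a deterministic mean function $m_T=m_{T,P}:\Theta\to\mathbb{R}^k$ (so $m_T(\theta_0)=0$) and a mean-zero Gaussian process $G=G_P$ on $\Theta$ with covariance function $\Sigma=\Sigma_P$, $\Sigma(\theta,\tilde\theta)=E[G(\theta)G(\tilde\theta)']$. Suppose: (1) $\displaystyle\lim_{T\to\infty}\sup_{P\in\mathcal{P}_0}\sup_{f\in BL_1}\left|E[f(g_T-m_T)]-E[f(G)]\right|=0$; (2) for some finite $\bar\lambda>0$, $\displaystyle 1/\bar\lambda\le\inf_{P\in\mathcal{P}_0}\inf_{\theta\in\Theta}\lambda_{\min}(\Sigma(\theta,\theta))\le\sup_{P\in\mathcal{P}_0}\sup_{\theta\in\Theta}\lambda_{\max}(\Sigma(\theta,\theta))\le\bar\lambda$; (3) there is an estimator $\widehat\Sigma(\cdot,\cdot)$ of the covariance function such that for any $\varepsilon>0$, $\displaystyle\lim_{T\to\infty}\sup_{P\in\mathcal{P}_0}P\left\{\sup_{\theta,\tilde\theta}\|\widehat\Sigma(\theta,\tilde\theta)-\Sigma(\theta,\tilde\theta)\|>\varepsilon\right\}=0$; (4) (strong identification) for some sequence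 of numbers $\delta_T$ converging to zero and each $P\in\mathcal{P}_0$, there exists a sequence of matrices $M_T$ (of size $k\times q$) such that for any $\varepsilon>0$: (i) $\displaystyle\lim_{T\to\infty}\inf_{P\in\mathcal{P}_0}\inf_{\|\theta-\theta_0\|>\delta_T}m_T(\theta)'\Sigma(\theta,\theta)^{-1}m_T(\theta)=\infty$; (ii) $\displaystyle\lim_{T\to\infty}\sup_{P\in\mathcal{P}_0}\sup_{\|\theta-\theta_0\|\le\delta_T}\|m_T(\theta)-M_T(\theta-\theta_0)\|=0$; (iii) $\displaystyle\lim_{T\to\infty}\inf_{P\in\mathcal{P}_0}\delta_T^2\,\lambda_{\min}(M_T'\Sigma(\theta_0,\theta_0)^{-1}M_T)=\infty$; (iv) $\displaystyle\lim_{T\to\infty}\sup_{P\in\mathcal{P}_0}\sup_{\|\theta-\theta_0\|\le\delta_T}\|\Sigma(\theta,\theta)-\Sigma(\theta_0,\theta_0)\|=0$ and $\displaystyle\lim_{T\to\infty}\sup_{P\in\mathcal{P}_0}\sup_{\|\theta-\theta_0\|\le\delta_T}\|\Sigma(\theta,\theta_0)-\Sigma(\theta_0,\theta_0)\|=0$; (v) $\displaystyle\lim_{T\to\infty}\sup_{P\in\mathcal{P}_0}P\left\{\sup_{\|\theta-\theta_0\|\le\delta_T}\|G(\theta)-G(\theta_0)\|>\varepsilon\right\}=0$; (vi) there exists a constant $C$ such that $\displaystyle\sup_{P\in\mathcal{P}_0}P\left\{\sup_{\theta\in\Theta}\|G(\theta)\|>C\right\}<\varepsilon$. Then the statistic $$QLR=g_T(\theta_0)'\widehat\Sigma(\theta_0,\theta_0)^{-1}g_T(\theta_0)-\inf_{\theta}g_T(\theta)'\widehat\Sigma(\theta,\theta)^{-1}g_T(\theta)$$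 converges in distribution to a $\chi^2_q$ uniformly over $\mathcal{P}_0$ as the sample size $T$ increases to infinity, while at the same time the conditional critical value $c_\alpha(h_T,\widehat\Sigma)$ of the QLR statistic (defined in the context) converges in probability to the $(1-\alpha)$-quantile of a $\chi^2_q$ distribution. Thus under strong identification the conditional QLR test (which rejects when $QLR>c_\alpha(h_T,\widehat\Sigma)$) is asymptotically equivalent to the classical unconditional QLR test (which uses the $\chi^2_q$ critical value) under the null.
   Context: $\lambda_{\min}(A)$, $\lambda_{\max}(A)$ are the minimal and maximal eigenvalues of a square matrix $A$; $\|\cdot\|$ is the Euclidean norm for vectors and the operator norm for matrices. $BL_1$ is the set of real functionals (of $\mathbb{R}^k$-valued functions on $\Theta$, with the sup norm) with Lipschitz constant and supremum norm bounded above by one. The dependence of $m_T$, $M_T$, $G$, $\Sigma$ on $P$ is suppressed. In all suprema and infima, $\theta$ and $\tilde\theta$ range over points of the parameter space $\Theta$, on which the processes and functions are defined. Conditional critical value: let $h_T(\theta)=g_T(\theta)-\widehat\Sigma(\theta,\theta_0)\widehat\Sigma(\theta_0,\theta_0)^{-1}g_T(\theta_0)$, and for $\xi\in\mathbb{R}^k$, $h:\Theta\to\mathbb{R}^k$ with $h(\theta_0)=0$ and a covariance function $S$ let $$R(\xi,h,S)=\xi'S(\theta_0,\theta_0)^{-1}\xi-\inf_{\theta}(V_S(\theta)\xi+h(\theta))'S(\theta,\theta)^{-1}(V_S(\theta)\xi+h(\theta)),\quad V_S(\theta)=S(\theta,\theta_0)S(\theta_0,\theta_0)^{-1},$$ so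 that $QLR=R(g_T(\theta_0),h_T,\widehat\Sigma)$. Then $$c_\alpha(h_T,\widehat\Sigma)=\inf\left\{c:P^*\{\xi:R(\xi,h_T,\widehat\Sigma)\le c\}\ge1-\alpha\right\},$$ where $P^*$ denotes the simulation probability, under which $\xi\sim N(0,\widehat\Sigma(\theta_0,\theta_0))$ with $(h_T,\widehat\Sigma)$ held fixed.
   Formalization: The formal theorem assumes θ0 is an interior point of Θ, not just a point of Θ; without this the claim is false (for Θ={θ0} with m_T=0, Σ=Σ̂=I, all conditions can hold while QLR=0 identically). *)

(* Defs.v *)
From HB Require Import structures.
From mathcomp Require Import all_boot all_order all_algebra.
From mathcomp Require Import all_classical all_reals all_analysis.

Set Implicit Arguments.
Unset Strict Implicit.
Unset Printing Implicit Defensive.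

Import Order.TTheory GRing.Theory Num.Theory.
Import numFieldTopology.Exports numFieldNormedType.Exports.

Local Open Scope classical_set_scope.
Local Open Scope ring_scope.

Section Euclidean.
Context {R : realType}.

(* The library's norm on matrices is the max norm, hence these definitions. *)
Definition enorm n (x : 'cV[R]_n) : R := Num.sqrt (\sum_i x i 0 ^+ 2).

Definition opnorm m n (A : 'M[R]_(m, n)) : R :=
  sup [set enorm (A *m x) | x in [set x | enorm x <= 1]].

(* Only applied to symmetric matrices: then the set of real eigenvalues is
   finite, and nonempty when the size is positive. *)
Definition lambda_min n (A : 'M[R]_n) : R := inf [set a | eigenvalue A a].
Definition lambda_max n (A : 'M[R]_n) : R := sup [set a | eigenvalue A a].

Definition qform n (A : 'M[R]_n) (x : 'cV[R]_n) : R := (x^T *m A *m x) 0 0.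

Definition covariance_matrix n (S : 'M[R]_n) : Prop :=
  S^T = S /\ forall x, 0 <= qform S x.

Definition col_tuple n (z : n.-tuple R) : 'cV[R]_n := \col_i tnth z i.
Definition tuple_col n (x : 'cV[R]_n) : n.-tuple R := [tuple x i 0 | i < n].

End Euclidean.

(* Hoffmann-Jorgensen conventions: suprema over Theta, and bounded Lipschitz
   functionals of the processes, need not be measurable. On measurable events
   and variables these are the ordinary probability and expectation. *)
Section OuterProbability.
Context d (T : measurableType d) (R : realType) (P : probability T R).
Local Open Scope ereal_scope.

Definition outer_prob (A : set T) : \bar R :=
  ereal_inf [set P B | B in [set B | measurable B /\ A `<=` B]].

Definition inner_prob (A : set T) : \bar R := 1 - outer_prob (~` A).

Definition outer_expectation (X : T -> R) : \bar R :=
  ereal_inf [set 'E_P[U] | U in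
    [set U : T -> R | P.-integrable setT (EFin \o U) /\
                      forall w, (X w <= U w)%R]].

End OuterProbability.

(* The supremum over P0 is inside the limit; for nonmeasurable X both the outer
   and the inner distribution functions must converge. *)
Definition cvg_in_law_uniformly d (T : measurableType d) (R : realType)
    (P0 : set (probability T R)) (X : nat -> T -> \bar R)
    (mu : set R -> \bar R) : Prop :=
  forall x : R, {for x, continuous (fun y => fine (mu `]-oo, y]%classic))} ->
    ereal_sup [set `|outer_prob P [set w | X n w <= x%:E]
                     - mu `]-oo, x]%classic|%E | P in P0] @[n --> \oo] --> 0%E /\
    ereal_sup [set `|inner_prob P [set w | X n w <= x%:E]
                     - mu `]-oo, x]%classic|%E | P in P0] @[n --> \oo] --> 0%E.

Definition cvg_in_prob_uniformly d (T : measurableType d) (R : realType)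
    (P0 : set (probability T R)) (X : nat -> T -> \bar R) (a : R) : Prop :=
  forall eps : R, 0 < eps ->
    ereal_sup [set outer_prob P [set w | (eps%:E < `|X n w - a%:E|)%E]
              | P in P0] @[n --> \oo] --> 0%E.

Section Gaussian.
Context {R : realType}.

Local Notation MR := (measurableTypeR R).

Definition cons_pair n (x : MR * n.-tuple MR) : n.+1.-tuple MR :=
  [tuple of x.1 :: x.2].

Lemma measurable_cons_pair n : measurable_fun setT (@cons_pair n).
Proof. by apply: measurable_cons. Qed.

HB.instance Definition _ n :=
  isMeasurableFun.Build _ _ (MR * n.-tuple MR)%type (n.+1.-tuple MR)
    (@cons_pair n) (@measurable_cons_pair n).

Fixpoint std_gaussian n : probability (n.-tuple MR) R :=
  match n with
  | 0 => \d_([tuple] : 0.-tuple MR)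
  | n'.+1 => distribution (normal_prob 0 1 \x std_gaussian n')%E (@cons_pair n')
  end.

(* N(0, S): the law of A *m z with A *m A^T = S and z standard Gaussian, which
   does not depend on the choice of A. Meaningful for covariance matrices only. *)
Definition mx_factor n (S : 'M[R]_n) : 'M[R]_n :=
  xget 0 [set A | A *m A^T = S].

Definition gaussian n (S : 'M[R]_n) : set (n.-tuple R) -> \bar R :=
  pushforward (std_gaussian n)
    (fun z => tuple_col (mx_factor S *m col_tuple z)).

Definition chi2 n : set R -> \bar R :=
  pushforward (std_gaussian n) (fun z => \sum_i tnth z i ^+ 2).

Definition quantile (mu : set R -> \bar R) (p : R) : R :=
  inf [set c | (p%:E <= mu `]-oo, c]%classic)%E].

End Gaussian.

Section Processes.
Context {R : realType} {q k : nat}.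
Implicit Types (Theta : set 'cV[R]_q).

Definition stochastic_process d (T : measurableType d) Theta
    (X : T -> 'cV[R]_q -> 'cV[R]_k) : Prop :=
  forall theta i, Theta theta -> measurable_fun setT (fun w => X w theta i 0).

(* Finite-dimensional distributions are indexed by finite families of pairs
   (point, coordinate). *)
Definition centered_gaussian_process d (T : measurableType d)
    (Q : probability T R) Theta (G : T -> 'cV[R]_q -> 'cV[R]_k)
    (Sigma : 'cV[R]_q -> 'cV[R]_q -> 'M[R]_k) : Prop :=
  [/\ stochastic_process Theta G,
      forall theta i, Theta theta -> ('E_Q[fun w => G w theta i 0%R] = 0)%E,
      forall theta theta' i j, Theta theta -> Theta theta' ->
        ('E_Q[fun w => (G w theta i 0 * G w theta' j 0)%R]
         = (Sigma theta theta' i j)%:E)%E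
    & forall n (s : 'I_n -> 'cV[R]_q * 'I_k) (B : set (n.-tuple R)),
        (forall i, Theta (s i).1) -> measurable B ->
        Q [set w | B [tuple G w (s i).1 (s i).2 0 | i < n]]
        = gaussian (\matrix_(i, j) Sigma (s i).1 (s j).1 (s i).2 (s j).2) B].

(* The sup distance may be +oo; functionals in BL1 only depend on the
   restriction of their argument to Theta. *)
Definition BL1 Theta : set (('cV[R]_q -> 'cV[R]_k) -> R) :=
  [set f | (forall x, `|f x| <= 1) /\
     forall x y, (`|f x - f y|%:E <=
       ereal_sup [set (enorm (x theta - y theta))%:E | theta in Theta])%E].

Variables (Theta : set 'cV[R]_q) (theta0 : 'cV[R]_q).
Implicit Types (g h : 'cV[R]_q -> 'cV[R]_k) (xi : 'cV[R]_k)
  (S : 'cV[R]_q -> 'cV[R]_q -> 'M[R]_k).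

(* The infima are taken in \bar R; invmx is a true inverse whenever the matrix
   is nonsingular. *)
Definition QLR g S : \bar R :=
  ((qform (invmx (S theta0 theta0)) (g theta0))%:E -
   ereal_inf [set (qform (invmx (S theta theta)) (g theta))%:E
             | theta in Theta])%E.

Definition projected_process g S theta : 'cV[R]_k :=
  g theta - S theta theta0 *m invmx (S theta0 theta0) *m g theta0.

Definition QLR_function xi h S : \bar R :=
  let V theta := S theta theta0 *m invmx (S theta0 theta0) in
  ((qform (invmx (S theta0 theta0)) xi)%:E -
   ereal_inf [set (qform (invmx (S theta theta)) (V theta *m xi + h theta))%:E
             | theta in Theta])%E.

Definition critical_value (alpha : R) h S : \bar R :=
  ereal_inf [set c%:E | c in [set c : R |
    ((1 - alpha)%:E <= gaussian (S theta0 theta0)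
       [set z | QLR_function (col_tuple z) h S <= c%:E])%E]].

End Processes.

(* Main.v *)
(* Write x = g - m and Sigma0 = A A^T.  With high probability, uniformly over
   P0, x is bounded, nearly constant on the delta-ball around theta0, and
   Sigmahat is close to Sigma.  On that event m explodes outside the ball and is
   nearly linear inside it, so the infimum in QLR is almost the least-squares
   minimum over b of |A^-1 (x theta0 + M b)|^2, and QLR is within eps of
   |B A^-1 x theta0|^2, where the rows of B are an orthonormal basis of the
   range of A^-1 M.  The recentred functional R(xi, h, Sigmahat) is the QLR
   statistic of the process x + V (xi - x theta0), so the same estimate squeezes
   the conditional law, hence the critical value.  That |B z|^2 is chi-square
   for Gaussian z follows by turning the rows of B onto coordinate axes with plane
   rotations, each of which is a product of three shears preserving Lebesgue
   measure.  Events about x are compared with events about G by applying the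
   bounded-Lipschitz hypothesis to clipped suprema. *)
Require Import Defs.
From HB Require Import structures.
From mathcomp Require Import all_boot all_order all_algebra.
From mathcomp Require Import all_classical all_reals all_analysis.
Import Order.TTheory GRing.Theory Num.Theory.
Import numFieldTopology.Exports numFieldNormedType.Exports.
Local Open Scope classical_set_scope.
Local Open Scope ring_scope.
From mathcomp Require Import measurable_realfun ring lra.

Set Implicit Arguments.
Unset Strict Implicit.
Unset Printing Implicit Defensive.

(** * Quadratic forms and least squares *)

Section Dot.
Context {R : realType}.
Implicit Types n : nat.

(** Uniformity over [P0] never comes from a limit argument in [P]. Every analytic error is measured
    by one number [eta], picked from the dimensions, the bounds and [eps] before [Theta], the
    measures or the sample size appear; the hypotheses only have to make [eta] admissible
    eventually. The projections [B] vary with the measure and the sample size and need not converge,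
    but the law of [|B z|^2] is exactly chi-square for each of them, so no subsequence is extracted.
    Strong identification acts twice on the infimum: the explosion of [m] discards distant points,
    and the bound on [delta^2 lambda_min] puts the unconstrained least-squares minimiser inside the
    ball. The factor [A] need only have [A A^T] close to [Sigma0], so one estimate serves both the
    statistic, with a factor of [Sigma0], and the simulation, with a factor of the estimated matrix.
    Bounded Lipschitz functionals see neither squares nor sharp thresholds. Norms are therefore
    compared unsquared and between two separated levels; continuity of the chi-square distribution
    function closes the gap at the end. *)

Definition dot n (u v : 'cV[R]_n) : R := (u^T *m v) 0 0.

Lemma dotE n (u v : 'cV[R]_n) : dot u v = \sum_i u i 0 * v i 0.
Proof. by rewrite /dot mxE; apply: eq_bigr => i _; rewrite mxE. Qed.

Lemma dotC n (u v : 'cV[R]_n) : dot u v = dot v u.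
Proof. by rewrite !dotE; apply: eq_bigr => i _; rewrite mulrC. Qed.

Lemma dotDr n (u v w : 'cV[R]_n) : dot u (v + w) = dot u v + dot u w.
Proof. by rewrite /dot mulmxDr mxE. Qed.

Lemma dotDl n (u v w : 'cV[R]_n) : dot (u + v) w = dot u w + dot v w.
Proof. by rewrite dotC dotDr !(dotC w). Qed.

Lemma dotZr n a (u v : 'cV[R]_n) : dot u (a *: v) = a * dot u v.
Proof. by rewrite /dot -scalemxAr mxE. Qed.

Lemma dotZl n a (u v : 'cV[R]_n) : dot (a *: u) v = a * dot u v.
Proof. by rewrite dotC dotZr dotC. Qed.

Lemma dotNr n (u v : 'cV[R]_n) : dot u (- v) = - dot u v.
Proof. by rewrite -scaleN1r dotZr mulN1r. Qed.

Lemma dotNl n (u v : 'cV[R]_n) : dot (- u) v = - dot u v.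
Proof. by rewrite dotC dotNr dotC. Qed.

Lemma dot0r n (u : 'cV[R]_n) : dot u 0 = 0.
Proof. by rewrite /dot mulmx0 mxE. Qed.

Lemma dot_mulmxr m n (A : 'M[R]_(m, n)) u v :
  dot u (A *m v) = dot (A^T *m u) v.
Proof. by rewrite /dot trmx_mul trmxK mulmxA. Qed.

Lemma dot_ge0 n (u : 'cV[R]_n) : 0 <= dot u u.
Proof. by rewrite dotE sumr_ge0// => i _; rewrite -expr2 sqr_ge0. Qed.

Lemma dot_eq0 n (u : 'cV[R]_n) : dot u u = 0 -> u = 0.
Proof.
move/eqP; rewrite dotE psumr_eq0 => [/allP u0|i _]; last first.
  by rewrite -expr2 sqr_ge0.
apply/matrixP => i j; rewrite ord1 mxE.
have := u0 i (mem_index_enum _); rewrite /= -expr2 sqrf_eq0.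
by move=> /eqP.
Qed.

Lemma enorm_sqr n (u : 'cV[R]_n) : enorm u ^+ 2 = dot u u.
Proof.
rewrite /enorm sqr_sqrtr; last by rewrite sumr_ge0// => i _; rewrite sqr_ge0.
by rewrite dotE; apply: eq_bigr => i _; rewrite expr2.
Qed.

Lemma enormE n (u : 'cV[R]_n) : enorm u = Num.sqrt (dot u u).
Proof. by rewrite -enorm_sqr sqrtr_sqr ger0_norm// sqrtr_ge0. Qed.

Lemma enorm_ge0 n (u : 'cV[R]_n) : 0 <= enorm u.
Proof. exact: sqrtr_ge0. Qed.

Lemma enorm0 n : enorm (0 : 'cV[R]_n) = 0.
Proof. by rewrite enormE dot0r sqrtr0. Qed.

Lemma enorm_eq0 n (u : 'cV[R]_n) : enorm u = 0 -> u = 0.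
Proof. by move=> u0; apply: dot_eq0; rewrite -enorm_sqr u0 expr0n. Qed.

Lemma enormZ n a (u : 'cV[R]_n) : enorm (a *: u) = `|a| * enorm u.
Proof.
rewrite !enormE dotZl dotZr mulrA -expr2 sqrtrM ?sqr_ge0//.
by rewrite sqrtr_sqr.
Qed.

Lemma enormN n (u : 'cV[R]_n) : enorm (- u) = enorm u.
Proof. by rewrite -scaleN1r enormZ normrN normr1 mul1r. Qed.

Lemma enormB n (u v : 'cV[R]_n) : enorm (u - v) = enorm (v - u).
Proof. by rewrite -enormN opprB. Qed.

Lemma cauchy_schwarz n (u v : 'cV[R]_n) : `|dot u v| <= enorm u * enorm v.
Proof.
rewrite -(@ler_pXn2r _ 2) ?nnegrE ?mulr_ge0 ?enorm_ge0//.
rewrite exprMn !enorm_sqr real_normK ?num_real//.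
have [v0|v0] := eqVneq (dot v v) 0.
  by rewrite (dot_eq0 v0) !dot0r expr0n mulr0.
have vp : 0 < dot v v by rewrite lt_def v0 dot_ge0.
have := dot_ge0 (dot v v *: u - dot u v *: v).
rewrite !(dotDl, dotDr, dotNl, dotNr, dotZl, dotZr) (dotC v u) => h.
have : 0 <= dot v v * (dot u u * dot v v - dot u v ^+ 2).
  apply: le_trans h _; rewrite le_eqVlt; apply/orP; left; apply/eqP; ring.
by rewrite pmulr_rge0// subr_ge0.
Qed.

Lemma ler_enormD n (u v : 'cV[R]_n) : enorm (u + v) <= enorm u + enorm v.
Proof.
rewrite -(@ler_pXn2r _ 2) ?nnegrE ?addr_ge0 ?enorm_ge0//.
rewrite enorm_sqr sqrrD !enorm_sqr !(dotDl, dotDr) (dotC v u).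
have := le_trans (ler_norm _) (cauchy_schwarz u v); lra.
Qed.

Lemma ler_enormB n (u v : 'cV[R]_n) : enorm (u - v) <= enorm u + enorm v.
Proof. by rewrite (le_trans (ler_enormD _ _))// enormN. Qed.

Lemma ler_enorm_sub n (u v : 'cV[R]_n) : enorm u - enorm v <= enorm (u - v).
Proof. by rewrite lerBlDr (le_trans _ (ler_enormD _ _))// subrK. Qed.

Lemma ler_dist_enorm n (u v : 'cV[R]_n) :
  `|enorm u - enorm v| <= enorm (u - v).
Proof.
rewrite ler_norml ler_enorm_sub andbT lerNl opprB enormB.
exact: ler_enorm_sub.
Qed.

Lemma ler_coord_enorm n (u : 'cV[R]_n) i : `|u i 0| <= enorm u.
Proof.
rewrite -(@ler_pXn2r _ 2) ?nnegrE ?enorm_ge0//.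
rewrite enorm_sqr real_normK ?num_real// dotE (bigD1 i)//= -expr2 lerDl.
by rewrite sumr_ge0// => j _; rewrite -expr2 sqr_ge0.
Qed.

Lemma ler_enorm_sum n (u : 'cV[R]_n) : enorm u <= \sum_i `|u i 0|.
Proof.
have -> : u = \sum_i u i 0 *: delta_mx i 0.
  apply/colP => i; rewrite summxE (bigD1 i)//= big1 ?addr0.
    by rewrite !mxE !eqxx mulr1.
  by move=> j ji; rewrite !mxE eq_sym (negbTE ji) mulr0.
rewrite (le_trans (y := \sum_i enorm (u i 0 *: (delta_mx i 0 : 'cV[R]_n)))) //.
  elim/big_rec2 : _ => [|i y z _ h]; first by rewrite enorm0.
  by rewrite (le_trans (ler_enormD _ _))// lerD2l.
apply: ler_sum => i _; rewrite enormZ.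
have -> : enorm (delta_mx i 0 : 'cV[R]_n) = 1.
  rewrite enormE dotE (bigD1 i)//= big1 ?addr0 ?mxE ?eqxx ?mulr1 ?sqrtr1//.
  by move=> j ji; rewrite !mxE (negbTE ji) mulr0.
rewrite mulr1 summxE (bigD1 i)//= big1 ?addr0.
  by rewrite !mxE !eqxx mulr1.
by move=> j ji; rewrite !mxE eq_sym (negbTE ji) mulr0.
Qed.

(** An operator-norm bound without the supremum: it composes under sums and products with no
    boundedness side condition. *)
Definition mxbound m n (K : R) (A : 'M[R]_(m, n)) :=
  forall v, enorm (A *m v) <= K * enorm v.

(** The factor [m * n] is crude; only a bound depending on nothing but [K] and the size is
    wanted. *)
Lemma mxbound_entries m n (A : 'M[R]_(m, n)) K :
  (forall i j, `|A i j| <= K) -> mxbound (K *+ (m * n)) A.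
Proof.
move=> AK v; apply: (le_trans (ler_enorm_sum _)).
apply: (@le_trans _ _ (\sum_(i < m) (K * enorm v) *+ n)).
  apply: ler_sum => i _; rewrite mxE.
  apply: (le_trans (ler_norm_sum _ _ _)).
  rewrite -[X in _ *+ X](card_ord n) -sumr_const; apply: ler_sum => j _.
  by rewrite normrM ler_pM// ler_coord_enorm.
rewrite sumr_const card_ord -mulrnA mulnC.
by rewrite -mulrnAl.
Qed.

Lemma mxbound_opnorm m n (A : 'M[R]_(m, n)) : mxbound (opnorm A) A.
Proof.
(* This bound only shows that the set defining [opnorm] is bounded, without which [sup] need not be
   an upper bound. *)
pose K := \sum_i \sum_j `|A i j|.
have AK : mxbound (K *+ (m * n)) A.
  apply: mxbound_entries => i j; rewrite /K (bigD1 i)//= (bigD1 j)//= -addrA.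
  by rewrite lerDl addr_ge0// !sumr_ge0// => *; rewrite sumr_ge0.
have K0 : 0 <= K *+ (m * n).
  by rewrite mulrn_wge0// sumr_ge0// => *; rewrite sumr_ge0.
have h x : enorm x <= 1 -> enorm (A *m x) <= opnorm A.
  move=> x1; apply: ub_le_sup; last by exists x.
  exists (K *+ (m * n)) => _ [y /= y1 <-].
  by rewrite (le_trans (AK _))// ler_piMr.
move=> v; have [v0|v0] := eqVneq (enorm v) 0.
  by rewrite (enorm_eq0 v0) mulmx0 !enorm0 mulr0.
have vp : 0 < enorm v by rewrite lt_def v0 enorm_ge0.
have := h ((enorm v)^-1 *: v).
rewrite enormZ -scalemxAr enormZ ger0_norm ?invr_ge0 ?enorm_ge0// mulVf//.
by move=> /(_ (lexx _)); rewrite mulrC ler_pdivrMr.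
Qed.

Lemma mxbound_le m n (A : 'M[R]_(m, n)) K K' :
  K <= K' -> mxbound K A -> mxbound K' A.
Proof.
by move=> KK AK v; rewrite (le_trans (AK v))// ler_wpM2r ?enorm_ge0.
Qed.

Lemma mxboundD m n (A B : 'M[R]_(m, n)) K L :
  mxbound K A -> mxbound L B -> mxbound (K + L) (A + B).
Proof.
by move=> AK BL v; rewrite mulmxDl (le_trans (ler_enormD _ _))// mulrDl lerD.
Qed.

Lemma mxboundN m n (A : 'M[R]_(m, n)) K : mxbound K A -> mxbound K (- A).
Proof. by move=> AK v; rewrite mulNmx enormN. Qed.

Lemma mxboundM m n p (A : 'M[R]_(m, n)) (B : 'M[R]_(n, p)) K L :
  0 <= K -> mxbound K A -> mxbound L B -> mxbound (K * L) (A *m B).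
Proof.
by move=> K0 AK BL v; rewrite -mulmxA (le_trans (AK _))// -mulrA ler_wpM2l.
Qed.

(** Symmetry is left out on purpose: away from [theta0] the estimated covariance is not assumed
    symmetric, yet it inherits this bound by perturbation. *)
Definition coercive n (c : R) (S : 'M[R]_n) :=
  forall v, c * dot v v <= dot v (S *m v).

Lemma coercive_unit n c (S : 'M[R]_n) : 0 < c -> coercive c S -> S \in unitmx.
Proof.
move=> c0 cS; rewrite -row_free_unit; apply: inj_row_free => v vS.
have := cS v^T; rewrite {2}/dot trmxK mulmxA vS mul0mx mxE.
rewrite pmulr_rle0// => vv; rewrite -[v]trmxK.
suff -> : v^T = 0 by rewrite trmx0.
by apply: dot_eq0; apply/eqP; rewrite eq_le vv dot_ge0.
Qed.

(** With [w = S^-1 v], coercivity and Cauchy-Schwarz give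
    [c |w|^2 <= <w, S w> = <w, v> <= |w| |v|]. *)
Lemma coercive_inv n c (S : 'M[R]_n) :
  0 < c -> coercive c S -> mxbound c^-1 (invmx S).
Proof.
move=> c0 cS v; have Su := coercive_unit c0 cS.
set w := invmx S *m v; have vE : v = S *m w by rewrite mulmxA mulmxV// mul1mx.
have := cS w; rewrite -vE -enorm_sqr => h.
have {}h := le_trans h (le_trans (ler_norm _) (cauchy_schwarz _ _)).
have [->|w0] := eqVneq (enorm w) 0.
  by rewrite mulr_ge0 ?enorm_ge0// invr_ge0 ltW.
have wp : 0 < enorm w by rewrite lt_def w0 enorm_ge0.
move: h; rewrite expr2 mulrCA ler_pM2l// => h.
by rewrite mulrC ler_pdivlMr// mulrC.
Qed.

Lemma coercive_perturb n c e (S S' : 'M[R]_n) :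
  coercive c S -> mxbound e (S' - S) -> coercive (c - e) S'.
Proof.
move=> cS b v; have := cS v; have := cauchy_schwarz v ((S' - S) *m v).
have -> : dot v (S' *m v) = dot v (S *m v) + dot v ((S' - S) *m v).
  by rewrite -dotDr -mulmxDl addrC subrK.
move: (b v); rewrite ler_norml => bv /andP[+ _] cv.
have := ler_wpM2l (enorm_ge0 v) bv; rewrite mulrCA -expr2 enorm_sqr; lra.
Qed.

(** Resolvent identity: [S^-1 - S'^-1 = - S^-1 (S - S') S'^-1], and each inverse is bounded by
    [c^-1]. *)
Lemma dot_inv_sub n c e (S S' : 'M[R]_n) v :
  0 < c -> coercive c S -> coercive c S' -> mxbound e (S - S') ->
  `|dot v (invmx S *m v) - dot v (invmx S' *m v)| <= e / c ^+ 2 * dot v v.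
Proof.
move=> c0 cS cS' b.
have Su := coercive_unit c0 cS; have S'u := coercive_unit c0 cS'.
have -> : dot v (invmx S *m v) - dot v (invmx S' *m v) =
    - dot v ((invmx S *m (S - S') *m invmx S') *m v).
  rewrite mulmxBr (mulmxBl _ _ (invmx S')) mulVmx// mul1mx -mulmxA mulmxV//.
  by rewrite mulmx1 mulmxBl dotDr dotNr opprB.
rewrite normrN (le_trans (cauchy_schwarz _ _))//.
have := mxboundM _ (mxboundM _ (coercive_inv c0 cS) b) (coercive_inv c0 cS').
have ci : 0 <= c^-1 by rewrite invr_ge0 ltW.
(* The sign of [e] is not assumed; a negative [e] forces [v = 0], where both sides vanish. *)
have [e0|e0] := leP 0 e.
  move=> /(_ (mulr_ge0 ci e0) ci v) h.
  apply: (le_trans (ler_wpM2l (enorm_ge0 _) h)).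
  rewrite -enorm_sqr le_eqVlt; apply/orP; left; apply/eqP.
  by field; rewrite gt_eqF.
suff : v = 0 by move=> ->; rewrite mulmx0 enorm0 dot0r !mulr0.
apply: enorm_eq0; apply/eqP; apply: contraTT isT => v0.
have vp : 0 < enorm v by rewrite lt_def v0 enorm_ge0.
by have := le_trans (enorm_ge0 _) (b v); rewrite pmulr_lge0// leNgt e0.
Qed.

(** With [w = S^-1 v] the form equals [<w, S w> >= c |w|^2], while [|v| = |S w| <= K |w|]. *)
Lemma dot_inv_ge n c K (S : 'M[R]_n) v :
  0 < c -> 0 < K -> coercive c S -> mxbound K S ->
  c / K ^+ 2 * dot v v <= dot v (invmx S *m v).
Proof.
move=> c0 K0 cS b; have Su := coercive_unit c0 cS.
set w := invmx S *m v; have vE : v = S *m w by rewrite mulmxA mulmxV// mul1mx.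
rewrite dotC -{3}/w {3}vE (le_trans _ (cS w))// -!enorm_sqr.
rewrite mulrAC -mulrA ler_pM2l// ler_pdivrMr ?exprn_gt0//.
rewrite -exprMn lerXn2r ?nnegrE ?enorm_ge0 ?mulr_ge0 ?enorm_ge0 ?(ltW K0)//.
by rewrite {1}vE mulrC.
Qed.

Lemma dot_inv_le n c (S : 'M[R]_n) v :
  0 < c -> coercive c S -> dot v (invmx S *m v) <= c^-1 * dot v v.
Proof.
move=> c0 cS; rewrite (le_trans (ler_norm _))//.
rewrite (le_trans (cauchy_schwarz _ _))// -enorm_sqr expr2 mulrCA.
by rewrite ler_wpM2l ?enorm_ge0//; apply: coercive_inv.
Qed.

Lemma qformE n (A : 'M[R]_n) x : qform A x = dot x (A *m x).
Proof. by rewrite /qform /dot mulmxA. Qed.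

End Dot.

(** * Cholesky factors, orthonormal bases of a range, extreme eigenvalues *)

Section Spectral.
Context {R : realType}.
Implicit Types n : nat.

Definition pos_def n (A : 'M[R]_n) := forall v, v != 0 -> 0 < dot v (A *m v).

Lemma pos_def_unit n (A : 'M[R]_n) : pos_def A -> A \in unitmx.
Proof.
move=> pA; rewrite -row_free_unit; apply: inj_row_free => v vA.
rewrite -[v]trmxK; apply/eqP; rewrite trmx_eq0; apply: contraPT vA => v0 vA.
have := pA _ v0; rewrite /dot trmxK mulmxA vA mul0mx mxE ltxx.
by [].
Qed.

Lemma coercive_pos_def n c (A : 'M[R]_n) : 0 < c -> coercive c A -> pos_def A.
Proof.
move=> c0 cA v v0; rewrite (lt_le_trans _ (cA v))// mulr_gt0// lt_def dot_ge0.
by rewrite andbT; apply: contra_neq v0 => /dot_eq0.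
Qed.

Lemma dot_block m n (x x' : 'cV[R]_m) (y y' : 'cV[R]_n) :
  dot (col_mx x y) (col_mx x' y') = dot x x' + dot y y'.
Proof. by rewrite /dot tr_col_mx mul_row_col mxE. Qed.

(** Induction through the Schur complement [D - a^-1 b b^T]. It is positive definite because its
    form at [w] is the form of [A] at [(- a^-1 <b, w>, w)], the minimum over the first
    coordinate. *)
Lemma cholesky n (A : 'M[R]_n) :
  A^T = A -> pos_def A -> exists L : 'M[R]_n, L *m L^T = A.
Proof.
elim: n A => [A _ _|n IH]; first by exists 0; apply/matrixP => -[].
rewrite -add1n => A sA pA.
pose a := A 0 0; pose b := dlsubmx A; pose D := drsubmx A.
have AE : A = block_mx a%:M b^T b D.
  rewrite -[LHS]submxK; congr block_mx => //.
    apply/matrixP => i j; rewrite !ord1 !mxE eqxx mulr1n.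
    by congr (A _ _); apply/val_inj.
  by rewrite -[in LHS]sA -trmx_dlsub.
have sD : D^T = D by rewrite /D trmx_drsub sA.
have AvE (x : 'cV[R]_1) y : dot (col_mx x y) (A *m col_mx x y) =
    a * x 0 0 ^+ 2 + 2 * x 0 0 * dot b y + dot y (D *m y).
  rewrite AE mul_block_col dot_block !dotDr.
  have -> : dot x (a%:M *m x) = a * x 0 0 ^+ 2.
    rewrite mul_scalar_mx dotZr; congr (_ * _).
    by rewrite dotE big_ord1 expr2.
  have -> : dot x (b^T *m y) = x 0 0 * dot b y.
    by rewrite {1}dotE big_ord1.
  have -> : dot y (b *m x) = x 0 0 * dot b y.
    by rewrite dot_mulmxr dotE big_ord1 mulrC.
  ring.
have a0 : 0 < a.
  have := pA (col_mx 1%:M 0); rewrite AvE mulmx0 !dot0r !mxE eqxx expr1n.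
  rewrite !mulr1 mulr0 !addr0; apply.
  apply/eqP => /(congr1 (fun M : 'cV_(1 + n) => M 0 0)).
  rewrite mxE; case: splitP => // i _; rewrite ord1 !mxE eqxx => /eqP.
  by rewrite oner_eq0.
have [|w w0|L LE] := IH (D - a^-1 *: (b *m b^T)).
- by rewrite linearB linearZ /= trmx_mul trmxK sD.
- have := pA (col_mx (- (a^-1 * dot b w))%:M w).
  rewrite AvE !mxE eqxx mulr1n mulmxBl dotDr dotNr -scalemxAl dotZr.
  have -> : dot w (b *m b^T *m w) = dot b w ^+ 2.
    by rewrite -mulmxA dot_mulmxr dotE big_ord1 expr2.
  move=> /(_ _)/lt_le_trans; apply.
    by apply: contra_neq w0 => /(congr1 dsubmx); rewrite col_mxKd linear0.
  rewrite le_eqVlt; apply/orP; left; apply/eqP.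
  by field; rewrite gt_eqF.
exists (block_mx (Num.sqrt a)%:M 0 ((Num.sqrt a)^-1 *: b) L).
have sa : Num.sqrt a != 0 by rewrite sqrtr_eq0 -ltNge.
rewrite [in LHS]tr_block_mx mulmx_block AE; congr block_mx.
- by rewrite trmx0 mulmx0 addr0 tr_scalar_mx -scalar_mxM -expr2 sqr_sqrtr// ltW.
- by rewrite mul0mx addr0 linearZ /= mul_scalar_mx scalerA divff// scale1r.
- rewrite trmx0 mulmx0 addr0 tr_scalar_mx mul_mx_scalar scalerA divff//.
  by rewrite scale1r.
- rewrite linearZ /= -scalemxAl -scalemxAr scalerA -invfM -expr2.
  by rewrite sqr_sqrtr ?ltW// LE addrC subrK.
Qed.

(** With [L L^T = N^T N], the matrix [B = L^-1 N^T] has orthonormal rows and [N = B^T L^T].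
    Completing the square leaves [|L^T b + B y|^2] as the only term depending on [b], and [L] is
    invertible. *)
Lemma least_squares q k (N : 'M[R]_(k, q)) :
  (forall b : 'cV_q, N *m b = 0 -> b = 0) ->
  exists B : 'M[R]_(q, k), B *m B^T = 1%:M /\
    forall y, (forall b : 'cV_q, dot y y - dot (B *m y) (B *m y)
                         <= dot (y + N *m b) (y + N *m b)) /\
      exists b : 'cV_q, dot (y + N *m b) (y + N *m b) = dot y y - dot (B *m y) (B *m y).
Proof.
move=> injN.
have pN : pos_def (N^T *m N).
  move=> v v0; rewrite -mulmxA dot_mulmxr trmxK lt_def dot_ge0 andbT.
  by apply: contra_neq v0 => /dot_eq0/injN.
have sN : (N^T *m N)^T = N^T *m N by rewrite trmx_mul trmxK.
have [L LE] := cholesky sN pN.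
have := pos_def_unit pN; rewrite -LE unitmx_mul unitmx_tr andbb => Lu.
pose B := invmx L *m N^T.
have NE : N = B^T *m L^T.
  by rewrite /B trmx_mul trmxK -mulmxA trmx_inv mulVmx ?mulmx1// unitmx_tr.
have BB : B *m B^T = 1%:M.
  rewrite /B trmx_mul trmxK mulmxA -(mulmxA _ N^T) -LE mulmxA mulVmx// mul1mx.
  by rewrite trmx_inv mulmxV// unitmx_tr.
exists B; split=> // y.
have E b : dot (y + N *m b) (y + N *m b) = dot y y - dot (B *m y) (B *m y)
    + dot (L^T *m b + B *m y) (L^T *m b + B *m y).
  rewrite NE -mulmxA; set u := L^T *m b.
  have Eu v : dot v (B^T *m u) = dot (B *m v) u by rewrite dot_mulmxr trmxK.
  rewrite !(dotDl, dotDr) (dotC (B^T *m u) y) !Eu mulmxA BB mul1mx (dotC u).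
  ring.
split=> [b|]; first by rewrite E lerDl dot_ge0.
exists (invmx L^T *m - (B *m y)); rewrite E mulmxA mulmxV ?unitmx_tr// mul1mx.
by rewrite addNr dot0r addr0.
Qed.

Lemma entry_continuous m n (i : 'I_m) (j : 'I_n) :
  continuous (fun A : 'M[R]_(m, n) => A i j).
Proof. exact: coord_continuous. Qed.

Lemma dot_continuous (T : topologicalType) n (f g : T -> 'cV[R]_n) :
  (forall i, continuous (fun x => f x i 0)) ->
  (forall i, continuous (fun x => g x i 0)) ->
  continuous (fun x => dot (f x) (g x)).
Proof.
move=> cf cg x.
rewrite (_ : (fun _ => _) = fun x => \sum_(i < n) f x i 0 * g x i 0); last first.
  by apply/funext => y; rewrite dotE.
apply: (cvg_big (op := +%R)) => [|i _]; first exact: add_continuous.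
by apply: cvgM; [exact: cf|exact: cg].
Qed.

Lemma mulmx_continuous (T : topologicalType) m n (A : 'M[R]_(m, n))
    (f : T -> 'cV[R]_n) i :
  (forall i, continuous (fun x => f x i 0)) ->
  continuous (fun x => (A *m f x) i 0).
Proof.
move=> cf x.
rewrite (_ : (fun _ => _) = fun x => dot (\col_j A i j) (f x)); last first.
  by apply/funext => y; rewrite dotE mxE; apply: eq_bigr => j _; rewrite mxE.
by apply: dot_continuous => // j y; exact: cvg_cst.
Qed.

(** The Rayleigh quotient attains its minimum on the compact unit sphere, and the minimiser is an
    eigenvector. The size is a successor because the sphere must be nonempty; vectors are rows
    because [eigenvalue] concerns row vectors. *)
Lemma eigenvalue_coercive n (A : 'M[R]_n.+1) :
  A^T = A -> exists2 a, eigenvalue A a & coercive a A.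
Proof.
move=> sA.
pose S := [set v : 'rV[R]_n.+1 | dot v^T v^T = 1].
have c1 i : continuous (fun v : 'rV[R]_n.+1 => v^T i 0).
  rewrite (_ : (fun _ => _) = fun v : 'rV[R]_n.+1 => v 0 i).
    exact: entry_continuous.
  by apply/funext => v; rewrite mxE.
have S0 : S !=set0.
  exists (delta_mx 0 0); rewrite /S/= dotE (bigD1 0)//= big1 ?addr0 ?mxE ?eqxx ?mulr1//.
  by move=> j ji; rewrite !mxE (negbTE ji) mulr0.
have Scl : closed S.
  apply: (@preimage_closed _ _ (fun v : 'rV[R]_n.+1 => dot v^T v^T) [set 1]).
    by move=> x _; exact: dot_continuous.
  exact: closed_eq.
have Sbd : bounded_set S.
  exists 1; split=> // M M1 v; rewrite /S/= => v1.
  rewrite [leLHS]mx_normrE; apply/bigmax_leP; split=> [|[i j] _ /=].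
    by rewrite (le_trans ler01)// ltW.
  have := ler_coord_enorm v^T j; rewrite enormE v1 sqrtr1 mxE ord1 => h.
  by rewrite (le_trans h)// ltW.
have cf : {within S, continuous (fun v : 'rV[R]_n.+1 => dot v^T (A *m v^T))}.
  apply: continuous_subspaceT; apply: dot_continuous => // i.
  exact: mulmx_continuous.
have [v] := compact_EVT_min S0 (bounded_closed_compact Sbd Scl) cf.
rewrite inE /S/= => v1 vmin; set a := dot v^T (A *m v^T) in vmin.
have cA : coercive a A.
  move=> u; have [u0|u0] := eqVneq (dot u u) 0.
    by rewrite (dot_eq0 u0) mulmx0 !dot0r mulr0.
  have up : 0 < dot u u by rewrite lt_def u0 dot_ge0.
  pose s := Num.sqrt (dot u u); have sp : 0 < s by rewrite sqrtr_gt0.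
  have s2 : s ^+ 2 = dot u u by rewrite sqr_sqrtr// ltW.
  have := vmin (s^-1 *: u)^T; rewrite inE /S/= trmxK => /(_ _).
  rewrite -scalemxAr !(dotZl, dotZr) mulrA -expr2 exprVn -s2 mulVf ?expf_neq0 ?gt_eqF//.
  move=> /(_ erefl); rewrite mulrA -expr2 exprVn mulrC.
  by rewrite ler_pdivlMr ?exprn_gt0.
exists a => //; apply/eigenvalueP; exists v; last first.
  by apply/eqP => v0; move: v1; rewrite v0 trmx0 dot0r => /eqP; rewrite eq_sym oner_eq0.
have [w wE] : exists w, A *m v^T = w + a *: v^T.
  by exists (A *m v^T - a *: v^T); rewrite subrK.
suff w0 : w = 0.
  by move: wE; rewrite w0 add0r => /(congr1 trmx); rewrite trmx_mul trmxK sA linearZ/= trmxK.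
have vw : dot v^T w = 0.
  have /eqP := erefl a; rewrite {1}/a wE dotDr dotZr v1 mulr1.
  by rewrite -subr_eq0 addrK => /eqP.
(* Minimality along [v + t w] forces [0 <= 2 t |w|^2 + O(t^2)] for every t. *)
have key t : 0 <= 2 * t * dot w w + t ^+ 2 * (dot w (A *m w) - a * dot w w).
  have := cA (v^T + t *: w).
  rewrite mulmxDr -scalemxAr !(dotDl, dotDr, dotZl, dotZr) v1 (dotC w v^T) vw -/a.
  have -> : dot v^T (A *m w) = dot w w.
    by rewrite dot_mulmxr sA wE dotDl dotZl vw mulr0 addr0.
  have -> : dot w (A *m v^T) = dot w w.
    by rewrite wE dotDr dotZr (dotC w v^T) vw mulr0 addr0.
  rewrite -subr_ge0 => h; apply: (le_trans h).
  by rewrite le_eqVlt; apply/orP; left; apply/eqP; ring.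
apply: dot_eq0; apply/eqP; apply: contraTT isT => ww0.
have wp : 0 < dot w w by rewrite lt_def ww0 dot_ge0.
set K := dot w (A *m w) - a * dot w w in key.
have K1 : 0 < 1 + `|K| by rewrite ltr_pwDl.
(* At [- t] the linear term is [- 2 t^2 (1 + |K|)], which dominates the quadratic term [t^2 K]. *)
pose t := dot w w / (1 + `|K|).
have tK : t * (1 + `|K|) = dot w w by rewrite divfK// gt_eqF.
have t0 : 0 < t by rewrite divr_gt0.
have := key (- t); rewrite sqrrN -tK.
have := ler_wpM2l (sqr_ge0 t) (ler_norm K); have := exprn_gt0 2 t0.
have := mulr_ge0 (sqr_ge0 t) (normr_ge0 K); nra.
Qed.

Lemma eigenvalue_le n (A : 'M[R]_n) K b : A^T = A ->
  (forall v, dot v (A *m v) <= K * dot v v) -> eigenvalue A b -> b <= K.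
Proof.
move=> sA AK /eigenvalueP[v vA v0].
have vp : 0 < dot v^T v^T.
  by rewrite lt_def dot_ge0 andbT; apply: contra_neq v0 => /dot_eq0/eqP; rewrite trmx_eq0 => /eqP.
have := AK v^T; have -> : A *m v^T = b *: v^T.
  by rewrite -[A in LHS]sA -trmx_mul vA linearZ.
by rewrite dotZr ler_pM2r.
Qed.

Lemma eigenvalue_ge n (A : 'M[R]_n) c b : A^T = A ->
  coercive c A -> eigenvalue A b -> c <= b.
Proof.
move=> sA cA /eigenvalueP[v vA v0].
have vp : 0 < dot v^T v^T.
  by rewrite lt_def dot_ge0 andbT; apply: contra_neq v0 => /dot_eq0/eqP; rewrite trmx_eq0 => /eqP.
have := cA v^T; have -> : A *m v^T = b *: v^T.
  by rewrite -[A in LHS]sA -trmx_mul vA linearZ.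
by rewrite dotZr ler_pM2r.
Qed.

Lemma lambda_min_coercive n (A : 'M[R]_n) :
  (0 < n)%N -> A^T = A -> coercive (lambda_min A) A.
Proof.
case: n A => // n A _ sA; have [a ea ca] := eigenvalue_coercive sA.
suff -> : lambda_min A = a by [].
apply/eqP; rewrite eq_le; apply/andP; split.
  by apply: ge_inf => //; exists a => b /= eb; exact: eigenvalue_ge eb.
by apply: lb_le_inf; [exists a|move=> b /= eb; exact: eigenvalue_ge eb].
Qed.

Lemma lambda_max_ge n (A : 'M[R]_n) v :
  (0 < n)%N -> A^T = A -> dot v (A *m v) <= lambda_max A * dot v v.
Proof.
case: n A v => // n A v _ sA; have [|a /eigenvalueP[u uA u0] ca] := @eigenvalue_coercive n (- A).
  by rewrite linearN /= sA.
have Aa w : dot w (A *m w) <= (- a) * dot w w.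
  by have := ca w; rewrite mulNmx dotNr mulNr; lra.
have ea : eigenvalue A (- a).
  apply/eigenvalueP; exists u => //; apply: oppr_inj.
  by rewrite -mulmxN uA scaleNr opprK.
suff -> : lambda_max A = - a by [].
apply/eqP; rewrite eq_le; apply/andP; split.
  by apply: ge_sup; [exists (- a)|move=> b /= eb; exact: eigenvalue_le eb].
by apply: ub_le_sup => //; exists (- a) => b /= eb; exact: eigenvalue_le eb.
Qed.

(** A matrix of size zero has no eigenvalue and [inf] of the empty set is 0. Positivity of [k] and
    [q] is read off the hypotheses in this way. *)
Lemma lambda_min_neq0 n (A : 'M[R]_n) : lambda_min A != 0 -> (0 < n)%N.
Proof.
case: n A => // A; apply: contra_neqT => _.
rewrite /lambda_min (_ : [set a | _] = set0) ?inf0//.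
apply/seteqP; split=> // a /= /eigenvalueP[v _ /eqP []].
by apply/matrixP => i [].
Qed.

End Spectral.

(** * Deterministic approximation of QLR *)

Section Deterministic.
Context {R : realType}.

Lemma dot_inv_dist n c (S : 'M[R]_n) v w : 0 < c -> coercive c S ->
  `|dot v (invmx S *m v) - dot w (invmx S *m w)|
  <= c^-1 * (enorm (v - w) * (enorm v + enorm w)).
Proof.
move=> c0 cS.
have -> : dot v (invmx S *m v) - dot w (invmx S *m w) =
    dot (v - w) (invmx S *m v) + dot w (invmx S *m (v - w)).
  rewrite mulmxBr !(dotDl, dotDr, dotNl, dotNr); ring.
rewrite (le_trans (ler_normD _ _))// mulrDr mulrDr.
apply: lerD; rewrite (le_trans (cauchy_schwarz _ _))//.
  by rewrite mulrCA ler_wpM2l ?enorm_ge0//; exact: coercive_inv.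
rewrite mulrA mulrAC -mulrA [leRHS]mulrC -mulrA ler_wpM2l ?enorm_ge0// mulrC.
exact: coercive_inv.
Qed.

Lemma dot_invmx_factor n (A W : 'M[R]_n) v : W \in unitmx -> A *m A^T = W ->
  dot v (invmx W *m v) = dot (invmx A *m v) (invmx A *m v).
Proof.
move=> + WE; rewrite -WE unitmx_mul unitmx_tr andbb => Au.
have -> : invmx (A *m A^T) = (invmx A)^T *m invmx A.
  rewrite trmx_inv; apply: (can_inj (mulKmx (_ : A *m A^T \in unitmx))).
    by rewrite unitmx_mul unitmx_tr Au.
  rewrite mulmxV ?unitmx_mul ?unitmx_tr ?Au//.
  by rewrite mulmxA -(mulmxA A) mulmxV ?unitmx_tr// mulmx1 mulmxV.
by rewrite -mulmxA dot_mulmxr trmxK.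
Qed.

(** The properties delivered by [least_squares]: [|B y|] is the length of the orthogonal projection
    of [y] on the range of [N]. *)
Definition projector_for q k (N : 'M[R]_(k, q)) (B : 'M[R]_(q, k)) :=
  B *m B^T = 1%:M /\
  forall y, (forall b : 'cV_q, dot y y - dot (B *m y) (B *m y)
                               <= dot (y + N *m b) (y + N *m b)) /\
    exists b : 'cV_q, dot (y + N *m b) (y + N *m b)
                      = dot y y - dot (B *m y) (B *m y).

Section fixed_index.
Variables (q k : nat) (Theta : set 'cV[R]_q) (theta0 : 'cV[R]_q).

(** The deterministic hypotheses for one measure and one sample size, all tolerances expressed by
    the same [eta]. [rd_id] is identification condition (iii) in the form used: a bounded [M b]
    forces [b] into the ball. *)
Record regular_design (c K eta delta : R) (m : 'cV[R]_q -> 'cV[R]_k)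
    (Sigma : 'cV[R]_q -> 'cV[R]_q -> 'M[R]_k) (M : 'M[R]_(k, q)) : Prop := {
  rd_delta : 0 < delta;
  rd_ball : forall t, enorm (t - theta0) <= delta -> Theta t;
  rd_coercive : forall t, Theta t -> coercive c (Sigma t t);
  rd_bound : forall t s, Theta t -> Theta s -> mxbound K (Sigma t s);
  rd_m0 : m theta0 = 0;
  rd_far : forall t, Theta t -> delta < enorm (t - theta0) ->
    eta^-1 <= dot (m t) (invmx (Sigma t t) *m m t);
  rd_lin : forall t, Theta t -> enorm (t - theta0) <= delta ->
    enorm (m t - M *m (t - theta0)) <= eta;
  rd_id : forall b, enorm b <= delta * eta * enorm (M *m b);
  rd_diag : forall t, Theta t -> enorm (t - theta0) <= delta ->
    mxbound eta (Sigma t t - Sigma theta0 theta0);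
  rd_col : forall t, Theta t -> enorm (t - theta0) <= delta ->
    mxbound eta (Sigma t theta0 - Sigma theta0 theta0) }.

(** The two path properties that (v) and (vi) give for [G] with high probability, and that the
    transfer carries over to [g - m]. *)
Definition tame C eta delta (x : 'cV[R]_q -> 'cV[R]_k) : Prop :=
  (forall t, Theta t -> enorm (x t) <= C) /\
  (forall t, Theta t -> enorm (t - theta0) <= delta ->
     enorm (x t - x theta0) <= eta).

Definition close_to eta (S Sigma : 'cV[R]_q -> 'cV[R]_q -> 'M[R]_k) : Prop :=
  forall t s, Theta t -> Theta s -> mxbound eta (S t s - Sigma t s).

Lemma rd_theta0 c K eta delta m Sigma M :
  regular_design c K eta delta m Sigma M -> Theta theta0.
Proof.
move=> D; apply: (rd_ball D); by rewrite subrr enorm0 (ltW (rd_delta D)).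
Qed.

Lemma rd_weaken c K eta eta' delta m Sigma M : 0 < eta -> eta <= eta' ->
  regular_design c K eta delta m Sigma M ->
  regular_design c K eta' delta m Sigma M.
Proof.
move=> e0 ee [d0 ball co bo m0 far lin id diag col]; split=> //.
- move=> t Tt td; apply: le_trans (far _ Tt td).
  by rewrite lef_pV2 ?posrE// (lt_le_trans e0).
- by move=> t Tt td; rewrite (le_trans (lin _ Tt td)).
- move=> b; rewrite (le_trans (id b))// ler_wpM2r ?enorm_ge0//.
  by rewrite ler_wpM2l// ltW.
- by move=> t Tt td; apply: mxbound_le (diag _ Tt td).
- by move=> t Tt td; apply: mxbound_le (col _ Tt td).
Qed.

End fixed_index.

(** [D] is a radius beyond which the quadratic form already exceeds its value at [x theta0]. The
    three conditions on [eta] respectively put the minimiser in the ball, exclude distant points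
    with a moderate value, and bound the total perturbation error by [eps / 2]. *)
Lemma QLR_approx_constants (c' c K' C eps : R) :
  0 < c' -> 0 < c -> 0 < K' -> 0 <= C -> 0 < eps ->
  exists D eta : R, [/\ 0 < eta, eta <= c', eta <= 1, C <= D &
  [/\ C ^+ 2 / c' <= c' / K' ^+ 2 * D ^+ 2, (D + C) * eta <= 1,
      (D + C) ^+ 2 / c < eta^-1 &
      3 * eta / c' ^+ 2 * (D + 2) ^+ 2 + c'^-1 * (2 * eta * (2 * D + 2))
      <= eps / 2]].
Proof.
move=> c'0 c0 K'0 C0 eps0.
have [a aE] : exists a, a = c' / K' ^+ 2 by exists (c' / K' ^+ 2).
have [Q QE] : exists Q, Q = C ^+ 2 / c' by exists (C ^+ 2 / c').
rewrite -aE -QE.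
have a0 : 0 < a by rewrite aE divr_gt0 ?exprn_gt0.
have Q0 : 0 <= Q by rewrite QE divr_ge0 ?sqr_ge0 ?ltW.
have Qa0 : 0 <= Q / a by rewrite divr_ge0// ltW.
have [D DE] : exists D, D = 1 + C + Q / a by exists (1 + C + Q / a).
have D1 : 1 <= D by rewrite DE; lra.
have CD : C <= D by rewrite DE; lra.
have aD : Q <= a * D ^+ 2.
  have DQ : Q / a <= D by rewrite DE; lra.
  rewrite mulrC -ler_pdivrMr// (le_trans DQ)// expr2 ler_peMr//; lra.
have [L LE] : exists L, L = 3 / c' ^+ 2 * (D + 2) ^+ 2 + c'^-1 * (2 * (2 * D + 2)).
  by exists (3 / c' ^+ 2 * (D + 2) ^+ 2 + c'^-1 * (2 * (2 * D + 2))).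
have L0 : 0 <= L.
  rewrite LE; apply: addr_ge0; rewrite mulr_ge0 ?invr_ge0 ?(ltW c'0)//.
  - by rewrite divr_ge0// sqr_ge0.
  - exact: sqr_ge0.
  - lra.
(* The final [eta] is [1 / h]; each summand of [h] secures one of the required inequalities. *)
have [h hE] : exists h, h = 1 + c'^-1 + (D + C) + (D + C) ^+ 2 / c + 2 * L / eps.
  by exists (1 + c'^-1 + (D + C) + (D + C) ^+ 2 / c + 2 * L / eps).
have h2 : 0 < c'^-1 by rewrite invr_gt0.
have h4 : 0 <= (D + C) ^+ 2 / c by rewrite divr_ge0 ?sqr_ge0// ltW.
have h5 : 0 <= 2 * L / eps by rewrite divr_ge0 ?mulr_ge0// ltW.
have h0 : 0 < h by rewrite hE; lra.
have etah t : t <= h -> t * h^-1 <= 1 by move=> th; rewrite ler_pdivrMr// mul1r.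
exists D, h^-1; split=> //; first by rewrite invr_gt0.
- by rewrite -[leRHS]invrK lef_pV2 ?posrE// hE; lra.
- by have := etah 1; rewrite mul1r; apply; rewrite hE; lra.
split=> //; first by apply: etah; rewrite hE; lra.
- by rewrite invrK hE; lra.
have : 2 * L / eps * h^-1 <= 1 by apply: etah; rewrite hE; lra.
have -> : 3 * h^-1 / c' ^+ 2 * (D + 2) ^+ 2 + c'^-1 * (2 * h^-1 * (2 * D + 2))
  = L * h^-1 by rewrite LE; ring.
by rewrite mulrAC ler_pdivrMr//; lra.
Qed.

(** [QLR] is the form at [x theta0] minus an infimum close to the least-squares minimum [mu], and
    this difference is [|B A^-1 x theta0|^2]. Only the diagonal values [S t t] enter, and [A] is
    tied to [Sigma theta0 theta0] only up to [eta]. *)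
Lemma QLR_approx c K C eps : 0 < c -> 0 < K -> 0 <= C -> 0 < eps ->
  exists2 eta, 0 < eta &
  forall q k (Theta : set 'cV[R]_q) theta0 delta m Sigma M
    (x : 'cV[R]_q -> 'cV[R]_k) S A (B : 'M[R]_(q, k)),
  regular_design Theta theta0 c K eta delta m Sigma M ->
  tame Theta theta0 C eta delta x ->
  (forall t, Theta t -> mxbound eta (S t t - Sigma t t)) ->
  mxbound eta (A *m A^T - Sigma theta0 theta0) ->
  projector_for (invmx A *m M) B ->
  ((enorm (B *m (invmx A *m x theta0)) ^+ 2 - eps)%:E
   <= QLR Theta theta0 (fun t => x t + m t)%R S
   <= (enorm (B *m (invmx A *m x theta0)) ^+ 2 + eps)%:E)%E.
Proof.
move=> c0 K0 C0 eps0.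
(* Half of the coercivity is kept in reserve: a perturbation of size [eta <= c'] still leaves
   [c']. *)
have [c' cE] : exists c', c = c' + c' by exists (c / 2); rewrite -splitr.
have c'0 : 0 < c' by lra.
have [K' K'E] : exists K', K' = K + c by exists (K + c).
have K'0 : 0 < K' by lra.
have [D [eta [eta0 etac eta1 CD [aD etaD etaF etaL]]]] :=
  QLR_approx_constants c'0 c0 K'0 C0 eps0.
have [a aE] : exists a, a = c' / K' ^+ 2 by exists (c' / K' ^+ 2).
have [Q QE] : exists Q, Q = C ^+ 2 / c' by exists (C ^+ 2 / c').
rewrite -aE -QE in aD.
have a0 : 0 < a by rewrite aE divr_gt0 ?exprn_gt0.
have c'eta : c' <= c - eta by lra.
have K'eta : K + eta <= K' by lra.
have D0 : 0 <= D by lra.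
have DC0 : 0 <= D + C by lra.
exists eta => // q k Theta theta0 delta m Sigma M x S A B.
move=> RD [xC xnear] SS AS [BB BP]; set Y := enorm _ ^+ 2.
have Th0 := rd_theta0 RD.
have cS t : Theta t -> coercive c' (S t t).
  move=> Tt v; apply: le_trans (coercive_perturb (rd_coercive RD Tt) (SS _ Tt) v).
  by rewrite ler_wpM2r ?dot_ge0.
have bS t : Theta t -> mxbound K' (S t t).
  move=> Tt; rewrite -[S t t](subrK (Sigma t t)) addrC.
  exact: mxbound_le (mxboundD (rd_bound RD Tt Tt) (SS _ Tt)).
pose W := A *m A^T.
have cW : coercive c' W.
  move=> v; apply: le_trans (coercive_perturb (rd_coercive RD Th0) AS v).
  by rewrite ler_wpM2r ?dot_ge0.
have bW : mxbound K' W.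
  rewrite -[W](subrK (Sigma theta0 theta0)) addrC.
  exact: mxbound_le (mxboundD (rd_bound RD Th0 Th0) AS).
have Wu := coercive_unit c'0 cW.
have [nS nSE] : exists nS, forall t v, nS t v = dot v (invmx (S t t) *m v).
  by exists (fun t v => dot v (invmx (S t t) *m v)).
have [nW nWW] : exists nW, forall v, nW v = dot v (invmx W *m v).
  by exists (fun v => dot v (invmx W *m v)).
have nWE v : nW v = dot (invmx A *m v) (invmx A *m v).
  by rewrite nWW; exact: dot_invmx_factor.
have nS_ge t v : Theta t -> a * enorm v ^+ 2 <= nS t v.
  by move=> Tt; rewrite nSE aE enorm_sqr; apply: dot_inv_ge => //; [exact: cS|exact: bS].
have nW_ge v : a * enorm v ^+ 2 <= nW v.
  by rewrite nWW aE enorm_sqr; apply: dot_inv_ge.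
have nSW t v E : Theta t -> enorm (t - theta0) <= delta -> enorm v <= E ->
    `|nS t v - nW v| <= 3 * eta / c' ^+ 2 * E ^+ 2.
  move=> Tt td vE; have b3 : mxbound (3 * eta) (S t t - W).
    have -> : S t t - W = (S t t - Sigma t t) + (Sigma t t - Sigma theta0 theta0)
        + - (W - Sigma theta0 theta0).
      by rewrite opprB !addrA subrK subrK.
    apply: mxbound_le (mxboundD (mxboundD (SS _ Tt) (rd_diag RD Tt td)) (mxboundN AS)).
    by clear; lra.
  rewrite nSE nWW (le_trans (dot_inv_sub _ c'0 (cS _ Tt) cW b3))// -enorm_sqr ler_wpM2l//.
    by rewrite divr_ge0 ?sqr_ge0// mulr_ge0 ?(ltW eta0).
  by rewrite lerXn2r ?nnegrE ?enorm_ge0// (le_trans (enorm_ge0 v)).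
have x0C := xC _ Th0.
have nWx0 : nW (x theta0) <= Q.
  rewrite nWW QE (le_trans (dot_inv_le _ c'0 cW))// -enorm_sqr mulrC ler_wpM2r//.
    by rewrite invr_ge0 ltW.
  by rewrite lerXn2r ?nnegrE ?enorm_ge0.
(* [mu] is the minimum over [b] of the [W]-form at [x theta0 + M b], so the form at [x theta0] minus
   [mu] is [Y]. *)
pose y := invmx A *m x theta0; have [mu muY] : exists mu, mu = nW (x theta0) - Y by exists (nW (x theta0) - Y).
have YE : Y = dot (B *m y) (B *m y) by rewrite /Y enorm_sqr.
have muE : mu = dot y y - dot (B *m y) (B *m y) by rewrite muY YE nWE.
have Y0 : 0 <= Y by exact: sqr_ge0.
have [BPle [b bE]] := BP y.
have nWlin b' : nW (x theta0 + M *m b') =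
    dot (y + (invmx A *m M) *m b') (y + (invmx A *m M) *m b').
  by rewrite nWE mulmxDr mulmxA.
pose v t := x t + m t.
have vnear t : Theta t -> enorm (t - theta0) <= delta ->
    enorm (v t - (x theta0 + M *m (t - theta0))) <= 2 * eta.
  move=> Tt td; rewrite /v opprD addrACA (le_trans (ler_enormD _ _))//.
  by have := xnear _ Tt td; have := rd_lin RD Tt td; clear; lra.
have compare t : Theta t -> enorm (t - theta0) <= delta ->
    enorm (x theta0 + M *m (t - theta0)) <= D + 2 ->
    enorm (v t) <= D + 2 ->
    enorm (v t) + enorm (x theta0 + M *m (t - theta0)) <= 2 * D + 2 ->
    `|nS t (v t) - nW (x theta0 + M *m (t - theta0))| <= eps / 2.
  move=> Tt td v'D vD vvD; set v' := x theta0 + _ in v'D vvD *.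
  have -> : nS t (v t) - nW v' = (nS t (v t) - nW (v t)) + (nW (v t) - nW v').
    by rewrite addrA subrK.
  apply: le_trans (ler_normD _ _) _; apply: le_trans etaL.
  apply: lerD; first exact: nSW Tt td vD.
  rewrite !nWW (le_trans (dot_inv_dist _ _ c'0 cW))// ler_wpM2l//.
    by rewrite invr_ge0 ltW.
  rewrite ler_pM ?enorm_ge0 ?addr_ge0 ?enorm_ge0//.
  exact: vnear.
(* Three cases. A value of norm at least [D] has a form above [Q >= mu]; a smaller value at a
   distant point would bound [m t] and contradict [rd_far]; at a near point the form is compared
   with the linear model. *)
have lower t : Theta t -> mu - eps / 2 <= nS t (v t).
  move=> Tt; have [vD|vD] := leP D (enorm (v t)).
    have : a * D ^+ 2 <= a * enorm (v t) ^+ 2.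
      by rewrite ler_wpM2l ?(ltW a0)// lerXn2r ?nnegrE ?enorm_ge0 ?(ltW vD)//.
    have := nS_ge _ (v t) Tt; move: aD nWx0 Y0 eps0; rewrite muY; clear; lra.
  have mD : enorm (m t) <= D + C.
    have -> : m t = v t - x t by rewrite /v addrC addKr.
    by have := ler_enormB (v t) (x t); have := xC _ Tt; move: vD; clear; lra.
  have [td|td] := leP (enorm (t - theta0)) delta; last first.
    have := rd_far RD Tt td; have := dot_inv_le (m t) c0 (rd_coercive RD Tt).
    rewrite -enorm_sqr => h6 h7; exfalso.
    have : c^-1 * enorm (m t) ^+ 2 <= (D + C) ^+ 2 / c.
      rewrite mulrC ler_wpM2r ?invr_ge0 ?(ltW c0)//.
      by rewrite lerXn2r ?nnegrE ?enorm_ge0.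
    move: h6 h7 etaF; clear; lra.
  have v'D : enorm (x theta0 + M *m (t - theta0)) <= enorm (v t) + 2 * eta.
    have := ler_enorm_sub (x theta0 + M *m (t - theta0)) (v t).
    by rewrite enormB; have := vnear _ Tt td; clear; lra.
  have : `|nS t (v t) - nW (x theta0 + M *m (t - theta0))| <= eps / 2.
    by apply: compare => //; move: v'D vD eta1; clear; lra.
  rewrite ler_distl => /andP[+ _]; have := BPle (t - theta0); rewrite -nWlin -muE; clear; lra.
(* The witness is [theta0 + b] for the least-squares minimiser [b]. Its form value [mu <= Q] gives
   [|x theta0 + M b| <= D], hence [|M b| <= D + C], and [rd_id] places [b] in the ball. *)
have [t Tt upper] : exists2 t, Theta t & nS t (v t) <= mu + eps / 2.
  have v'D : enorm (x theta0 + M *m b) <= D.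
    rewrite -(@ler_pXn2r _ 2) ?nnegrE ?enorm_ge0//.
    rewrite -(ler_pM2l a0) (le_trans (nW_ge _))// nWlin bE -muE.
    by apply: le_trans aD; move: nWx0 Y0; rewrite muY; clear; lra.
  have bd : enorm b <= delta.
    rewrite (le_trans (rd_id RD b))// -mulrA ler_piMr ?(ltW (rd_delta RD))//.
    apply: le_trans etaD; rewrite mulrC ler_wpM2r ?(ltW eta0)//.
    have -> : M *m b = (x theta0 + M *m b) - x theta0 by rewrite addrC addKr.
    by have := ler_enormB (x theta0 + M *m b) (x theta0); move: v'D x0C; clear; lra.
  have tb : (theta0 + b) - theta0 = b by rewrite addrC addKr.
  have td : enorm (theta0 + b - theta0) <= delta by rewrite tb.
  have Tt := rd_ball RD td.
  exists (theta0 + b) => //.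
  have vD : enorm (v (theta0 + b)) <= enorm (x theta0 + M *m b) + 2 * eta.
    have := vnear _ Tt td; rewrite tb.
    by have := ler_enorm_sub (v (theta0 + b)) (x theta0 + M *m b); clear; lra.
  have : `|nS (theta0 + b) (v (theta0 + b)) - nW (x theta0 + M *m b)| <= eps / 2.
    by have := compare _ Tt td; rewrite tb; apply=> //; move: v'D vD eta1; clear; lra.
  rewrite ler_distl nWlin bE -muE; clear; lra.
have n0 : `|nS theta0 (x theta0) - nW (x theta0)| <= eps / 2.
  have t0 : enorm (theta0 - theta0) <= delta.
    by rewrite subrr enorm0 ltW// (rd_delta RD).
  have x0D : enorm (x theta0) <= D + 2 by move: x0C CD; clear; lra.
  apply: le_trans (nSW _ _ _ Th0 t0 x0D) _; apply: le_trans etaL.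
  rewrite lerDl mulr_ge0 ?invr_ge0 ?(ltW c'0)// mulr_ge0 ?mulr_ge0 ?(ltW eta0)//.
  by move: D0; clear; lra.
rewrite /QLR; set I := ereal_inf _.
have Ilo : ((mu - eps / 2)%:E <= I)%E.
  by apply: le_ereal_inf_tmp => _ [t' Tt' <-]; rewrite lee_fin qformE -nSE lower.
have Iup : (I <= (mu + eps / 2)%:E)%E.
  by apply: ge_ereal_inf; exists (qform (invmx (S t t)) (v t))%:E;
    [exists t|rewrite lee_fin qformE -nSE].
move: Ilo Iup; case: I => [i| |]; rewrite ?lee_fin//= => Ilo Iup.
rewrite qformE (rd_m0 RD) addr0 -nSE.
by move: n0 Ilo Iup; rewrite ler_distl muY; clear; lra.
Qed.

End Deterministic.

(** * Rotation invariance of the standard Gaussian law *)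

Section Lebesgue_shear.
Context {R : realType}.
Local Notation mu := (@lebesgue_measure R).
Local Notation MR := (measurableTypeR R).
Local Open Scope ereal_scope.

Definition translate (a : R) : MR -> MR := fun x => (x + a)%R.

Lemma measurable_translate a : measurable_fun [set: MR] (translate a).
Proof. exact: measurable_funD. Qed.

HB.instance Definition _ a :=
  isMeasurableFun.Build _ _ MR MR (translate a) (measurable_translate a).

Lemma lebesgue_measure_translation (a : R) (A : set MR) : measurable A ->
  mu A = pushforward mu (translate a) A.
Proof.
apply: lebesgue_measure_unique => _ [[u v] /= uv <-].
rewrite /pushforward (_ : _ @^-1` _ = `]u - a, v - a]%classic)%R; last first.
  by apply/seteqP; split => x; rewrite /= /translate !in_itv/= ltrBlDr lerBrDr.
rewrite !lebesgue_measure_itv/= !lte_fin ltrD2r.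
by case: ifP => // _; rewrite -!EFinB; congr EFin; ring.
Qed.

Lemma integral_translation (a : R) (f : R -> \bar R) :
  measurable_fun [set: MR] f -> (forall x, 0 <= f x) ->
  \int[mu]_x f (x + a)%R = \int[mu]_x f x.
Proof.
move=> mf f0.
have -> : \int[mu]_x f x = \int[pushforward mu (translate a)]_x f x.
  by apply: eq_measure_integral => /= A mA _; exact: lebesgue_measure_translation.
by rewrite ge0_integral_pushforward//= => y _.
Qed.

(** An iterated integral, so that a shear acts as a translation in the inner variable. *)
Definition iint (H : R * R -> \bar R) := \int[mu]_x \int[mu]_y H (x, y).

Lemma iint_shear2 (b : R) (H : R * R -> \bar R) :
  measurable_fun [set: MR * MR] H -> (forall p, 0 <= H p) ->
  iint (fun p => H (p.1, p.2 + b * p.1)%R) = iint H.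
Proof.
move=> mH H0; apply: eq_integral => x _ /=.
apply: (integral_translation (b * x)%R (f := fun y => H (x, y))) => //.
exact: measurableT_comp.
Qed.

Lemma iint_swap (H : R * R -> \bar R) :
  measurable_fun [set: MR * MR] H -> (forall p, 0 <= H p) ->
  iint H = iint (fun p => H (p.2, p.1)).
Proof. by move=> mH H0; rewrite /iint fubini_tonelli. Qed.

Lemma iint_shear1 (a : R) (H : R * R -> \bar R) :
  measurable_fun [set: MR * MR] H -> (forall p, 0 <= H p) ->
  iint (fun p => H (p.1 + a * p.2, p.2)%R) = iint H.
Proof.
move=> mH H0.
have m2 : measurable_fun [set: MR * MR] (fun p : MR * MR => H (p.2, p.1)).
  by apply: (measurableT_comp mH); exact: measurable_swap.
have m1 : measurable_fun [set: MR * MR]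
    (fun p : MR * MR => H (p.1 + a * p.2, p.2)%R).
  apply: (measurableT_comp mH); apply: measurable_fun_pair => //=.
  by apply: measurable_funD => //; exact: measurable_funM.
apply: (eq_trans (iint_swap m1 (fun=> H0 _))).
apply: (eq_trans (iint_shear2 a m2 (fun=> H0 _))).
exact: esym (iint_swap mH H0).
Qed.

Lemma iint_rotation (c s : R) (H : R * R -> \bar R) :
  (c ^+ 2 + s ^+ 2 = 1)%R -> (0 <= c)%R ->
  measurable_fun [set: MR * MR] H -> (forall p, 0 <= H p) ->
  iint (fun p => H (c * p.1 - s * p.2, s * p.1 + c * p.2)%R) = iint H.
Proof.
(* [t] is the tangent of half the angle. The rotation is the horizontal shear by [- t], the vertical
   shear by [s] and the first shear again; [0 <= c] keeps [1 + c] away from zero. *)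
move=> cs c0 mH H0; pose t := (s / (1 + c))%R.
have c1 : (1 + c != 0)%R by rewrite gt_eqF// ltr_pwDl.
pose H1 p := H (p.1 + (- t) * p.2, p.2)%R.
have mH1 : measurable_fun [set: MR * MR] H1.
  apply: (measurableT_comp mH); apply: measurable_fun_pair => //=.
  by apply: measurable_funD => //; exact: measurable_funM.
pose H2 p := H1 (p.1, p.2 + s * p.1)%R.
have mH2 : measurable_fun [set: MR * MR] H2.
  apply: (measurableT_comp mH1); apply: measurable_fun_pair => //=.
  by apply: measurable_funD => //; exact: measurable_funM.
have H10 p : 0 <= H1 p by exact: H0.
have H20 p : 0 <= H2 p by exact: H0.
rewrite -(iint_shear1 (- t) mH H0) -(iint_shear2 s mH1 H10).
rewrite -(iint_shear1 (- t) mH2 H20).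
congr iint; apply/funext => -[x y] /=; rewrite /H2 /H1 /=.
have ts : (s * t = 1 - c)%R.
  rewrite /t mulrA -expr2; apply: (mulIf c1); rewrite divfK//.
  by rewrite -(addrK (c ^+ 2) (s ^+ 2))%R addrC [X in (_ + X)%R]addrC cs; ring.
have tc : (t * (1 + c) = s)%R by rewrite /t divfK.
(* Vanishing multiples of the two trigonometric relations, from which both coordinate identities
   follow linearly. *)
have e1 z : ((s * t - (1 - c)) * z = 0)%R by rewrite ts subrr mul0r.
have e2 z : ((t * (1 + c) - s) * z = 0)%R by rewrite tc subrr mul0r.
congr (H (_, _)).
  by have := e1 x; have := e1 (t * y)%R; have := e2 y; lra.
by have := e1 y; lra.
Qed.

End Lebesgue_shear.

Section Normal_rotation.
Context {R : realType}.
Local Notation mu := (@lebesgue_measure R).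
Local Notation MR := (measurableTypeR R).
Local Notation N01 := (normal_prob (0 : R) 1).
Local Open Scope ereal_scope.

Lemma measurable_normal_pdfE :
  measurable_fun [set: MR] (fun x : MR => (normal_pdf 0 1 x)%:E).
Proof. by apply/measurable_EFinP; exact: measurable_normal_pdf. Qed.

(** The bound by 1 supplies the integrability that the Radon-Nikodym change of measure asks for;
    later integrands are probabilities of slices. *)
Lemma integral_std_normal (f : R -> \bar R) :
  measurable_fun [set: MR] f -> (forall x, 0 <= f x <= 1) ->
  \int[N01]_x f x = \int[mu]_x (f x * (normal_pdf 0 1 x)%:E).
Proof.
move=> mf f01.
have dom : N01 `<< mu := normal_prob_dominates 0 1.
have intf : (N01 : {measure set MR -> \bar R}).-integrable [set: MR] f.
  apply/integrableP; split=> //.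
  apply: (@le_lt_trans _ _ (\int[N01]_y cst 1 y)).
    apply: ge0_le_integral => //=; first exact: measurableT_comp.
    by move=> y _; case/andP: (f01 y) => f0 f1; rewrite gee0_abs.
  by rewrite integral_cst//= probability_setT mul1e ltry.
rewrite -(Radon_Nikodym_change_of_variables dom)//=.
apply: ae_eq_integral => //.
- exact: emeasurable_funM.
- by apply: emeasurable_funM => //; exact: measurable_normal_pdfE.
- apply: ae_eqe_mul2l => /=; rewrite Radon_NikodymE//=.
  case: cid => /= h [h1 h2 h3]; apply: integral_ae_eq => //=.
    exact: measurable_normal_pdfE.
  by move=> E _ mE; rewrite -h3.
Qed.

Lemma normal_pdf_rotation (c s x y : R) : (c ^+ 2 + s ^+ 2 = 1)%R ->
  (normal_pdf 0 1 (c * x - s * y) * normal_pdf 0 1 (s * x + c * y)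
   = normal_pdf 0 1 x * normal_pdf 0 1 y)%R.
Proof.
move=> cs; rewrite !normal_pdfE ?oner_eq0// /normal_fun !subr0.
rewrite mulrACA [RHS]mulrACA -!expRD; congr (_ * expR _)%R.
rewrite -!mulrDl -!opprD; congr (- _ / _)%R.
rewrite -[RHS]mul1r -cs; ring.
Qed.

Lemma integral2_std_normal (F : R * R -> \bar R) :
  measurable_fun [set: MR * MR] F -> (forall p, 0 <= F p <= 1) ->
  \int[N01]_x \int[N01]_y F (x, y)
  = iint (fun p => F p * (normal_pdf 0 1 p.1 * normal_pdf 0 1 p.2)%:E).
Proof.
move=> mF F01.
have F0 p : 0 <= F p by case/andP: (F01 p).
have mG : measurable_fun [set: MR] (fun x : MR => \int[N01]_y F (x, y)).
  exact: (measurable_fun_fubini_tonelli_F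
    (m2 := (N01 : {sigma_finite_measure set MR -> \bar R})) F).
rewrite integral_std_normal//; last first.
  move=> x; rewrite integral_ge0//=.
  apply: (@le_trans _ _ (\int[N01]_y cst 1 y)).
    apply: ge0_le_integral => //=.
    - exact: measurableT_comp.
    - by move=> y _; case/andP: (F01 (x, y)).
  by rewrite integral_cst//= probability_setT mul1e.
apply: eq_integral => x _ /=.
rewrite integral_std_normal//; last exact: measurableT_comp.
rewrite muleC -ge0_integralZl//=.
- by apply: eq_integral => y _; rewrite muleCA EFinM muleA muleC muleA.
- apply: emeasurable_funM; first exact: measurableT_comp.
  exact: measurable_normal_pdfE.
- by move=> y _; rewrite mule_ge0// lee_fin normal_pdf_ge0.
- by rewrite lee_fin normal_pdf_ge0.
Qed.

Lemma integral_normal_rotation (c s : R) (F : R * R -> \bar R) :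
  (c ^+ 2 + s ^+ 2 = 1)%R -> (0 <= c)%R ->
  measurable_fun [set: MR * MR] F -> (forall p, 0 <= F p <= 1) ->
  \int[N01]_x \int[N01]_y F (c * x - s * y, s * x + c * y)%R
  = \int[N01]_x \int[N01]_y F (x, y).
Proof.
move=> cs c0 mF F01.
have mr : measurable_fun [set: MR * MR]
    (fun p : MR * MR => (c * p.1 - s * p.2, s * p.1 + c * p.2)%R : MR * MR).
  apply: measurable_fun_pair => /=.
    by apply: measurable_funB; exact: measurable_funM.
  by apply: measurable_funD; exact: measurable_funM.
have mpp : measurable_fun [set: MR * MR]
    (fun p : MR * MR => (normal_pdf 0 1 p.1 * normal_pdf 0 1 p.2)%:E).
  apply: measurableT_comp => //; apply: measurable_funM.
    exact: (measurableT_comp (measurable_normal_pdf 0 1)).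
  exact: (measurableT_comp (measurable_normal_pdf 0 1)).
pose rot (p : R * R) := (c * p.1 - s * p.2, s * p.1 + c * p.2)%R.
have mFr : measurable_fun [set: MR * MR] (fun p : MR * MR => F (rot p)).
  exact: (measurableT_comp mF mr).
transitivity (iint (fun p => F (rot p) *
    (normal_pdf 0 1 p.1 * normal_pdf 0 1 p.2)%:E)).
  by apply: (integral2_std_normal mFr) => p; exact: F01.
transitivity (iint (fun p => F p *
    (normal_pdf 0 1 p.1 * normal_pdf 0 1 p.2)%:E)); last first.
  exact/esym/integral2_std_normal.
rewrite -(iint_rotation cs c0 (emeasurable_funM mF mpp)); last first.
  move=> p; rewrite mule_ge0//; first by case/andP: (F01 p).
  by rewrite lee_fin mulr_ge0// normal_pdf_ge0.
congr iint; apply/funext => -[x y] /=.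
by rewrite normal_pdf_rotation.
Qed.

End Normal_rotation.

Section Std_gaussian.
Context {R : realType}.
Local Notation MR := (measurableTypeR R).
Local Notation N01 := (normal_prob (0 : R) 1).
Local Notation gam := (@std_gaussian R).

Lemma std_gaussianS n (B : set (n.+1.-tuple MR)) :
  gam n.+1 B = (\int[N01]_x gam n [set z | B (cons_pair (x, z))])%E.
Proof.
rewrite /= /distribution /pushforward /product_measure1.
apply: eq_integral => x _ /=; congr (gam n _).
by apply/seteqP; split => z; rewrite /xsection /= inE.
Qed.

Lemma measurable_slice n (B : set (n.+1.-tuple MR)) x :
  measurable B -> measurable [set z : n.-tuple MR | B (cons_pair (x, z))].
Proof.
move=> mB; have mc : measurable_fun setT (fun z : n.-tuple MR => cons_pair (x, z)).
  by apply: (measurableT_comp (@measurable_cons_pair R n)); exact: measurable_fun_pair.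
by rewrite -[X in measurable X]setTI; exact: mc.
Qed.

Lemma measurable_std_gaussian_slice d (T : measurableType d) n
    (B : set (T * n.-tuple MR)) : measurable B ->
  measurable_fun setT (fun t => gam n [set z | B (t, z)]).
Proof.
move=> mB; rewrite (_ : (fun _ => _) = gam n \o xsection B).
  exact: measurable_fun_xsection.
apply/funext => t /=; congr (gam n _).
by apply/seteqP; split => z; rewrite /xsection /= inE.
Qed.

Lemma std_gaussian_slice01 n (B : set (n.-tuple MR)) : measurable B ->
  (0 <= gam n B <= 1)%E.
Proof. by move=> mB; rewrite measure_ge0 probability_le1. Qed.

Definition invariant_mx n (U : 'M[R]_n) := forall B : set (n.-tuple MR),
  measurable B -> gam n [set z | B (tuple_col (U *m col_tuple z))] = gam n B.

Lemma col_tupleK n : cancel (@col_tuple R n) (@tuple_col R n).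
Proof. by move=> z; apply: eq_from_tnth => i; rewrite tnth_mktuple mxE. Qed.

Lemma tuple_colK n : cancel (@tuple_col R n) (@col_tuple R n).
Proof. by move=> x; apply/colP => i; rewrite mxE tnth_mktuple. Qed.

Lemma measurable_sum_fun d (T : measurableType d) n (f : 'I_n -> T -> R) :
  (forall i, measurable_fun setT (f i)) ->
  measurable_fun setT (fun t => \sum_(i < n) f i t)%R.
Proof.
by move=> mf; apply: (measurable_sum (index_enum 'I_n) mf).
Qed.

Lemma measurable_mulmx_coord d (T : measurableType d) m n (A : 'M[R]_(m, n))
    (f : T -> 'cV[R]_n) i :
  (forall j, measurable_fun setT (fun t => f t j 0)) ->
  measurable_fun setT (fun t => (A *m f t) i 0).
Proof.
move=> mf; rewrite (_ : (fun _ => _) = fun t => (\sum_j A i j * f t j 0)).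
  by apply: measurable_sum_fun => j; apply: measurable_funM.
by apply/funext => t; rewrite mxE.
Qed.

Lemma measurable_col_tuple n j :
  measurable_fun setT (fun z : n.-tuple MR => col_tuple z j 0).
Proof.
rewrite (_ : (fun _ => _) = (fun z : n.-tuple MR => tnth z j)).
  exact: measurable_tnth.
by apply/funext => z; rewrite mxE.
Qed.

Lemma measurable_dot d (T : measurableType d) n (f g : T -> 'cV[R]_n) :
  (forall j, measurable_fun setT (fun t => f t j 0)) ->
  (forall j, measurable_fun setT (fun t => g t j 0)) ->
  measurable_fun setT (fun t => dot (f t) (g t)).
Proof.
move=> mf mg; rewrite (_ : (fun _ => _) = fun t => (\sum_j f t j 0 * g t j 0)).
  by apply: measurable_sum_fun => j; apply: measurable_funM.
by apply/funext => t; rewrite dotE.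
Qed.

Lemma measurable_mulmx_tuple n (U : 'M[R]_n) :
  measurable_fun setT (fun z : n.-tuple MR =>
    tuple_col (U *m col_tuple z) : n.-tuple MR).
Proof.
apply/measurable_fun_tnthP => i.
rewrite (_ : _ \o _ = fun z => (U *m col_tuple z) i 0); last first.
  by apply/funext => z /=; rewrite tnth_mktuple.
by apply: measurable_mulmx_coord => j; exact: measurable_col_tuple.
Qed.

Lemma measurable_set_mulmx n (U : 'M[R]_n) (B : set (n.-tuple MR)) :
  measurable B -> measurable [set z | B (tuple_col (U *m col_tuple z))].
Proof.
move=> mB; rewrite -[X in measurable X]setTI.
exact: (measurable_mulmx_tuple U).
Qed.

Lemma invariant_mx1 n : invariant_mx (1%:M : 'M[R]_n).
Proof.
by move=> B mB; congr (gam n _); apply/seteqP; split => z /=;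
  rewrite mul1mx col_tupleK.
Qed.

Lemma invariant_mxM n (U V : 'M[R]_n) :
  invariant_mx U -> invariant_mx V -> invariant_mx (U *m V).
Proof.
move=> iU iV B mB.
rewrite -(iU B mB) -(iV _ (measurable_set_mulmx U mB)); congr (gam n _).
by apply/seteqP; split => z /=; rewrite tuple_colK mulmxA.
Qed.

Lemma col_tuple_cons n (x : R) (z : n.-tuple R) :
  col_tuple (cons_pair (x, z)) = col_mx x%:M (col_tuple z) :> 'cV[R]_n.+1.
Proof.
apply/colP => i; rewrite !mxE; case: splitP => [j|j] ij.
  by rewrite !ord1 mxE eqxx mulr1n (tnth_nth 0) ij ord1.
by rewrite mxE !(tnth_nth 0) ij.
Qed.

Lemma tuple_col_cons n (x : 'M[R]_1) (y : 'cV[R]_n) :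
  tuple_col (col_mx x y : 'cV[R]_n.+1) = cons_pair (x 0 0, tuple_col y).
Proof.
apply: (can_inj (@col_tupleK n.+1)).
by rewrite tuple_colK col_tuple_cons tuple_colK -mx11_scalar.
Qed.

Lemma invariant_block n (U : 'M[R]_n) : invariant_mx U ->
  invariant_mx (block_mx (1%:M : 'M[R]_1) 0 0 U).
Proof.
move=> iU B mB; rewrite !std_gaussianS; apply: eq_integral => x _.
rewrite -(iU _ (measurable_slice x mB)); congr (gam n _).
apply/seteqP; split => z /=; rewrite col_tuple_cons mul_block_col !mul0mx;
  by rewrite addr0 add0r mul1mx tuple_col_cons mxE eqxx mulr1n.
Qed.

(** The rotation in the plane of the first two coordinates, in blocks of sizes 1, 1 and [n]. *)
Definition givens n (c s : R) :=
  block_mx (c%:M : 'M[R]_1) (row_mx ((- s)%:M : 'M[R]_1) 0) (col_mx (s%:M : 'M[R]_1) 0)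
    (block_mx (c%:M : 'M[R]_1) 0 0 (1%:M : 'M[R]_n)).

Lemma givens_col n c s (x y : R) (z : 'cV[R]_n) :
  givens n c s *m col_mx x%:M (col_mx y%:M z) =
  col_mx (c * x - s * y)%:M (col_mx (s * x + c * y)%:M z).
Proof.
rewrite /givens mul_block_col mul_row_col mul0mx addr0 -!scalar_mxM.
rewrite mul_block_col mul_col_mx !mul0mx mul1mx addr0 -!scalar_mxM.
by rewrite add_col_mx !add0r mulNr -!raddfD.
Qed.

(** Integrating out the last [n] coordinates first leaves a function [F] of the first two with
    values in [0, 1], to which the planar rotation applies. *)
Lemma invariant_givens n (c s : R) :
  (c ^+ 2 + s ^+ 2 = 1)%R -> (0 <= c)%R -> invariant_mx (givens n c s).
Proof.
move=> cs c0 B mB.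
pose cons2 (p : MR * MR) (z : n.-tuple MR) := cons_pair (p.1, cons_pair (p.2, z)).
have mcons2 : measurable_fun setT (fun t : (MR * MR) * n.-tuple MR => cons2 t.1 t.2).
  apply: (measurableT_comp (@measurable_cons_pair R n.+1)).
  apply: measurable_fun_pair => /=.
    exact: (measurableT_comp measurable_fst measurable_fst).
  apply: (measurableT_comp (@measurable_cons_pair R n)).
  apply: measurable_fun_pair => //=.
  exact: (measurableT_comp measurable_snd measurable_fst).
pose F p := gam n [set z | B (cons2 p z)].
have mB2 : measurable [set t : (MR * MR) * n.-tuple MR | B (cons2 t.1 t.2)].
  by rewrite -[X in measurable X]setTI; exact: mcons2.
have mF : measurable_fun [set: MR * MR] F := measurable_std_gaussian_slice mB2.
have F01 p : (0 <= F p <= 1)%E.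
  apply: std_gaussian_slice01.
  exact: (measurable_slice p.2 (measurable_slice p.1 mB)).
have E C : measurable C ->
    gam n.+2 C = (\int[N01]_x \int[N01]_y gam n [set z | C (cons2 (x, y) z)])%E.
  by move=> mC; rewrite std_gaussianS; apply: eq_integral => x _;
    rewrite std_gaussianS.
rewrite (E B mB) E; last exact: measurable_set_mulmx.
transitivity (\int[N01]_x \int[N01]_y F (c * x - s * y, s * x + c * y)%R)%E.
  apply: eq_integral => x _; apply: eq_integral => y _; congr (gam n _).
  apply/seteqP; split => z /=; rewrite /cons2 /= !col_tuple_cons givens_col;
    by rewrite !tuple_col_cons !mxE !eqxx !mulr1n col_tupleK.
exact: integral_normal_rotation.
Qed.

End Std_gaussian.

(** * Squared length of an orthonormal projection of a Gaussian vector *)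

Section Projection_law.
Context {R : realType}.
Local Notation MR := (measurableTypeR R).
Local Notation N01 := (normal_prob (0 : R) 1).
Local Notation gam := (@std_gaussian R).

(** The vector may land on either half of the axis, so [(c, s)] is taken along [(a, b)] or its
    opposite; this freedom allows [0 <= c], which the shear decomposition requires. *)
Lemma rotation_to_axis (a b : R) : exists c s : R,
  [/\ c ^+ 2 + s ^+ 2 = 1, 0 <= c & b * c = a * s].
Proof.
have [ab|ab] := eqVneq (a ^+ 2 + b ^+ 2) 0.
  exists 1, 0; rewrite expr1n expr0n addr0 ler01; split=> //.
  move/eqP: ab; rewrite paddr_eq0 ?sqr_ge0// !sqrf_eq0 => /andP[/eqP-> /eqP->].
  by rewrite !mul0r.
have abp : 0 < a ^+ 2 + b ^+ 2 by rewrite lt_def ab addr_ge0// sqr_ge0.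
pose r := Num.sqrt (a ^+ 2 + b ^+ 2).
have r0 : 0 < r by rewrite sqrtr_gt0.
have r2 : r ^+ 2 = a ^+ 2 + b ^+ 2 by rewrite sqr_sqrtr// ltW.
have [a0|a0] := leP 0 a.
  exists (a / r), (b / r); split; last by rewrite mulrCA.
    by rewrite !exprMn -mulrDl -r2 exprVn mulfV// expf_neq0// gt_eqF.
  by rewrite divr_ge0// ltW.
exists (- a / r), (- b / r); split; last by rewrite !mulNr !mulrN mulrCA.
  by rewrite !exprMn !sqrrN -mulrDl -r2 exprVn mulfV// expf_neq0// gt_eqF.
by rewrite divr_ge0 ?(ltW r0)// oppr_ge0 ltW.
Qed.

Lemma mulmx_givens n c s (x y : R) (z : 'rV[R]_n) :
  row_mx (x%:M : 'M[R]_1) (row_mx (y%:M : 'M[R]_1) z) *m givens n c s =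
  row_mx (x * c + y * s)%:M (row_mx (y * c - x * s)%:M z).
Proof.
rewrite /givens mul_row_block mul_mx_row mulmx0 mul_row_col mul_row_block.
rewrite !mulmx0 mulmx1 -!scalar_mxM add_row_mx !addr0 !add0r.
by rewrite -!raddfD /= mulrN [- _ + _]addrC.
Qed.

Lemma givens_orthogonal n (c s : R) :
  c ^+ 2 + s ^+ 2 = 1 -> givens n c s *m (givens n c s)^T = 1%:M.
Proof.
move=> cs; rewrite /givens !tr_block_mx !tr_row_mx !tr_col_mx !trmx0 !tr_scalar_mx.
rewrite !mulmx_block mul_row_col mul_mx_row mul_row_block mul_col_mx mul_block_col.
rewrite mul_col_row !mulmx0 !mul0mx !mulmx1 !addr0 !add0r -!scalar_mxM.
rewrite add_row_mx add_col_mx add_block_mx !addr0 !add0r -!raddfD /=.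
rewrite mulrNN -!expr2 cs mulNr (mulrC s c) subrr raddf0 row_mx0 mulrN subrr raddf0.
by rewrite col_mx0 addrC cs -!scalar_mx_block.
Qed.

(** The tail of [v] is turned onto its own first axis by induction; one plane rotation then merges
    the two remaining coordinates. *)
Lemma invariant_to_axis n (v : 'rV[R]_n.+1) : exists U : 'M[R]_n.+1,
  [/\ U *m U^T = 1%:M, invariant_mx U & exists a, v *m U = a *: delta_mx 0 0].
Proof.
elim: n v => [|n IH] v.
  exists 1%:M; split; [by rewrite trmx1 mulmx1|exact: invariant_mx1|].
  exists (v 0 0); rewrite mulmx1; apply/rowP => j.
  by rewrite !ord1 !mxE !eqxx mulr1.
have [U [UU iU [a vU]]] := IH (rsubmx (v : 'M[R]_(1, 1 + n.+1))).
pose U1 := block_mx (1%:M : 'M[R]_1) 0 0 U.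
pose b := v 0 0.
have [c [s [cs c0 bcs]]] := rotation_to_axis b a.
have vU1 : (v : 'M[R]_(1, 1 + n.+1)) *m U1 =
    row_mx (b%:M : 'M[R]_1) (row_mx (a%:M : 'M[R]_1) 0).
  rewrite -[v in LHS](@hsubmxK _ 1 1 n.+1) mul_row_block !mulmx0 addr0 add0r.
  rewrite mulmx1 vU; congr row_mx.
    by apply/rowP => j; rewrite !ord1 !mxE eqxx mulr1n; congr (v _ _); apply/val_inj.
  apply/rowP => j; rewrite !mxE; case: splitP => [i|i] ji.
    have -> : j = 0 by apply/val_inj; rewrite /= ji ord1.
    by rewrite ord1 !mxE !eqxx mulr1 mulr1n.
  have /negbTE-> : j != 0 by rewrite -val_eqE /= ji.
  by rewrite !mxE andbF mulr0.
have UU1 : U1 *m U1^T = 1%:M.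
  rewrite /U1 tr_block_mx mulmx_block !trmx0 !mulmx0 !mul0mx !addr0 add0r UU.
  by rewrite trmx1 mulmx1 -scalar_mx_block.
exists (U1 *m givens n c s); split.
- by rewrite trmx_mul mulmxA -(mulmxA U1) givens_orthogonal// mulmx1.
- by apply: invariant_mxM; [exact: invariant_block|exact: invariant_givens].
exists (b * c + a * s).
rewrite mulmxA vU1 mulmx_givens bcs subrr raddf0 row_mx0.
apply/rowP => j; rewrite !mxE; case: splitP => [i|i] ji.
  have -> : j = 0 by apply/val_inj; rewrite /= ji ord1.
  by rewrite ord1 !mxE !eqxx mulr1 mulr1n.
have /negbTE-> : j != 0 by rewrite -val_eqE /= ji.
by rewrite !mxE andbF mulr0.
Qed.

Lemma measurable_dot_mulmx_tuple m n (B : 'M[R]_(m, n)) (A : set MR) :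
  measurable A ->
  measurable [set z : n.-tuple MR |
    A (dot (B *m col_tuple z) (B *m col_tuple z))].
Proof.
move=> mA; rewrite -[X in measurable X]setTI.
have := @measurable_dot R _ (n.-tuple MR) m (fun z => B *m col_tuple z)
  (fun z => B *m col_tuple z); apply => // j;
  by apply: measurable_mulmx_coord => i; exact: measurable_col_tuple.
Qed.

(** Induction on the rows. Turning the first row onto an axis makes [B U] block diagonal: its corner
    [a] satisfies [a^2 = 1] as the row is a unit vector, and orthogonality clears the rest of the
    first column. The first coordinate then splits off, shifting [A] by [x^2]. *)
Lemma projection_law m n (B : 'M[R]_(m, n)) (A : set MR) :
  B *m B^T = 1%:M -> measurable A ->
  gam n [set z | A (dot (B *m col_tuple z) (B *m col_tuple z))] =
  gam m [set z | A (dot (col_tuple z) (col_tuple z))].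
Proof.
elim: m n B A => [|m IH] n B A BB mA.
  have d0 (u : 'cV[R]_0) : dot u u = 0 by rewrite dotE big_ord0.
  have [A0|A0] := pselect (A 0).
    rewrite [in LHS](_ : [set z | _] = setT); last first.
      by apply/seteqP; split => z //= _; rewrite d0.
    rewrite [in RHS](_ : [set z | _] = setT); last first.
      by apply/seteqP; split => z //= _; rewrite d0.
    by rewrite !probability_setT.
  rewrite [in LHS](_ : [set z | _] = set0); last first.
    by apply/seteqP; split => z //=; rewrite d0.
  rewrite [in RHS](_ : [set z | _] = set0); last first.
    by apply/seteqP; split => z //=; rewrite d0.
  by rewrite !measure0.
case: n B BB => [|n] B BB.
  have /matrixP/(_ 0 0) := BB; rewrite !mxE eqxx big_ord0.
  by move=> /esym/eqP; rewrite oner_eq0.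
have [U [UU iU [a BU]]] := invariant_to_axis (row 0 B).
have [C CBU] : exists C : 'M[R]_(1 + m, 1 + n), C = B *m U by exists (B *m U).
have CC : C *m C^T = 1%:M.
  by rewrite CBU trmx_mul mulmxA -(mulmxA B) UU mulmx1.
have C0 j : C 0 j = a * (j == 0)%:R.
  have := congr1 (fun w : 'rV_n.+1 => w 0 j) BU; rewrite -row_mul mxE -CBU => ->.
  by rewrite !mxE eqxx.
have CC0 i : a * C i 0 = (i == 0)%:R.
  have /matrixP/(_ 0 i) := CC; rewrite !mxE eq_sym => <-.
  rewrite (bigD1 0)//= big1 ?addr0 => [|j j0]; last first.
    by rewrite C0 (negbTE j0) mulr0 mul0r.
  by rewrite C0 eqxx mulr1 mxE.
have a2 : a ^+ 2 = 1 by rewrite expr2 -[a in X in _ * X]mulr1 -(C0 0) CC0.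
have a0 : a != 0 by apply: contra_eq_neq a2 => ->; rewrite expr0n eq_sym oner_eq0.
have l0 p : lshift p (0 : 'I_1) = 0 :> 'I_(1 + p) by apply/val_inj.
have CE : C = block_mx (a%:M : 'M[R]_1) 0 0 (drsubmx C).
  rewrite -[LHS]submxK; congr block_mx.
  - apply/matrixP => i j; rewrite !ord1 !mxE eqxx mulr1n !l0.
    by rewrite C0 eqxx mulr1.
  - apply/matrixP => i j; rewrite !ord1 !mxE l0 C0.
    by rewrite (_ : (_ == 0) = false) ?mulr0.
  - apply/matrixP => i j; rewrite !ord1 !mxE l0; apply: (mulfI a0).
    by rewrite mulr0 CC0.
pose B' := drsubmx C.
have BB' : B' *m B'^T = 1%:M.
  have := CC; rewrite CE tr_block_mx mulmx_block !trmx0 !mulmx0 !mul0mx.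
  rewrite add0r scalar_mx_block => /eq_block_mx[_ _ _].
  by rewrite add0r.
rewrite -(iU _ (measurable_dot_mulmx_tuple B mA)) !std_gaussianS.
apply: eq_integral => x _.
pose A' := [set y : R | A (x ^+ 2 + y)].
have mA' : measurable A'.
  rewrite -[X in measurable X]setTI.
  have : measurable_fun [set: MR] (fun y : MR => x ^+ 2 + y : MR) by exact: measurable_funD.
  exact.
have sx (y : R) p (u u' : 'cV[R]_p) : dot (col_mx y%:M u) (col_mx y%:M u')
    = y ^+ 2 + dot u u'.
  by rewrite dot_block [dot y%:M _]dotE big_ord1 mxE eqxx mulr1n -expr2.
have Ew (u : 'cV[R]_n) :
    C *m (col_mx x%:M u) = col_mx (a * x)%:M (B' *m u).
  by rewrite CE mul_block_col !mul0mx addr0 add0r -scalar_mxM.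
have E z : dot (B *m (U *m col_tuple (cons_pair (x, z))))
    (B *m (U *m col_tuple (cons_pair (x, z))))
    = x ^+ 2 + dot (B' *m col_tuple z) (B' *m col_tuple z).
  have -> : B *m (U *m col_tuple (cons_pair (x, z))) =
      col_mx (a * x)%:M (B' *m col_tuple z).
    by rewrite mulmxA -CBU col_tuple_cons; exact: Ew.
  by apply: (eq_trans (sx _ _ _ _)); rewrite exprMn a2 mul1r.
transitivity (gam n [set z | A' (dot (B' *m col_tuple z) (B' *m col_tuple z))]).
  by congr (gam n _); apply/seteqP; split => z; rewrite /A' /= tuple_colK E.
rewrite IH//; congr (gam m _).
have E' z : dot (col_tuple (cons_pair (x, z))) (col_tuple (cons_pair (x, z)))
    = x ^+ 2 + dot (col_tuple z) (col_tuple z).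
  by rewrite col_tuple_cons; exact: sx.
by apply/seteqP; split => z; rewrite /A' /= E'.
Qed.

End Projection_law.

(** * The chi-square law *)

Section Chi2.
Context {R : realType}.
Local Notation MR := (measurableTypeR R).
Local Notation N01 := (normal_prob (0 : R) 1).
Local Notation gam := (@std_gaussian R).

Definition sqn n (z : n.-tuple R) : R := \sum_i tnth z i ^+ 2.

Lemma sqnE n (z : n.-tuple R) : sqn z = dot (col_tuple z) (col_tuple z).
Proof. by rewrite dotE; apply: eq_bigr => i _; rewrite !mxE expr2. Qed.

Lemma sqn_ge0 n (z : n.-tuple R) : 0 <= sqn z.
Proof. by rewrite sqnE dot_ge0. Qed.

Lemma sqn0 (z : 0.-tuple R) : sqn z = 0.
Proof. by rewrite /sqn big_ord0. Qed.

Lemma sqn_cons n x (z : n.-tuple R) : sqn (cons_pair (x, z)) = x ^+ 2 + sqn z.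
Proof.
rewrite /sqn big_ord_recl; congr (_ + _); apply: eq_bigr => i _.
by rewrite !(tnth_nth 0).
Qed.

Lemma measurable_sqn n : measurable_fun setT (@sqn n : n.-tuple MR -> MR).
Proof.
by apply: measurable_sum_fun => i; apply: measurable_funX; exact: measurable_tnth.
Qed.

Lemma measurable_sqn_set n (A : set MR) :
  measurable A -> measurable [set z : n.-tuple MR | A (sqn z)].
Proof. by move=> mA; rewrite -[X in measurable X]setTI; exact: measurable_sqn. Qed.

Lemma std_gaussian_sqnS n (A : set MR) :
  gam n.+1 [set z | A (sqn z)]
  = (\int[N01]_x gam n [set z | A (x ^+ 2 + sqn z)%R])%E.
Proof.
rewrite std_gaussianS; apply: eq_integral => x _; congr (gam n _).
by apply/seteqP; split => z /=; rewrite sqn_cons.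
Qed.

Lemma measurable_sqn_slice n (A : set MR) : measurable A ->
  measurable_fun setT (fun x : MR => gam n [set z | A (x ^+ 2 + sqn z)]).
Proof.
move=> mA; pose B := [set t : MR * n.-tuple MR | A (t.1 ^+ 2 + sqn t.2)].
apply: (@measurable_std_gaussian_slice R _ _ _ B).
rewrite -[X in measurable X]setTI.
have : measurable_fun setT (fun t : MR * n.-tuple MR => t.1 ^+ 2 + sqn t.2 : MR).
  apply: measurable_funD; first exact: measurable_funX.
  exact: (measurableT_comp (@measurable_sqn n)).
exact.
Qed.

Lemma measurable_sqr_set (A : set MR) :
  measurable A -> measurable [set x : MR | A (x ^+ 2)].
Proof.
move=> mA; rewrite -[X in measurable X]setTI.
exact: (measurable_funX 2 (@measurable_id _ MR setT)).
Qed.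

Lemma std_gaussian1_sqn (A : set MR) : measurable A ->
  gam 1 [set z | A (sqn z)] = N01 [set x | A (x ^+ 2)].
Proof.
move=> mA; rewrite std_gaussian_sqnS.
transitivity (\int[N01]_x (\1_[set x : MR | A (x ^+ 2)] x)%:E)%E; last first.
  by rewrite integral_indic// ?setIT//; exact: measurable_sqr_set.
apply: eq_integral => x _; rewrite /= diracE indicE; congr ((nat_of_bool _)%:R%:E).
by apply/idP/idP; rewrite !inE /= sqn0 addr0.
Qed.

Lemma normal_sqr_atom (c : R) : N01 [set x : MR | x ^+ 2 = c] = 0%E.
Proof.
have mA := @measurable_sqr_set [set c] (measurable_set1 _).
have := @normal_prob_dominates R 0 1.
move/null_content_dominatesP => /(_ _ mA); apply.
apply: countable_lebesgue_measure0; apply: finite_set_countable.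
apply: (@sub_finite_set _ _ [set Num.sqrt c; - Num.sqrt c]) => //.
move=> x /= <-; rewrite sqrtr_sqr; have [x0|x0] := leP 0 x.
  by left; rewrite ger0_norm.
by right; rewrite ltr0_norm// opprK.
Qed.

Lemma sqn_atom n (c : R) : gam n.+1 [set z | sqn z = c] = 0%E.
Proof.
elim: n c => [|n IH] c.
  by rewrite (std_gaussian1_sqn (measurable_set1 c)) normal_sqr_atom.
rewrite (std_gaussian_sqnS n.+1 [set c]) integral0_eq// => x _.
rewrite -[RHS](IH (c - x ^+ 2)); congr (gam _ _).
by apply/seteqP; split => z /= ?; lra.
Qed.

Lemma normal_itv_gt0 (u v : R) : u < v -> (0 < N01 `]u, v[%classic)%E.
Proof.
(* On the interval the density is at least its value at the endpoint farther from 0. *)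
move=> uv; pose r := Num.max `|u| `|v|.
have p0 : 0 < normal_pdf 0 1 r.
  by rewrite normal_pdfE ?oner_eq0// mulr_gt0 ?normal_peak_gt0 ?oner_eq0// expR_gt0.
apply: (@lt_le_trans _ _
    (\int[lebesgue_measure]_(x in `]u, v[) (normal_pdf 0 1 r)%:E)%E).
  rewrite integral_cst//= lebesgue_measure_itv/= lte_fin uv -EFinB -EFinM lte_fin.
  by rewrite mulr_gt0// subr_gt0.
apply: ge0_le_integral => //=.
- by move=> x _; rewrite lee_fin normal_pdf_ge0.
- by apply: measurable_funTS; exact: measurable_normal_pdfE.
- move=> x; rewrite in_itv/= lee_fin => /andP[ux xv].
  rewrite !normal_pdfE ?oner_eq0// ler_wpM2l ?normal_peak_ge0// ler_expR.
  rewrite !subr0 !mulNr lerN2 ler_wpM2r ?invr_ge0 ?mulrn_wge0 ?sqr_ge0//.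
  rewrite -(real_normK (num_real x)) lerXn2r ?nnegrE//.
    by rewrite le_max normr_ge0.
  rewrite le_max; have [x0|x0] := leP 0 x.
    by rewrite (ger0_norm x0) orbC (le_trans (ltW xv) (ler_norm _)).
  by rewrite (ltr0_norm x0) -(normrN u) (le_trans _ (ler_norm (- u)))// lerN2 ltW.
Qed.

Lemma measurable_indicE (A : set MR) : measurable A ->
  measurable_fun setT (fun x : MR => (\1_A x : R)%:E).
Proof. by move=> mA; apply/measurable_EFinP; exact: measurable_indic. Qed.

(** This makes the distribution function strictly increasing on the half-line, which isolates the
    quantile. In the induction, [x^2 < (b - a) / 2] and [sqn z] in the lower half of the interval
    keep the sum below [b]. *)
Lemma sqn_itv_gt0 n (a b : R) : 0 <= a -> a < b ->
  (0 < gam n.+1 [set z | a < sqn z < b]%R)%E.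
Proof.
have mitv (u v : R) : measurable [set y : MR | u < y < v].
  exact: (measurable_itv `]u, v[).
elim: n a b => [|n IH] a b a0 ab.
  rewrite (std_gaussian1_sqn (mitv a b)).
  have sab : Num.sqrt a < Num.sqrt b by rewrite ltr_sqrt// (le_lt_trans a0).
  apply: (lt_le_trans (normal_itv_gt0 sab)); apply: le_measure.
  - by rewrite inE.
  - by rewrite inE; exact: measurable_sqr_set.
  move=> x /=; rewrite in_itv/= => /andP[ax xb].
  have x0 : 0 < x by rewrite (le_lt_trans _ ax)// sqrtr_ge0.
  have b0 : 0 < b by rewrite (le_lt_trans a0).
  rewrite -[X in X < _ < _](sqr_sqrtr a0) -[X in _ < _ < X](sqr_sqrtr (ltW b0)).
  by rewrite !ltrXn2r ?nnegrE ?sqrtr_ge0 ?ax ?xb//= ltW.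
pose m := (a + b) / 2; pose r := (b - a) / 2.
have am : a < m by rewrite /m; lra.
have r0 : 0 < r by rewrite /r; lra.
have p0 := IH _ _ a0 am; set p := gam _ _ in p0.
pose A := [set x : MR | - Num.sqrt r < x < Num.sqrt r].
have mA : measurable A := mitv _ _.
have A0 : (0 < N01 A)%E.
  have sr : 0 < Num.sqrt r by rewrite sqrtr_gt0.
  have : - Num.sqrt r < Num.sqrt r by lra.
  exact: normal_itv_gt0.
rewrite (std_gaussian_sqnS n.+1 [set y | a < y < b]).
apply: (@lt_le_trans _ _ (\int[N01]_x (p * (\1_A x)%:E))%E).
  rewrite ge0_integralZl//= ?integral_indic ?setIT//; last 2 first.
  - exact: measurable_indicE.
  - exact: ltW.
  by rewrite mule_gt0.
apply: ge0_le_integral => [//||||].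
- by move=> x _; rewrite mule_ge0 ?(ltW p0)// lee_fin.
- by apply: emeasurable_funM => //; exact: measurable_indicE.
- exact: (measurable_sqn_slice n.+1 (mitv a b)).
move=> x _; rewrite indicE; case: (boolP (x \in A)) => xA; last by rewrite mule0.
rewrite mule1; apply: le_measure.
- by rewrite inE; exact: (measurable_sqn_set (mitv _ _)).
- rewrite inE (_ : [set z | _] = [set z | `]a - x ^+ 2, b - x ^+ 2[%classic (sqn z)]).
    exact: measurable_sqn_set.
  by apply/seteqP; split => z /=; rewrite in_itv/= ltrBlDl ltrBrDl.
move=> z /= /andP[az zm]; move: xA; rewrite inE /A /= => xA.
have : x ^+ 2 < r.
  by rewrite -(sqr_sqrtr (ltW r0)) -(real_normK (num_real x)) ltrXn2r ?nnegrE ?sqrtr_ge0// ltr_norml.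
by have := sqr_ge0 x; rewrite /r; rewrite /m in zm; lra.
Qed.

Lemma sqn_tail n (e : R) : 0 < e ->
  exists2 K, 0 < K & (gam n [set z | (K < sqn z)%R] <= e%:E)%E.
Proof.
move=> e0; pose F (i : nat) := [set z : n.-tuple MR | i%:R < sqn z].
have mF i : measurable (F i).
  apply: (@measurable_sqn_set n [set y | i%:R < y]).
  by rewrite -set_itvoy; exact: measurable_itv.
have : gam n (F i) @[i --> \oo] --> gam n (\bigcap_i F i).
  apply: nonincreasing_cvg_mu => //.
  - by rewrite (le_lt_trans (probability_le1 _ _))// ltry.
  - exact: bigcapT_measurable.
  - apply/nonincreasing_seqP => i; apply/subsetPset => z; rewrite /F /=.
    by apply: lt_trans; rewrite ltr_nat.
rewrite (_ : \bigcap_i F i = set0); last first.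
  apply/seteqP; split => z // zF; have := zF (Num.truncn (sqn z)).+1 I.
  by rewrite /F /= ltNge ltW// truncnS_gt.
rewrite measure0 => /fine_cvgP[_ /cvgrPdist_lt/(_ _ e0)[i _ /(_ i (leqnn i)) /=]].
rewrite sub0r normrN ger0_norm ?fine_ge0// => h.
exists i.+1%:R => //; apply: (@le_trans _ _ (gam n (F i))).
  apply: le_measure; rewrite ?inE//; first exact: mF i.+1.
  by move=> z; rewrite /F /=; apply: lt_trans; rewrite ltr_nat.
by rewrite -(fineK (fin_num_measure (gam n) _ (mF i))) lee_fin ltW.
Qed.

(** Continuity from above along shrinking intervals, whose intersection lies in an atom of mass
    zero. *)
Lemma sqn_concentration n (c e : R) : 0 < e ->
  exists2 h, 0 < h & (gam n.+1 [set z | c - h <= sqn z <= c + h]%R <= e%:E)%E.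
Proof.
move=> e0; pose F (i : nat) :=
  [set z : n.+1.-tuple MR | c - i.+1%:R^-1 <= sqn z <= c + i.+1%:R^-1].
have mF i : measurable (F i).
  exact: (measurable_sqn_set (measurable_itv `[c - i.+1%:R^-1, c + i.+1%:R^-1])).
have : gam n.+1 (F i) @[i --> \oo] --> gam n.+1 (\bigcap_i F i).
  apply: nonincreasing_cvg_mu => //.
  - by rewrite (le_lt_trans (probability_le1 _ _))// ltry.
  - exact: bigcapT_measurable.
  - apply/nonincreasing_seqP => i; apply/subsetPset => z; rewrite /F /=.
    have : (i.+2%:R : R)^-1 <= i.+1%:R^-1 by rewrite lef_pV2 ?posrE// ler_nat.
    by move: (_^-1) (_^-1) => u v uv /andP[h1 h2]; apply/andP; split; lra.
have -> : gam n.+1 (\bigcap_i F i) = 0%E.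
  apply/eqP; rewrite eq_le measure_ge0 andbT -(sqn_atom n c).
  apply: le_measure; rewrite ?inE//.
  - exact: bigcapT_measurable.
  - exact: (measurable_sqn_set (measurable_set1 c)).
  move=> z zF /=; apply/eqP; rewrite eq_le; apply/andP; split.
    apply/ler_addgt0Pr => d d0; have := zF (Num.truncn d^-1) I => /andP[_ h].
    rewrite (le_trans h)// lerD2l invf_ple ?posrE//.
    by rewrite ltW// truncnS_gt.
  apply/ler_addgt0Pr => d d0; have := zF (Num.truncn d^-1) I => /andP[h _].
  rewrite -lerBlDr (le_trans _ h)// lerD2l lerN2 invf_ple ?posrE//.
  by rewrite ltW// truncnS_gt.
move=> /fine_cvgP[_ /cvgrPdist_lt/(_ _ e0)[i _ /(_ i (leqnn i)) /=]].
rewrite sub0r normrN ger0_norm ?fine_ge0// => h.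
exists i.+1%:R^-1; first by rewrite invr_gt0.
apply: (@le_trans _ _ (gam n.+1 (F i))) => //.
by rewrite -(fineK (fin_num_measure (gam n.+1) _ (mF i))) lee_fin ltW.
Qed.

End Chi2.

Section Chi2_cdf.
Context {R : realType}.
Local Notation MR := (measurableTypeR R).
Local Notation gam := (@std_gaussian R).

Lemma measurable_sqn_le n (c : R) :
  measurable [set z : n.-tuple MR | sqn z <= c].
Proof.
apply: (@measurable_sqn_set R n [set y | y <= c]).
by rewrite -set_itvNyc; exact: measurable_itv.
Qed.

Lemma measurable_sqn_gt n (c : R) :
  measurable [set z : n.-tuple MR | c < sqn z].
Proof.
apply: (@measurable_sqn_set R n [set y | c < y]).
by rewrite -set_itvoy; exact: measurable_itv.
Qed.

Definition chi2_cdf n (c : R) : R := fine (gam n [set z | sqn z <= c]).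

Lemma chi2_cdfE n c : gam n [set z | sqn z <= c] = (chi2_cdf n c)%:E.
Proof. by rewrite fineK// fin_num_measure//; exact: measurable_sqn_le. Qed.

Lemma chi2_itvE n c : chi2 n `]-oo, c]%classic = (chi2_cdf n c)%:E.
Proof.
by rewrite -chi2_cdfE /chi2 /pushforward; congr (gam n _).
Qed.

Lemma chi2_cdf_ge0 n c : 0 <= chi2_cdf n c.
Proof. by rewrite -lee_fin -chi2_cdfE. Qed.

Lemma chi2_cdf_lt0 n c : c < 0 -> chi2_cdf n c = 0.
Proof.
move=> c0; rewrite /chi2_cdf (_ : [set z | _] = set0) ?measure0//.
by apply/seteqP; split => z //=; have := sqn_ge0 z; lra.
Qed.

Lemma chi2_cdf_diff n a b : a <= b ->
  gam n [set z | (a < sqn z <= b)%R] = (chi2_cdf n b - chi2_cdf n a)%:E.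
Proof.
move=> ab; pose A c := [set z : n.-tuple MR | sqn z <= c].
have mA c : measurable (A c) := measurable_sqn_le c.
have AB : A b `&` A a = A a.
  by apply/setIidPr => z; rewrite /A /= => /le_trans; apply.
rewrite EFinB -!chi2_cdfE -[X in (_ - gam n X)%E]AB -measureD//.
- congr (gam n _); apply/seteqP; split => z /=.
    by move=> /andP[h1 h2]; split=> //; apply/negP; rewrite -ltNge.
  by move=> [h /negP]; rewrite -ltNge => ->.
- exact: (mA b).
- by rewrite (le_lt_trans (probability_le1 _ (mA b)))// ltry.
Qed.

Lemma chi2_cdf_gt n a : gam n [set z | (a < sqn z)%R] = (1 - chi2_cdf n a)%:E.
Proof.
rewrite EFinB -chi2_cdfE -probability_setC; last exact: measurable_sqn_le.
congr (gam n _); apply/seteqP; split => z /=; rewrite ltNge.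
  by move/negP.
by move=> h; apply/negP.
Qed.

Lemma chi2_cdf_mono n a b : a <= b -> chi2_cdf n a <= chi2_cdf n b.
Proof.
move=> ab; rewrite -subr_ge0 -lee_fin -chi2_cdf_diff//.
Qed.

Lemma chi2_cdf_lt n a b : 0 <= a -> a < b -> chi2_cdf n.+1 a < chi2_cdf n.+1 b.
Proof.
move=> a0 ab; rewrite -subr_gt0 -lte_fin -chi2_cdf_diff ?(ltW ab)//.
apply: (lt_le_trans (sqn_itv_gt0 n a0 ab)); apply: le_measure; rewrite ?inE.
- exact: (measurable_sqn_set (measurable_itv `]a, b[)).
- exact: (measurable_sqn_set (measurable_itv `]a, b])).
by move=> z /= /andP[-> /ltW ->].
Qed.

(** For [n = 0] the law is a point mass at 0, hence the positivity assumption. *)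
Lemma chi2_cdf_continuous n c e : (0 < n)%N -> 0 < e -> exists2 h, 0 < h &
  chi2_cdf n (c + h) - chi2_cdf n (c - h) <= e.
Proof.
case: n => // n _ e0; have [h h0 hc] := sqn_concentration n c e0; exists h => //.
rewrite -lee_fin -chi2_cdf_diff; last lra.
apply: le_trans hc; apply: le_measure; rewrite ?inE.
- exact: (measurable_sqn_set (measurable_itv `]c - h, c + h])).
- exact: (measurable_sqn_set (measurable_itv `[c - h, c + h])).
by move=> z /= /andP[/ltW -> ->].
Qed.

Lemma chi2_cdf_tail n e : 0 < e -> exists2 K, 0 < K & 1 - e <= chi2_cdf n K.
Proof.
move=> e0; have [K K0] := sqn_tail n e0; rewrite chi2_cdf_gt lee_fin => h.
by exists K => //; lra.
Qed.

(** Strictness on both sides is the margin that later absorbs the simulation error. On the right it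
    comes from strict monotonicity, available because [0 < p] makes every admissible level
    nonnegative. *)
Lemma chi2_quantile n (p : R) : (0 < n)%N -> 0 < p < 1 ->
  let c := quantile (chi2 n) p in
  forall e, 0 < e -> chi2_cdf n (c - e) < p /\ p < chi2_cdf n (c + e).
Proof.
case: n => // n _ /andP[p0 p1] c e e0.
pose D := [set d : R | (p%:E <= chi2 n.+1 `]-oo, d]%classic)%E].
have D0 d : D d -> 0 <= d.
  rewrite /D/= chi2_itvE lee_fin => pd; rewrite leNgt; apply/negP => d0.
  by move: pd; rewrite chi2_cdf_lt0// leNgt p0.
have Dlb : has_lbound D by exists 0.
have Dne : D !=set0.
  have [|K K0 h] := @chi2_cdf_tail n.+1 (1 - p); first lra.
  by exists K; rewrite /D/= chi2_itvE lee_fin; lra.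
split.
  rewrite ltNge; apply/negP => h; have : c <= c - e.
    by apply: ge_inf => //; rewrite /D /= chi2_itvE lee_fin.
  lra.
have [//|d Dd dc] := @inf_adherent _ D e e0.
have := D0 d Dd; move: Dd; rewrite /D/= chi2_itvE lee_fin => pd d0.
by apply: (le_lt_trans pd); exact: chi2_cdf_lt.
Qed.

End Chi2_cdf.

Section Gaussian_sets.
Context {R : realType}.
Local Notation MR := (measurableTypeR R).
Local Notation gam := (@std_gaussian R).

(* Coordinatewise open sets are countable unions of rational boxes. *)
Lemma measurable_box_open n (U : set (n.-tuple MR)) :
  (forall z, U z -> exists2 e : R, 0 < e &
     forall y : n.-tuple R, (forall i, `|tnth y i - tnth z i| < e) -> U y) ->
  measurable U.
Proof.
move=> oU.
pose box (c : n.-tuple rat) (j : nat) := [set y : n.-tuple MR |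
  forall i, `|tnth y i - ratr (tnth c i)| < j.+1%:R^-1].
have mbox c j : measurable (box c j).
  rewrite (_ : box c j = \bigcap_(i in [set: 'I_n]) [set y : n.-tuple MR |
      `|tnth y i - ratr (tnth c i)| < j.+1%:R^-1]); last first.
    by apply/seteqP; split => y /= h i => [_|]; exact: h.
  apply: fin_bigcap_measurable => // i _.
  rewrite -[X in measurable X]setTI.
  have : measurable_fun setT (fun y : n.-tuple MR =>
      `|tnth y i - ratr (tnth c i)| : MR).
    apply: measurableT_comp => //; apply: measurable_funB => //.
    exact: measurable_tnth.
  move=> /(_ measurableT [set r | r < j.+1%:R^-1]); apply.
  by rewrite -set_itvNyo; exact: measurable_itv.
pose F i := if (unpickle i : option (n.-tuple rat * nat)) is Some (c, j)
  then if `[< box c j `<=` U >] then box c j else set0 else set0.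
rewrite (_ : U = \bigcup_i F i).
  apply: bigcupT_measurable => i; rewrite /F.
  by case: unpickle => [[c j]|] //; case: ifP => _.
apply/seteqP; split => [z Uz|z [i _]]; last first.
  by rewrite /F; case: unpickle => [[c j]|] //; case: ifP => // /asboolP; apply.
have [e e0 ze] := oU z Uz.
pose j := Num.truncn (2 / e).
have je : j.+1%:R^-1 < e / 2.
  by rewrite invf_plt ?posrE ?divr_gt0// invf_div truncnS_gt.
have rc i : {r : rat | `|tnth z i - ratr r| < j.+1%:R^-1}.
  apply: cid; have /rat_in_itvoo[r] : tnth z i - j.+1%:R^-1 < tnth z i + j.+1%:R^-1.
    by rewrite ltrD2l gt0_cp// invr_gt0.
  by rewrite in_itv/= => ?; exists r; rewrite distrC ltr_distl.
pose c := [tuple sval (rc i) | i < n].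
have zc : box c j z by move=> i; rewrite tnth_mktuple; exact: svalP (rc i).
have cU : box c j `<=` U.
  move=> y yc; apply: ze => i.
  have := zc i; rewrite /= distrC; have /= := yc i; move: je.
  have := ler_distD (ratr (tnth c i)) (tnth y i) (tnth z i).
  move: (j.+1%:R^-1) => u; lra.
exists (pickle (c, j)) => //; rewrite /F pickleK ifT//.
exact/asboolP.
Qed.

End Gaussian_sets.

(** * The conditional critical value *)

Section Critical_value.
Context {R : realType}.
Local Notation MR := (measurableTypeR R).
Local Notation gam := (@std_gaussian R).

Lemma measurable_lt0_tuple n (p : 'cV[R]_n -> R) : continuous p ->
  forall z : n.-tuple R, p (col_tuple z) < 0 -> exists2 e : R, 0 < e &
     forall y : n.-tuple R, (forall i, `|tnth y i - tnth z i| < e) ->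
     p (col_tuple y) < 0.
Proof.
move=> cp z pz; have : \forall v \near col_tuple z, p v < 0.
  exact: (cp (col_tuple z) _ (lt_nbhsl pz)).
move=> /nbhs_ballP[e /= e0 ep]; exists e => // y yz; apply: ep.
split=> // i j; rewrite !mxE /ball/= distrC; exact: yz.
Qed.

Lemma affine_continuous (T : topologicalType) m n (B : 'M[R]_(m, n)) u
    (f : T -> 'cV[R]_n) i :
  (forall j, continuous (fun x => f x j 0)) ->
  continuous (fun x => (B *m f x + u) i 0).
Proof.
move=> cf x; rewrite (_ : (fun _ => _) = fun y => (B *m f y) i 0 + u i 0).
  have cB : (fun y => (B *m f y) i 0) @ x --> (B *m f x) i 0.
    exact: mulmx_continuous.
  by apply: (cvgD cB); exact: cvg_cst.
by apply/funext => y; rewrite mxE.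
Qed.

(** The set is an intersection over all [t], possibly uncountable. Its complement is a union of sets
    open in [z], hence open, and so measurable whatever [Theta] is. *)
Lemma measurable_QLR_function_le q k (Theta : set 'cV[R]_q) theta0
    (h : 'cV[R]_q -> 'cV[R]_k) S n (A : 'M[R]_(k, n)) (c : R) :
  Theta theta0 ->
  measurable [set z : n.-tuple MR |
    (QLR_function Theta theta0 (A *m col_tuple z) h S <= c%:E)%E].
Proof.
move=> Th0; set X := [set z | _].
pose p t (xi : 'cV[R]_k) : R := c - dot xi (invmx (S theta0 theta0) *m xi) +
  dot (S t theta0 *m invmx (S theta0 theta0) *m xi + h t)
    (invmx (S t t) *m (S t theta0 *m invmx (S theta0 theta0) *m xi + h t)).
have XE z : X z <-> forall t, Theta t -> 0 <= p t (A *m col_tuple z).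
  rewrite /X /QLR_function /=; set xi := A *m _; set I := ereal_inf _.
  rewrite qformE; set u := dot xi _.
  have -> : (u%:E - I <= c%:E)%E = ((u - c)%:E <= I)%E.
    case: (I) => [i| |].
    - by rewrite -EFinB !lee_fin; apply/idP/idP; lra.
    - by rewrite addeNy leNye leey.
    - by rewrite addey// leye_eq leeNy_eq.
  split=> [uI t Tt|H].
    have := le_trans uI (ereal_inf_lbound (imageP _ Tt)).
    by rewrite lee_fin qformE /p -/u; lra.
  apply: le_ereal_inf_tmp => _ [t Tt <-]; rewrite lee_fin qformE.
  by have := H t Tt; rewrite /p -/u; lra.
rewrite -[X]setCK; apply: measurableC; apply: measurable_box_open => z.
rewrite /setC /= XE -existsNE => -[t] /not_implyP[Tt /negP]; rewrite -ltNge => ptz.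
have cc (i : 'I_n) : continuous (fun v : 'cV[R]_n => v i 0).
  exact: entry_continuous.
have cA (i : 'I_k) : continuous (fun v : 'cV[R]_n => (A *m v) i 0).
  exact: (mulmx_continuous (f := id)).
have ca (i : 'I_k) : continuous (fun v : 'cV[R]_n =>
    (S t theta0 *m invmx (S theta0 theta0) *m (A *m v) + h t) i 0).
  exact: affine_continuous.
have c1 : continuous (fun v : 'cV[R]_n =>
    dot (A *m v) (invmx (S theta0 theta0) *m (A *m v))).
  by apply: dot_continuous => // i; exact: mulmx_continuous.
have c2 : continuous (fun v : 'cV[R]_n =>
    dot (S t theta0 *m invmx (S theta0 theta0) *m (A *m v) + h t)
    (invmx (S t t) *m (S t theta0 *m invmx (S theta0 theta0) *m (A *m v) + h t))).
  by apply: dot_continuous => // i; exact: mulmx_continuous.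
have cp : continuous (fun v : 'cV[R]_n => p t (A *m v)).
  by move=> v; exact: (cvgD (cvgB (cvg_cst c) (c1 v)) (c2 v)).
have [e e0 ez] := measurable_lt0_tuple cp ptz.
by exists e => // y /ez py; rewrite XE => /(_ t Tt); rewrite leNgt py.
Qed.

(** The transpose comes first, since [|A^T w|^2 = <w, W w>]; then [|A v|^2 = <v, A^T (A v)>] gives
    the same bound for [A]. *)
Lemma factor_bound n (A W : 'M[R]_n) K : 0 <= K -> A *m A^T = W ->
  mxbound K W -> mxbound (Num.sqrt K) A.
Proof.
move=> K0 AW bW v.
have AT w : enorm (A^T *m w) <= Num.sqrt K * enorm w.
  rewrite -(@ler_pXn2r _ 2) ?nnegrE ?mulr_ge0 ?enorm_ge0 ?sqrtr_ge0//.
  rewrite exprMn !enorm_sqr sqr_sqrtr// dot_mulmxr trmxK mulmxA AW dotC.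
  rewrite (le_trans (ler_norm _))// (le_trans (cauchy_schwarz _ _))//.
  by rewrite -enorm_sqr expr2 mulrCA ler_wpM2l ?enorm_ge0.
have [->|w0] := eqVneq (enorm (A *m v)) 0.
  by rewrite mulr_ge0 ?sqrtr_ge0 ?enorm_ge0.
have wp : 0 < enorm (A *m v) by rewrite lt_def w0 enorm_ge0.
rewrite -(ler_pM2r wp) -expr2 enorm_sqr dot_mulmxr dotC.
rewrite (le_trans (ler_norm _))// (le_trans (cauchy_schwarz _ _))//.
by rewrite mulrAC mulrC ler_wpM2r ?enorm_ge0.
Qed.

Lemma mx_factorP n (S : 'M[R]_n) c : S^T = S -> 0 < c -> coercive c S ->
  mx_factor S *m (mx_factor S)^T = S.
Proof.
move=> sS c0 cS; have [L LS] := cholesky sS (coercive_pos_def c0 cS).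
by have := @xgetPex _ 0 [set A | A *m A^T = S] (ex_intro _ L LS).
Qed.

Lemma gaussianE n (S : 'M[R]_n) (B : set (n.-tuple R)) :
  gaussian S B = gam n [set z | B (tuple_col (mx_factor S *m col_tuple z))].
Proof. by []. Qed.

Lemma std_gaussian_subU n (A B C : set (n.-tuple MR)) :
  measurable A -> measurable B -> measurable C -> A `<=` B `|` C ->
  (gam n A <= gam n B + gam n C)%E.
Proof.
move=> mA mB mC ABC; apply: (@le_trans _ _ (gam n (B `|` C))).
  by apply: le_measure; rewrite ?inE//; exact: measurableU.
exact: measureU2.
Qed.

Lemma QLR_function_recentered q k (Theta : set 'cV[R]_q) theta0
    (x m : 'cV[R]_q -> 'cV[R]_k) S xi :
  S theta0 theta0 \in unitmx -> m theta0 = 0 ->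
  QLR_function Theta theta0 xi
    (projected_process theta0 (fun t => x t + m t) S) S =
  QLR Theta theta0 (fun t => (x t + S t theta0 *m invmx (S theta0 theta0) *m
    (xi - x theta0)) + m t) S.
Proof.
move=> Su m0; rewrite /QLR_function /QLR.
have -> : x theta0 + S theta0 theta0 *m invmx (S theta0 theta0) *m
    (xi - x theta0) + m theta0 = xi.
  by rewrite m0 addr0 mulmxV// mul1mx addrC subrK.
congr (_ - ereal_inf _)%E.
apply: eq_imagel => t _; congr (qform _ _)%:E.
rewrite /projected_process m0 addr0 mulmxBr; move: (_ *m xi) (_ *m x theta0) => a b.
by rewrite addrA [a + _]addrC [RHS]addrAC [RHS]addrA.
Qed.

Lemma projector_exists q k (A : 'M[R]_k) (M : 'M[R]_(k, q)) : A \in unitmx ->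
  (forall b : 'cV_q, M *m b = 0 -> b = 0) ->
  exists B, projector_for (invmx A *m M) B.
Proof.
move=> Au injM; have [|B BP] := @least_squares R q k (invmx A *m M).
  move=> b; rewrite -mulmxA => /(congr1 (mulmx A)).
  by rewrite mulmxA mulmxV// mul1mx mulmx0; exact: injM.
by exists B.
Qed.

Lemma rd_injective q k (Theta : set 'cV[R]_q) theta0 c K eta delta
    (m : 'cV[R]_q -> 'cV[R]_k) Sigma M :
  regular_design Theta theta0 c K eta delta m Sigma M ->
  forall b : 'cV_q, M *m b = 0 -> b = 0.
Proof.
move=> D b Mb; apply: enorm_eq0; apply/eqP.
by have := rd_id D b; rewrite Mb enorm0 mulr0 eq_le enorm_ge0 andbT.
Qed.

End Critical_value.

Section Critical_value_limit.
Context {R : realType}.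
Local Notation MR := (measurableTypeR R).
Local Notation gam := (@std_gaussian R).

(* If [psi] is within [e] of [|B z|^2] off a set of small Gaussian mass, its
   distribution function is squeezed between shifts of the chi-square one. *)
Lemma chi2_sandwich q k (B : 'M[R]_(q, k)) (psi : k.-tuple R -> \bar R) e r K :
  B *m B^T = 1%:M ->
  (forall c, measurable [set z : k.-tuple MR | (psi z <= c%:E)%E]) ->
  (gam k [set z | K < sqn z]%R <= r%:E)%E ->
  (forall z, sqn z <= K ->
     ((enorm (B *m col_tuple z) ^+ 2 - e)%:E <= psi z
      <= (enorm (B *m col_tuple z) ^+ 2 + e)%:E)%E) ->
  forall c, ((chi2_cdf q (c - e) - r)%:E <= gam k [set z | psi z <= c%:E]
             <= (chi2_cdf q (c + e) + r)%:E)%E.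
Proof.
move=> BB mpsi tail approx c.
have mB a : measurable [set z : k.-tuple MR | enorm (B *m col_tuple z) ^+ 2 <= a].
  rewrite (_ : [set z | _] = [set z | [set y | y <= a]
      (dot (B *m col_tuple z) (B *m col_tuple z))]).
    by apply: measurable_dot_mulmx_tuple; rewrite -set_itvNyc; exact: measurable_itv.
  by apply/seteqP; split => z /=; rewrite enorm_sqr.
have Blaw a : gam k [set z | enorm (B *m col_tuple z) ^+ 2 <= a] =
    (chi2_cdf q a)%:E.
  rewrite -chi2_cdfE; transitivity (gam k [set z | [set y | y <= a]
      (dot (B *m col_tuple z) (B *m col_tuple z))]).
    by congr (gam k _); apply/seteqP; split => z /=; rewrite enorm_sqr.
  rewrite projection_law//; last by rewrite -set_itvNyc; exact: measurable_itv.
  by congr (gam q _); apply/seteqP; split => z /=; rewrite sqnE.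
have mK := @measurable_sqn_gt R k K.
apply/andP; split.
  rewrite EFinB leeBlDr// -Blaw (le_trans (std_gaussian_subU (mB (c - e)) (mpsi c) mK _))//.
    move=> z /= Bz; have [zK|] := leP (sqn z) K; last by right.
    left; have /andP[_ h] := approx z zK; rewrite (le_trans h)// lee_fin; lra.
  by rewrite leeD2l.
rewrite EFinD -Blaw (le_trans (std_gaussian_subU (mpsi c) (mB (c + e)) mK _))//.
  move=> z /= pz; have [zK|] := leP (sqn z) K; last by right.
  left; have /andP[h _] := approx z zK; have := le_trans h pz.
  by rewrite lee_fin; lra.
by rewrite leeD2l.
Qed.

(** The statement concerns a single realisation: the estimate [QLR_approx] is applied to the
    recentred process for every bounded draw [xi], and unbounded draws cost only a Gaussian tail. *)
Lemma critical_value_approx q k c K C alpha eps :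
  0 < c -> 0 < K -> 0 <= C -> 0 < alpha < 1 -> 0 < eps -> (0 < q)%N ->
  exists2 eta, 0 < eta &
  forall (Theta : set 'cV[R]_q) theta0 delta (m : 'cV[R]_q -> 'cV[R]_k)
    Sigma M (x : 'cV[R]_q -> 'cV[R]_k) S,
  regular_design Theta theta0 c K eta delta m Sigma M ->
  tame Theta theta0 C eta delta x ->
  close_to Theta eta S Sigma ->
  covariance_matrix (S theta0 theta0) ->
  ((quantile (chi2 q) (1 - alpha) - eps)%:E <=
   critical_value Theta theta0 alpha
     (projected_process theta0 (fun t => x t + m t)%R S) S
   <= (quantile (chi2 q) (1 - alpha) + eps)%:E)%E.
Proof.
move=> c0 K0 C0 alpha01 eps0 q0; set cq := quantile _ _.
have p01 : 0 < 1 - alpha < 1 by lra.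
have e20 : 0 < eps / 2 by rewrite divr_gt0.
have [lo hi] := chi2_quantile q0 p01 e20; rewrite -/cq in lo hi.
(* Half the smaller distance from [1 - alpha] to the chi-square distribution function at
   [cq - eps / 2] and [cq + eps / 2]; this is the tail mass that can be given away. *)
pose r := Num.min (1 - alpha - chi2_cdf q (cq - eps / 2))
                  (chi2_cdf q (cq + eps / 2) - (1 - alpha)) / 2.
have r0 : 0 < r by rewrite divr_gt0// lt_min !subr_gt0 lo hi.
have rlo : r < 1 - alpha - chi2_cdf q (cq - eps / 2).
  have : 2 * r <= 1 - alpha - chi2_cdf q (cq - eps / 2).
    by rewrite /r mulrC divfK// ge_min lexx.
  lra.
have rhi : r < chi2_cdf q (cq + eps / 2) - (1 - alpha).
  have : 2 * r <= chi2_cdf q (cq + eps / 2) - (1 - alpha).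
    by rewrite /r mulrC divfK// ge_min lexx orbT.
  lra.
have [Kz Kz0 tail] := sqn_tail k r0.
pose K' := K + c; have K'0 : 0 < K' by rewrite addr_gt0.
pose D := Num.sqrt K' * Num.sqrt Kz.
have D0 : 0 <= D by rewrite mulr_ge0 ?sqrtr_ge0.
(* [D] bounds the draw [xi], so [D + C] bounds [xi - x theta0], and [C'] bounds the recentred
   process on all of [Theta]. *)
pose C' := C + K' * (c / 2)^-1 * (D + C).
have c20 : 0 < c / 2 by rewrite divr_gt0.
have ci0 : 0 < (c / 2)^-1 by rewrite invr_gt0.
have C'0 : 0 <= C' by rewrite addr_ge0// !mulr_ge0 ?addr_ge0// ltW.
have [etaA etaA0 HA] := @QLR_approx R c K C' (eps / 2) c0 K0 C'0 e20.
(* Recentring inflates the oscillation near [theta0] from [eta] to at most [eta * L]. The 3 counts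
   the errors in replacing [S t theta0 - S theta0 theta0]: two estimation errors and one for the
   continuity of [Sigma]. *)
pose L := 1 + 3 * (c / 2)^-1 * (D + C).
have L1 : 1 <= L by rewrite lerDl !mulr_ge0 ?addr_ge0// ltW.
pose eta := Num.min (etaA / L) (c / 2).
have eta0 : 0 < eta by rewrite lt_min c20 divr_gt0// (lt_le_trans ltr01).
have etaL : eta * L <= etaA.
  by rewrite -ler_pdivlMr ?(lt_le_trans ltr01)// ge_min lexx.
have etaA' : eta <= etaA.
  by rewrite (le_trans _ etaL)// ler_peMr// ltW.
have etac : eta <= c / 2 by rewrite ge_min lexx orbT.
exists eta => // Theta theta0 delta m Sigma M x S RD [xC xnear] SS [symS _].
have Th0 := rd_theta0 RD.
have t00 : enorm (theta0 - theta0) <= delta.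
  by rewrite subrr enorm0 ltW// (rd_delta RD).
have cS0 : coercive (c / 2) (S theta0 theta0).
  move=> v; apply: le_trans (coercive_perturb (rd_coercive RD Th0) (SS _ _ Th0 Th0) v).
  by rewrite ler_wpM2r ?dot_ge0//; move: etac; clear; lra.
have bS t s : Theta t -> Theta s -> mxbound K' (S t s).
  move=> Tt Ts; rewrite -[S t s](subrK (Sigma t s)) addrC.
  apply: mxbound_le (mxboundD (rd_bound RD Tt Ts) (SS _ _ Tt Ts)).
  by rewrite /K' lerD2l (le_trans etac)// ler_pdivrMr// ler_peMr ?ler1n// ltW.
have Su := coercive_unit c20 cS0.
pose A := mx_factor (S theta0 theta0).
have AA : A *m A^T = S theta0 theta0 := mx_factorP symS c20 cS0.
have Au : A \in unitmx.
  by have := Su; rewrite -AA unitmx_mul unitmx_tr andbb.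
have [B BP] := projector_exists Au (rd_injective RD).
have bA := factor_bound (ltW K'0) AA (bS _ _ Th0 Th0).
set h := projected_process _ _ _.
pose psi (z : k.-tuple R) := QLR_function Theta theta0 (A *m col_tuple z) h S.
have approx z : sqn z <= Kz ->
    ((enorm (B *m col_tuple z) ^+ 2 - eps / 2)%:E <= psi z
     <= (enorm (B *m col_tuple z) ^+ 2 + eps / 2)%:E)%E.
  move=> zK; set xi := A *m col_tuple z.
  have xiD : enorm xi <= D.
    rewrite (le_trans (bA _))// ler_wpM2l ?sqrtr_ge0//.
    by rewrite enormE -sqnE ler_wsqrtr.
  have xix : enorm (xi - x theta0) <= D + C.
    by rewrite (le_trans (ler_enormB _ _))// lerD// xC.
  rewrite /psi QLR_function_recentered ?(rd_m0 RD)//.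
  pose x' t := x t + S t theta0 *m invmx (S theta0 theta0) *m (xi - x theta0).
  have x'0 : x' theta0 = xi.
    by rewrite /x' mulmxV// mul1mx addrC subrK.
  have := HA q k Theta theta0 delta m Sigma M x' S A B
    (rd_weaken eta0 etaA' RD).
  rewrite x'0 /xi mulKmx//; apply => //.
  - split=> t Tt.
      rewrite /x' /C' (le_trans (ler_enormD _ _))// lerD ?xC//.
      apply: (le_trans (mxboundM (ltW K'0) (bS _ _ Tt Th0) (coercive_inv c20 cS0) _)).
      by rewrite ler_wpM2l// mulr_ge0// ltW.
    move=> td; rewrite x'0.
    have -> : x' t - xi = (x t - x theta0) +
        (S t theta0 - S theta0 theta0) *m invmx (S theta0 theta0) *m (xi - x theta0).
      rewrite !mulmxBl mulmxV// mul1mx /x'; move: (_ *m (xi - _)) => w.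
      by rewrite opprB addrACA (addrA _ (x theta0)) addNr add0r.
    rewrite (le_trans (ler_enormD _ _))//.
    have b3 : mxbound (3 * eta) (S t theta0 - S theta0 theta0).
      have -> : S t theta0 - S theta0 theta0 = (S t theta0 - Sigma t theta0) +
          (Sigma t theta0 - Sigma theta0 theta0) +
          - (S theta0 theta0 - Sigma theta0 theta0).
        by rewrite opprB !addrA subrK subrK.
      apply: mxbound_le (mxboundD (mxboundD (SS _ _ Tt Th0) (rd_col RD Tt td))
        (mxboundN (SS _ _ Th0 Th0))).
      by clear; lra.
    have := mxboundM _ b3 (coercive_inv c20 cS0) (xi - x theta0).
    have e30 : 0 <= 3 * eta by rewrite mulr_ge0// ltW.
    move=> /(_ e30) h3; have := xnear _ Tt td.
    have : 3 * eta * (c / 2)^-1 * enorm (xi - x theta0) <=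
        3 * eta * (c / 2)^-1 * (D + C).
      by rewrite ler_wpM2l// mulr_ge0// ltW.
    move: etaL; rewrite /L mulrDr mulr1 => etaL h4 h5.
    apply: (le_trans _ etaL); apply: lerD => //; apply: (le_trans h3).
    by apply: (le_trans h4); rewrite !mulrA (mulrC eta).
  - by move=> t Tt; apply: mxbound_le etaA' (SS _ _ Tt Tt).
  - by rewrite AA; apply: mxbound_le etaA' (SS _ _ Th0 Th0).
have mpsi c' : measurable [set z : k.-tuple MR | (psi z <= c'%:E)%E].
  exact: measurable_QLR_function_le.
have gE c' : gaussian (S theta0 theta0)
    [set z | (QLR_function Theta theta0 (col_tuple z) h S <= c'%:E)%E] =
    gam k [set z | (psi z <= c'%:E)%E].
  by rewrite gaussianE; congr (gam k _); apply/seteqP; split => z /=; rewrite tuple_colK.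
have sand := chi2_sandwich BP.1 mpsi tail approx.
rewrite /critical_value; apply/andP; split.
  apply: le_ereal_inf_tmp => _ [c' /= + <-]; rewrite gE lee_fin => c'D.
  rewrite leNgt; apply/negP => c'c; have /andP[_ h1] := sand c'.
  have := le_trans c'D h1; rewrite lee_fin.
  have : chi2_cdf q (c' + eps / 2) <= chi2_cdf q (cq - eps / 2).
    by apply: chi2_cdf_mono; move: c'c; clear; lra.
  by move: rlo; clear; lra.
apply: ge_ereal_inf; exists (cq + eps)%:E => //; exists (cq + eps) => //=.
rewrite gE; have /andP[h1 _] := sand (cq + eps); apply: le_trans h1.
rewrite lee_fin (_ : cq + eps - eps / 2 = cq + eps / 2); last by clear; lra.
by move: rhi; clear; lra.
Qed.

End Critical_value_limit.

(** * Outer probabilities and the bounded-Lipschitz transfer *)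

Section Outer.
Context d (T : measurableType d) (R : realType) (P : probability T R).
Local Open Scope ereal_scope.

Lemma outer_prob_le (A B : set T) : A `<=` B -> outer_prob P A <= outer_prob P B.
Proof.
move=> AB; apply: le_ereal_inf_tmp => _ [C [mC BC] <-].
by apply: ereal_inf_lbound; exists C => //; split=> //; exact: subset_trans BC.
Qed.

Lemma outer_prob_leP (A B : set T) : measurable B -> A `<=` B ->
  outer_prob P A <= P B.
Proof. by move=> mB AB; apply: ereal_inf_lbound; exists B. Qed.

Lemma outer_prob_ge0 (A : set T) : 0 <= outer_prob P A.
Proof. by apply: le_ereal_inf_tmp => _ [C _ <-]. Qed.

Lemma outer_prob_le1 (A : set T) : outer_prob P A <= 1.
Proof. by rewrite -(probability_setT P) outer_prob_leP. Qed.

Lemma outer_prob_fin (A : set T) : outer_prob P A \is a fin_num.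
Proof.
by rewrite ge0_fin_numE ?outer_prob_ge0// (le_lt_trans (outer_prob_le1 _))// ltry.
Qed.

Lemma outer_prob_measurable (A : set T) : measurable A -> outer_prob P A = P A.
Proof.
move=> mA; apply/eqP; rewrite eq_le outer_prob_leP//=.
apply: le_ereal_inf_tmp => _ [C [mC AC] <-].
by apply: le_measure; rewrite ?inE.
Qed.

Lemma outer_probU (A B : set T) :
  outer_prob P (A `|` B) <= outer_prob P A + outer_prob P B.
Proof.
apply/lee_addgt0Pr => e e0.
have e2 : (0 < e / 2)%R by rewrite divr_gt0.
have [_ [A' [mA' AA'] <-] hA] := lb_ereal_inf_adherent e2 (outer_prob_fin A).
have [_ [B' [mB' BB'] <-] hB] := lb_ereal_inf_adherent e2 (outer_prob_fin B).
apply: (@le_trans _ _ (P (A' `|` B'))).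
  by apply: outer_prob_leP; [exact: measurableU|exact: setUSS].
apply: (le_trans (measureU2 _ mA' mB')).
apply: (le_trans (leeD (ltW hA) (ltW hB))).
by rewrite addeACA -EFinD -splitr.
Qed.

Lemma outer_probC (A : set T) : 1 <= outer_prob P A + outer_prob P (~` A).
Proof.
by rewrite -(probability_setT P) -outer_prob_measurable// -(setUv A) outer_probU.
Qed.

(** [X] need not be measurable, so Markov's inequality is applied to each integrable majorant [U]
    before taking the infimum. *)
Lemma outer_expectation_markov (X : T -> R) (A : set T) (c : R) : (0 < c)%R ->
  (forall w, 0 <= X w)%R -> (forall w, A w -> (c <= X w)%R) ->
  c%:E * outer_prob P A <= outer_expectation P X.
Proof.
move=> c0 X0 AX; apply: le_ereal_inf_tmp => _ [U /= [iU XU] <-].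
have mU : measurable_fun setT U by apply/measurable_EFinP; exact: measurable_int iU.
have mB : measurable [set w | (c <= U w)%R].
  rewrite (_ : [set w | _] = U @^-1` `[c, +oo[%classic).
    by rewrite -[X in measurable X]setTI; exact: mU.
  by apply/seteqP; split => w /=; rewrite in_itv/= andbT.
apply: (@le_trans _ _ (c%:E * P [set w | (c <= U w)%R])).
  rewrite lee_pmul2l ?fin_numE//; apply: outer_prob_leP => // w /AX/le_trans.
  by apply; exact: XU.
rewrite unlock.
apply: (@le_trans _ _ (\int[P]_w (c%:E * (\1_[set w | (c <= U w)%R] w)%:E))).
  rewrite ge0_integralZl//= ?lee_fin ?(ltW c0)//.
    by rewrite integral_indic// setIT.
  by apply/measurable_EFinP; exact: measurable_indic.
apply: ge0_le_integral => //=.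
- by move=> w _; rewrite -EFinM lee_fin mulr_ge0// ltW.
- by apply/measurable_EFinP; apply: measurable_funM => //; exact: measurable_indic.
- by apply/measurable_EFinP.
move=> w _; rewrite -EFinM lee_fin indicE; case: (boolP (_ \in _)).
  by move=> /set_mem; rewrite mulr1.
by move=> _; rewrite mulr0 (le_trans (X0 w)).
Qed.

Lemma outer_expectation_le (X : T -> R) (B : set T) (c : R) : (0 < c)%R ->
  (forall w, (X w <= c)%R) -> (forall w, ~ B w -> (X w <= 0)%R) ->
  outer_expectation P X <= c%:E * outer_prob P B.
Proof.
move=> c0 Xc XB; rewrite -lee_pdivrMl//.
apply: le_ereal_inf_tmp => _ [C [mC BC] <-]; rewrite lee_pdivrMl//.
apply: ereal_inf_lbound; exists (fun w => c * \1_C w)%R; first split.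
- have : P.-integrable setT (fun w => (\1_C w : R)%:E).
    by apply: integrable_indic => //; rewrite (le_lt_trans (probability_le1 _ _))// ltry.
  by move=> /(integrableZl measurableT c); apply: eq_integrable.
- move=> w; rewrite indicE; case: (boolP (w \in C)) => wC; first by rewrite mulr1.
  by rewrite mulr0 XB// => /BC /mem_set; apply/negP.
rewrite unlock; under eq_integral do rewrite EFinM.
rewrite ge0_integralZl//= ?lee_fin ?(ltW c0)//.
  by rewrite integral_indic// setIT.
by apply/measurable_EFinP; exact: measurable_indic.
Qed.

End Outer.

Section Transfer.
Context {R : realType}.

Lemma le_abse_dist (a b : \bar R) (e : R) : (`|a - b| <= e%:E -> a <= b + e%:E)%E.
Proof.
case: a b => [a| |] [b| |]; rewrite ?leNye ?leey//.
rewrite -EFinB -EFinD /= !lee_fin ler_norml; lra.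
Qed.

(* The bounded Lipschitz functional is a multiple of a clipped supremum of the
   family [w], so it separates the levels [a] and [b]. *)
Lemma sup_transfer q k (Theta J : set 'cV[R]_q)
    (w : 'cV[R]_q -> ('cV[R]_q -> 'cV[R]_k) -> R) (L a b e : R)
    d (Om : measurableType d) (P : probability Om R) X
    d' (Om' : measurableType d') (Q : probability Om' R) Y :
  Theta !=set0 -> J !=set0 -> 0 < L -> a < b ->
  (forall D x y, 0 <= D -> (forall t, Theta t -> enorm (x t - y t) <= D) ->
     forall t, J t -> `|w t x - w t y| <= L * D) ->
  (forall f, BL1 Theta f ->
     (`|outer_expectation P (fun o => f (X o)) -
        outer_expectation Q (fun o => f (Y o))| <= e%:E)%E) ->
  (outer_prob P [set o | exists2 t, J t & (b < w t (X o))%R] <=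
   outer_prob Q [set o | exists2 t, J t & (a < w t (Y o))%R] +
   (e / Num.min 1 ((b - a) / L))%:E)%E.
Proof.
move=> [t0 Th0] [j0 Jj0] L0 ab Lip XY.
(* Clipping at [b] makes the supremum finite even when the family is unbounded, and does not hide
   whether level [b] is exceeded. *)
pose s x := sup [set Num.min (w t x) b | t in J].
have s_has x : has_sup [set Num.min (w t x) b | t in J].
  split; first by exists (Num.min (w j0 x) b), j0.
  by exists b => _ [t Jt <-]; rewrite ge_min lexx orbT.
have sb x : s x <= b.
  apply: ge_sup; first by case: (s_has x).
  by move=> _ [t Jt <-]; rewrite ge_min lexx orbT.
have sLip D x y : 0 <= D -> (forall t, Theta t -> enorm (x t - y t) <= D) ->
    s x <= s y + L * D.
  move=> D0 xy; apply: ge_sup; first by case: (s_has x).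
  move=> _ [t Jt <-]; have := Lip D x y D0 xy t Jt; rewrite ler_distl => /andP[_ h].
  have hs : Num.min (w t y) b <= s y.
    by apply: ub_le_sup; [exact: (s_has y).2|exists t].
  have LD : 0 <= L * D by rewrite mulr_ge0// ltW.
  rewrite ge_min; move: hs; case: (leP (w t y) b) => wb hs; apply/orP; [left|right]; lra.
(* This factor makes the ramp below both bounded by 1 and 1-Lipschitz; dividing by it produces the
   error term of the conclusion. *)
pose c := Num.min 1 ((b - a) / L).
have c0 : 0 < c by rewrite lt_min ltr01 divr_gt0// subr_gt0.
have c1 : c <= 1 by rewrite ge_min lexx.
have cL : c * L <= b - a by rewrite -ler_pdivlMr// ge_min lexx orbT.
pose f x := c * Num.max 0 ((s x - a) / (b - a)).
have ba : 0 < b - a by rewrite subr_gt0.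
have f0 x : 0 <= f x by rewrite mulr_ge0 ?(ltW c0)// le_max lexx.
have fc x : f x <= c.
  rewrite ler_piMr ?(ltW c0)// ge_max ler01 ler_pdivrMr// mul1r.
  by have := sb x; lra.
have fLip D x y : 0 <= D -> (forall t, Theta t -> enorm (x t - y t) <= D) ->
    f x <= f y + D.
  move=> D0 xy; have h := sLip D x y D0 xy.
  have h1 : c * ((s x - a) / (b - a)) <= c * ((s y - a) / (b - a)) + D.
    rewrite -lerBlDl -mulrBr -mulrBl mulrA ler_pdivrMr//.
    have : c * (s x - a - (s y - a)) <= c * (L * D) by rewrite ler_pM2l//; lra.
    have : c * L * D <= (b - a) * D by rewrite ler_wpM2r.
    lra.
  rewrite /f !maxr_pMr ?(ltW c0)// mulr0 ge_max; apply/andP; split.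
    by rewrite addr_ge0// le_max lexx.
  by rewrite (le_trans h1)// lerD2r le_max lexx orbT.
have fBL : BL1 Theta f.
  split=> [x|x y].
    by rewrite ger0_norm// (le_trans (fc x)).
  set S := ereal_sup _.
  have S0 : (0%:E <= S)%E.
    apply: (@le_trans _ _ (enorm (x t0 - y t0))%:E); first by rewrite lee_fin enorm_ge0.
    by apply: ereal_sup_ubound; exists t0.
  have xyS t : Theta t -> ((enorm (x t - y t))%:E <= S)%E.
    by move=> Tt; apply: ereal_sup_ubound; exists t.
  move: S0 xyS; case: (S) => [D| |] D0 xyD; [|by rewrite leey|by []].
  rewrite !lee_fin in D0 *; rewrite ler_norml.
  have yxD t : Theta t -> enorm (y t - x t) <= D.
    by move=> Tt; rewrite enormB -lee_fin xyD.
  have xyD' t : Theta t -> enorm (x t - y t) <= D by move=> Tt; rewrite -lee_fin xyD.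
  have := fLip D x y D0 xyD'; have := fLip D y x D0 yxD.
  by move=> h1 h2; apply/andP; split; lra.
have := le_abse_dist (XY f fBL).
set EX := outer_expectation P _; set EY := outer_expectation Q _ => EXY.
have h1 : (c%:E * outer_prob P [set o | exists2 t, J t & (b < w t (X o))%R] <= EX)%E.
  apply: outer_expectation_markov => // o [t Jt bw].
  rewrite /f -[leLHS]mulr1 ler_pM2l// le_max; apply/orP; right.
  rewrite ler_pdivlMr// mul1r lerD2r.
  by apply: ub_le_sup; [exact: (s_has _).2|exists t => //; rewrite min_r// ltW].
have h2 : (EY <= c%:E * outer_prob Q [set o | exists2 t, J t & (a < w t (Y o))%R])%E.
  apply: outer_expectation_le => // o nY; rewrite /f pmulr_rle0// ge_max lexx /=.
  rewrite pmulr_lle0 ?invr_gt0// subr_le0.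
  apply: ge_sup; first by case: (s_has (Y o)).
  move=> _ [t Jt <-]; rewrite ge_min leNgt; apply/orP; left; apply/negP => h.
  by apply: nY; exists t.
have := le_trans h1 (le_trans EXY (leeD2r _ h2)).
rewrite -lee_pdivlMl// => /le_trans; apply.
have q0 := outer_prob_fin Q [set o | exists2 t, J t & (a < w t (Y o))%R].
move: (outer_prob Q _) q0 => [p| |] // _.
rewrite -!(EFinM, EFinD) lee_fin le_eqVlt; apply/orP; left.
by apply/eqP; rewrite -/c; field; rewrite gt_eqF.
Qed.

End Transfer.

(** * Limits uniform over a family *)

Section Uniform_limits.
Context {R : realType} {I : Type}.
Implicit Types (D : set I) (F : nat -> I -> \bar R).
Local Open Scope ereal_scope.

Lemma near_sup_le D F : ereal_sup [set F n i | i in D] @[n --> \oo] --> 0%E ->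
  forall e : R, (0 < e)%R -> \forall n \near \oo, forall i, D i -> F n i <= e%:E.
Proof.
move=> Fcvg e e0.
have nb : nbhs (0 : \bar R) [set x | x < e%:E] by apply: lt_nbhsl; exact: e0.
have h : \forall n \near \oo, ereal_sup [set F n i | i in D] < e%:E.
  exact: (Fcvg _ nb).
apply: filterS h => n Fn i Di; apply: le_trans (ltW Fn).
by apply: ereal_sup_ubound; exists i.
Qed.

Lemma near_inf_ge D F : ereal_inf [set F n i | i in D] @[n --> \oo] --> +oo ->
  forall A : R, \forall n \near \oo, forall i, D i -> A%:E <= F n i.
Proof.
move=> /cvgeyPge Fcvg A; apply: filterS (Fcvg A) => n Fn i Di.
by apply: (le_trans Fn); apply: ereal_inf_lbound; exists i.
Qed.

(** The index set has to be nonempty because the supremum of the empty family is [-oo]. *)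
Lemma cvg_sup0 D F : D !=set0 -> (forall n i, D i -> 0 <= F n i) ->
  (forall e : R, (0 < e)%R -> \forall n \near \oo, forall i, D i -> F n i <= e%:E) ->
  ereal_sup [set F n i | i in D] @[n --> \oo] --> 0%E.
Proof.
move=> [i0 Di0] F0 Fle.
pose S n := ereal_sup [set F n i | i in D].
have S0 n : 0 <= S n.
  by apply: le_trans (F0 n i0 Di0) _; apply: ereal_sup_ubound; exists i0.
have Sle e : (0 < e)%R -> \forall n \near \oo, S n <= e%:E.
  move=> e0; apply: filterS (Fle e e0) => n Fn.
  by apply: ge_ereal_sup => _ [i Di <-]; exact: Fn.
apply/fine_cvgP; split.
  apply: filterS (Sle 1%R ltr01) => n Sn.
  by rewrite ge0_fin_numE ?S0// (le_lt_trans Sn)// ltry.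
apply/cvgrPdist_le => e e0; apply: filterS (Sle e e0) => n Sn /=.
rewrite sub0r normrN ger0_norm ?fine_ge0 ?S0//.
have Sf : S n \is a fin_num by rewrite ge0_fin_numE ?S0// (le_lt_trans Sn)// ltry.
by rewrite -lee_fin fineK.
Qed.

End Uniform_limits.

(** * From approximation in probability to laws, critical values and tests *)

Section Conclusions.
Context d (Om : measurableType d) (R : realType).
Variables (P0 : set (probability Om R)) (q : nat) (alpha : R).
Hypothesis P0ne : P0 !=set0.
Hypothesis q0 : (0 < q)%N.
Variables (X c : nat -> Om -> \bar R) (Y : probability Om R -> nat -> Om -> R).
Let F := @chi2_cdf R q.
Let cq : R := quantile (chi2 q) (1 - alpha).

(** Both approximations form one event because the comparison of the two tests uses them
    together. *)
Definition well_approximated (e : R) (P : probability Om R) (n : nat) (w : Om) :=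
  ((Y P n w - e)%:E <= X n w <= (Y P n w + e)%:E)%E /\
  ((cq - e)%:E <= c n w <= (cq + e)%:E)%E.

Hypothesis mY : forall P n, measurable_fun setT (Y P n).
Hypothesis approx : forall e, 0 < e -> \forall n \near \oo, forall P, P0 P ->
  (outer_prob P [set w | ~ well_approximated e P n w] <= e%:E)%E.
(** The slack between [a] and [b] is the price of testing with Lipschitz functionals. *)
Hypothesis law_le : forall a b e, a < b -> 0 < e ->
  \forall n \near \oo, forall P, P0 P ->
  (outer_prob P [set w | (Y P n w <= a)%R] <= (F b + e)%:E)%E.
Hypothesis law_ge : forall a b e, a < b -> 0 < e ->
  \forall n \near \oo, forall P, P0 P ->
  (outer_prob P [set w | (b <= Y P n w)%R] <= (1 - F a + e)%:E)%E.

Lemma near_law_le (x e : R) : 0 < e -> \forall n \near \oo, forall P, P0 P ->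
  (outer_prob P [set w | X n w <= x%:E] <= (F x + e)%:E)%E.
Proof.
move=> e0; have e30 : 0 < e / 3 by rewrite divr_gt0.
have [h h0 Fh] := chi2_cdf_continuous x q0 e30.
pose h' := Num.min (h / 2) (e / 3).
have h'0 : 0 < h' by rewrite lt_min e30 divr_gt0.
have h'h : h' < h by rewrite gt_min; apply/orP; left; lra.
have h'e : h' <= e / 3 by rewrite ge_min lexx orbT.
have xh : x + h' < x + h by lra.
near=> n => P PP.
have A : (outer_prob P [set w | ~ well_approximated h' P n w] <= h'%:E)%E.
  by move: P PP; near: n; exact: approx.
have B : (outer_prob P [set w | (Y P n w <= x + h')%R] <= (F (x + h) + e / 3)%:E)%E.
  by move: P PP {A}; near: n; exact: law_le.
have sub : [set w | (X n w <= x%:E)%E] `<=`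
    [set w | ~ well_approximated h' P n w] `|` [set w | (Y P n w <= x + h')%R].
  move=> w /= Xx; have [g|] := pselect (well_approximated h' P n w); last by left.
  right; case: g => /andP[YX _] _; have := le_trans YX Xx; rewrite lee_fin; lra.
apply: (le_trans (outer_prob_le P sub)); apply: (le_trans (outer_probU P _ _)).
apply: (le_trans (leeD A B)); rewrite -EFinD lee_fin.
have : F (x - h) <= F x by apply: chi2_cdf_mono; lra.
by move: Fh; rewrite -/F; lra.
Unshelve. all: by end_near. Qed.

Lemma near_law_gt (x e : R) : 0 < e -> \forall n \near \oo, forall P, P0 P ->
  (outer_prob P [set w | ~ (X n w <= x%:E)] <= (1 - F x + e)%:E)%E.
Proof.
move=> e0; have e30 : 0 < e / 3 by rewrite divr_gt0.
have [h h0 Fh] := chi2_cdf_continuous x q0 e30.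
pose h' := Num.min (h / 2) (e / 3).
have h'0 : 0 < h' by rewrite lt_min e30 divr_gt0.
have h'h : h' < h by rewrite gt_min; apply/orP; left; lra.
have h'e : h' <= e / 3 by rewrite ge_min lexx orbT.
have xh : x - h < x - h' by lra.
near=> n => P PP.
have A : (outer_prob P [set w | ~ well_approximated h' P n w] <= h'%:E)%E.
  by move: P PP; near: n; exact: approx.
have B : (outer_prob P [set w | (x - h' <= Y P n w)%R] <=
    (1 - F (x - h) + e / 3)%:E)%E.
  by move: P PP {A}; near: n; exact: law_ge.
have sub : [set w | ~ (X n w <= x%:E)%E] `<=`
    [set w | ~ well_approximated h' P n w] `|` [set w | (x - h' <= Y P n w)%R].
  move=> w /= /negP; rewrite -ltNge => Xx.
  have [g|] := pselect (well_approximated h' P n w); last by left.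
  right; case: g => /andP[_ YX] _; have := lt_le_trans Xx YX; rewrite lte_fin; lra.
apply: (le_trans (outer_prob_le P sub)); apply: (le_trans (outer_probU P _ _)).
apply: (le_trans (leeD A B)); rewrite -EFinD lee_fin.
have : F x <= F (x + h) by apply: chi2_cdf_mono; lra.
by move: Fh; rewrite -/F; lra.
Unshelve. all: by end_near. Qed.

(** Only upper bounds on the outer probabilities of an event and of its complement are available. As
    these two sum to at least 1, they also give the lower bounds, for the outer and the inner
    distribution function alike. *)
Lemma conclusion_law : cvg_in_law_uniformly P0 X (chi2 q).
Proof.
move=> x _; rewrite chi2_itvE -/F.
have two_sided e : 0 < e -> \forall n \near \oo, forall P, P0 P ->
    (`|outer_prob P [set w | X n w <= x%:E] - (F x)%:E| <= e%:E)%E /\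
    (`|inner_prob P [set w | X n w <= x%:E] - (F x)%:E| <= e%:E)%E.
  move=> e0; near=> n => P PP; rewrite /inner_prob.
  have A : (outer_prob P [set w | X n w <= x%:E] <= (F x + e)%:E)%E.
    by move: P PP; near: n; exact: near_law_le.
  have B : (outer_prob P [set w | ~ (X n w <= x%:E)] <= (1 - F x + e)%:E)%E.
    by move: P PP {A}; near: n; exact: near_law_gt.
  have := outer_probC P [set w | (X n w <= x%:E)%E].
  have -> : ~` [set w | (X n w <= x%:E)%E] = [set w | ~ (X n w <= x%:E)%E] by [].
  move: A B (outer_prob_fin P [set w | (X n w <= x%:E)%E])
    (outer_prob_fin P [set w | ~ (X n w <= x%:E)%E]).
  move: (outer_prob P _) (outer_prob P _) => [u| |] [v| |] // A B _ _ uv.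
  rewrite !lee_fin in A B; rewrite -EFinD lee_fin in uv.
  by split; rewrite /= lee_fin ler_norml; apply/andP; split; lra.
split; apply: cvg_sup0 => // e e0;
  by apply: filterS (two_sided e e0) => n H P PP; case: (H P PP).
Unshelve. all: by end_near. Qed.

Lemma conclusion_critical_value : cvg_in_prob_uniformly P0 c cq.
Proof.
move=> eps eps0; apply: cvg_sup0 => // [n P _|e e0]; first exact: outer_prob_ge0.
pose h := Num.min eps e.
have h0 : 0 < h by rewrite lt_min eps0.
have heps : h <= eps by rewrite ge_min lexx.
have he : h <= e by rewrite ge_min lexx orbT.
apply: filterS (approx h0) => n A P PP; have {}A := A P PP.
have heE : (h%:E <= e%:E)%E by rewrite lee_fin.
apply: (le_trans _ (le_trans A heE)); apply: outer_prob_le => w /= + [_].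
case: (c n w) => [y| |] cy /andP[h1 h2] //.
rewrite !lee_fin in h1 h2; move: cy; rewrite lte_fin ltNge => /negP; apply.
by rewrite ler_norml; apply/andP; split; lra.
Qed.

(** On the good event the tests disagree only if [Y] lies within [2 h'] of [cq], one [h'] coming
    from the statistic and one from the critical value. The mass of this band is controlled by
    continuity of the chi-square law. *)
Lemma conclusion_test : ereal_sup [set outer_prob P
    [set w | (c n w < X n w)%E != (cq%:E < X n w)%E] | P in P0] @[n --> \oo] --> 0%E.
Proof.
apply: cvg_sup0 => // [n P _|e e0]; first exact: outer_prob_ge0.
have e40 : 0 < e / 4 by rewrite divr_gt0.
have [h h0 Fh] := chi2_cdf_continuous cq q0 e40.
pose h' := Num.min (h / 3) (e / 4).
have h'0 : 0 < h' by rewrite lt_min e40 divr_gt0.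
have h'h : h' <= h / 3 by rewrite ge_min lexx.
have h'e : h' <= e / 4 by rewrite ge_min lexx orbT.
have up : cq + 2 * h' < cq + h by lra.
have dn : cq - h < cq - 2 * h' by lra.
near=> n => P PP.
have A : (outer_prob P [set w | ~ well_approximated h' P n w] <= h'%:E)%E.
  by move: P PP; near: n; exact: approx.
have B : (outer_prob P [set w | (Y P n w <= cq + 2 * h')%R] <=
    (F (cq + h) + e / 4)%:E)%E.
  by move: P PP {A}; near: n; exact: law_le.
have C : (outer_prob P [set w | (cq - 2 * h' <= Y P n w)%R] <=
    (1 - F (cq - h) + e / 4)%:E)%E.
  by move: P PP {A B}; near: n; exact: law_ge.
pose U := [set w | (Y P n w <= cq + 2 * h')%R].
pose V := [set w | (cq - 2 * h' <= Y P n w)%R].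
have mU : measurable U.
  have := mY P n measurableT (measurable_itv `]-oo, cq + 2 * h']).
  rewrite setTI (_ : _ @^-1` _ = U)//.
have mV : measurable V.
  have := mY P n measurableT (measurable_itv `[cq - 2 * h', +oo[).
  rewrite setTI (_ : _ @^-1` _ = V)//.
  by apply/seteqP; split => w; rewrite /V /= in_itv/= andbT.
have UV : U `|` V = setT.
  apply/seteqP; split => w // _; rewrite /U /V /=.
  have [|/ltW Yc] := leP (Y P n w) (cq + 2 * h'); first by left.
  by right; lra.
(* As [U] and [V] cover the space, the mass of their intersection is [P U + P V - 1]. This
   additivity is where measurability of [Y] enters. *)
have PUV : (P (U `&` V) <= (e / 4 + e / 2)%:E)%E.
  rewrite outer_prob_measurable// in B; rewrite outer_prob_measurable// in C.
  have UD : U `\` V = ~` V.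
    apply/seteqP; split => [w []//|w nV]; split=> //.
    by have : (U `|` V) w by [rewrite UV|]; case.
  have PUE : (P U = 1 - P V + P (U `&` V))%E.
    by rewrite -(probability_setC _ mV) -UD; exact: measureDI.
  move: B C PUE; rewrite -/U -/V.
  have := fineK (fin_num_measure P _ mV).
  have := fineK (fin_num_measure P _ (measurableI _ _ mU mV)).
  move: (fine (P V)) (fine (P (U `&` V))) => v u <- <- PU PV PUE.
  by move: PU PV; rewrite PUE /= !lee_fin; move: Fh; rewrite -/F; lra.
have sub : [set w | (c n w < X n w)%E != (cq%:E < X n w)%E] `<=`
    [set w | ~ well_approximated h' P n w] `|` (U `&` V).
  move=> w /= cX; have [g|] := pselect (well_approximated h' P n w); last by left.
  right; case: g => /andP[YX XY] /andP[ch hc].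
  move: cX YX XY ch hc; rewrite /U /V /=; case: (X n w) => [x| |] //; case: (c n w) => [y| |] //.
  rewrite !lte_fin !lee_fin => cX YX XY cy yc; split; rewrite leNgt; apply/negP => h1.
    move: cX; have -> : y < x by lra.
    by have -> : cq < x by lra.
  move: cX; have -> : (y < x) = false by apply/negbTE; rewrite -leNgt; lra.
  by have -> : (cq < x) = false by apply/negbTE; rewrite -leNgt; lra.
apply: (le_trans (outer_prob_le P sub)); apply: (le_trans (outer_probU P _ _)).
rewrite -(outer_prob_measurable P (measurableI _ _ mU mV)) in PUV.
apply: (le_trans (leeD A PUV)); rewrite -EFinD lee_fin; lra.
Unshelve. all: by end_near. Qed.

End Conclusions.

(** * Gaussian processes and strong identification *)

Section Process_facts.
Context {R : realType} {q k : nat} d (Om : measurableType d).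
Variables (Q : probability Om R) (Theta : set 'cV[R]_q).
Variables (G : Om -> 'cV[R]_q -> 'cV[R]_k) (Sigma : 'cV[R]_q -> 'cV[R]_q -> 'M[R]_k).
Hypothesis HG : centered_gaussian_process Q Theta G Sigma.

Lemma covariance_sym t s : Theta t -> Theta s -> (Sigma t s)^T = Sigma s t.
Proof.
case: HG => _ _ cov _ Tt Ts; apply/matrixP => i j; rewrite mxE.
apply: EFin_inj; rewrite -!cov//; congr expectation.
by apply/funext => w; rewrite mulrC.
Qed.

Lemma expectation_mul_le (X Y : Om -> R) (a b ab : R) :
  measurable_fun setT X -> measurable_fun setT Y ->
  ('E_Q[fun w => (X w * X w)%R] = a%:E)%E -> ('E_Q[fun w => (Y w * Y w)%R] = b%:E)%E ->
  ('E_Q[fun w => (X w * Y w)%R] = ab%:E)%E -> `|ab| <= a + b.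
Proof.
move=> mX mY; rewrite unlock => EX EY EXY.
have mXX : measurable_fun setT (fun w => (X w * X w)%:E).
  by apply/measurable_EFinP; exact: measurable_funM.
have mYY : measurable_fun setT (fun w => (Y w * Y w)%:E).
  by apply/measurable_EFinP; exact: measurable_funM.
have mXY : measurable_fun setT (fun w => (X w * Y w)%:E).
  by apply/measurable_EFinP; exact: measurable_funM.
rewrite -lee_fin EFinD -EX -EY -ge0_integralD//=; last 2 first.
- by move=> w _; rewrite lee_fin -expr2 sqr_ge0.
- by move=> w _; rewrite lee_fin -expr2 sqr_ge0.
have -> : `|ab|%:E = `|ab%:E|%E by [].
rewrite -EXY; apply: (le_trans (le_abse_integral _ measurableT mXY)).
apply: ge0_le_integral => //=.
- by apply/measurable_EFinP; apply: measurableT_comp => //; exact: measurable_funM.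
- exact: (emeasurable_funD mXX mYY).
move=> w _; rewrite -EFinD lee_fin normrM.
have := sqr_ge0 (`|X w| - `|Y w|); rewrite sqrrB -!expr2.
rewrite !real_normK ?num_real//; have := normr_ge0 (X w); have := normr_ge0 (Y w); nra.
Qed.

(** The eigenvalue hypothesis bounds only [Sigma t t]; the cross-covariances are controlled through
    [|X Y| <= X^2 + Y^2]. *)
Lemma covariance_entry_le t s i j : Theta t -> Theta s ->
  `|Sigma t s i j| <= Sigma t t i i + Sigma s s j j.
Proof.
case: HG => mG _ cov _ Tt Ts.
by apply: (expectation_mul_le (mG t i Tt) (mG s j Ts)); exact: cov.
Qed.

(** Multiplying by [V] whitens the marginal at [t0], so the projection law applies and the result
    does not depend on [B]. *)
Lemma marginal_law t0 p (B : 'M[R]_(p, k)) c (A : set (measurableTypeR R)) :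
  Theta t0 -> 0 < c -> coercive c (Sigma t0 t0) -> B *m B^T = 1%:M ->
  measurable A ->
  let V := invmx (mx_factor (Sigma t0 t0)) in
  Q [set w | A (dot (B *m (V *m G w t0)) (B *m (V *m G w t0)))] =
  std_gaussian p [set z | A (sqn z)].
Proof.
case: HG => _ _ _ fdd T0 c0 cS BB mA V.
set S := Sigma t0 t0 in cS V *.
have AA : mx_factor S *m (mx_factor S)^T = S.
  by apply: (mx_factorP _ c0 cS); exact: covariance_sym.
have Au : mx_factor S \in unitmx.
  by have := coercive_unit c0 cS; rewrite -{1}AA unitmx_mul unitmx_tr andbb.
pose D := [set z : k.-tuple (measurableTypeR R) |
  A (dot ((B *m V) *m col_tuple z) ((B *m V) *m col_tuple z))].
have mD : measurable D := measurable_dot_mulmx_tuple (B *m V) mA.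
have := fdd k (fun i => (t0, i)) D (fun=> T0) mD.
rewrite (_ : \matrix_(i, j) _ = S); last by apply/matrixP => i j; rewrite mxE.
rewrite gaussianE => QD; transitivity (Q [set w | D [tuple G w t0 i 0 | i < k]]).
  congr (Q _); apply/seteqP; split => w; rewrite /D /=;
    by rewrite (tuple_colK (G w t0)) mulmxA.
rewrite QD; transitivity (std_gaussian k [set z : k.-tuple R |
    A (dot (B *m col_tuple z) (B *m col_tuple z))]).
  congr (std_gaussian k _); apply/seteqP; split => z; rewrite /D /= tuple_colK;
    by rewrite -mulmxA mulKmx.
rewrite projection_law//; congr (std_gaussian p _).
by apply/seteqP; split => z /=; rewrite sqnE.
Qed.

End Process_facts.

(** A supremum over the empty set is [-oo] and cannot tend to 0; thus hypothesis (1) already yields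
    a measure in [P0]. *)
Lemma cvg_sup0_ne {R : realType} {I : Type} (D : set I) (F : nat -> I -> \bar R) :
  ereal_sup [set F n i | i in D] @[n --> \oo] --> 0%E -> D !=set0.
Proof.
move=> Fcvg.
have nb : nbhs (0 : \bar R)%E [set x | (-oo < x)%E] 
  by apply: (@filterE _ (nbhs (0 : R))) => r; exact: ltNyr.
have h : \forall n \near \oo, (-oo < ereal_sup [set F n i | i in D])%E.
  exact: (Fcvg _ nb).
have [n _ /(_ n (leqnn n)) /= Fn] := h.
by apply: contraPP Fn => /set0P/negP/negPn/eqP ->; rewrite image_set0 ereal_sup0.
Qed.

(** Applied to the neighbourhoods of [theta0], this yields [0 <= delta T] eventually. *)
Lemma near_sup_nested_ne {R : realType} {I J : Type} (D : set I)
    (E : nat -> set J) (F : nat -> I -> J -> \bar R) :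
  ereal_sup [set ereal_sup [set F n i j | j in E n] | i in D] @[n --> \oo]
    --> 0%E ->
  \forall n \near \oo, E n !=set0.
Proof.
move=> Fcvg.
have nb : nbhs (0 : \bar R)%E [set x | (-oo < x)%E] 
  by apply: (@filterE _ (nbhs (0 : R))) => r; exact: ltNyr.
have h : \forall n \near \oo,
    (-oo < ereal_sup [set ereal_sup [set F n i j | j in E n] | i in D])%E.
  exact: (Fcvg _ nb).
apply: filterS h => n; apply: contraPP => /set0P/negP/negPn/eqP En.
apply/negP; rewrite -leNgt; apply: ge_ereal_sup => _ [i _ <-].
by rewrite En image_set0 ereal_sup0.
Qed.

Lemma interior_enorm_ball {R : realType} n (A : set 'cV[R]_n) a : interior A a ->
  exists2 e : R, 0 < e & forall t, enorm (t - a) < e -> A t.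
Proof.
move=> /nbhs_ballP[e /= e0 eA]; exists e => // t ta; apply: eA.
split=> // i j; rewrite ord1 /ball/= distrC.
have := ler_coord_enorm (t - a) i; rewrite !mxE => h; exact: le_lt_trans h ta.
Qed.

Lemma near_regular_design {R : realType} (I : Type) (P0 : set I) (q k : nat)
    (Theta : set 'cV[R]_q) (theta0 : 'cV[R]_q) (c K : R)
    (m : I -> nat -> 'cV[R]_q -> 'cV[R]_k)
    (Sigma : I -> 'cV[R]_q -> 'cV[R]_q -> 'M[R]_k)
    (delta : nat -> R) (M : I -> nat -> 'M[R]_(k, q)) :
  let near T := [set theta | Theta theta /\ enorm (theta - theta0) <= delta T] in
  let far T := [set theta | Theta theta /\ delta T < enorm (theta - theta0)] in
  (0 < q)%N -> P0 !=set0 -> interior Theta theta0 -> 0 < c ->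
  (forall P, P0 P -> forall T, m P T theta0 = 0) ->
  (forall P, P0 P -> forall t, Theta t -> coercive c (Sigma P t t)) ->
  (forall P, P0 P -> (Sigma P theta0 theta0)^T = Sigma P theta0 theta0) ->
  (forall P, P0 P -> forall t s, Theta t -> Theta s -> mxbound K (Sigma P t s)) ->
  delta @ \oo --> 0 ->
  ereal_inf [set ereal_inf [set
      (qform (invmx (Sigma P theta theta)) (m P T theta))%:E
      | theta in far T] | P in P0] @[T --> \oo] --> +oo%E ->
  ereal_sup [set ereal_sup [set
      (enorm (m P T theta - M P T *m (theta - theta0)))%:E
      | theta in near T] | P in P0] @[T --> \oo] --> 0%E ->
  ereal_inf [set (delta T ^+ 2 *
      lambda_min ((M P T)^T *m invmx (Sigma P theta0 theta0) *m M P T))%:E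
      | P in P0] @[T --> \oo] --> +oo%E ->
  ereal_sup [set ereal_sup [set
      (opnorm (Sigma P theta theta - Sigma P theta0 theta0))%:E
      | theta in near T] | P in P0] @[T --> \oo] --> 0%E ->
  ereal_sup [set ereal_sup [set
      (opnorm (Sigma P theta theta0 - Sigma P theta0 theta0))%:E
      | theta in near T] | P in P0] @[T --> \oo] --> 0%E ->
  forall eta, 0 < eta -> \forall T \near \oo, forall P, P0 P ->
    regular_design Theta theta0 c K eta (delta T) (m P T) (Sigma P) (M P T).
Proof.
move=> nearT farT q0 [P1 PP1] Hint c0 m0 coer sym bnd dcvg Hi Hii Hiii Hiv Hiv' eta eta0.
have Th0 : Theta theta0 := nbhs_singleton Hint.
have [e e0 eTh] := interior_enorm_ball Hint.
have near_e : \forall T \near \oo, `|delta T| < e.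
  by have /cvgr0Pnorm_lt := dcvg; apply.
have near_ne := near_sup_nested_ne Hii.
have near_i := near_inf_ge Hi eta^-1.
have near_ii := near_sup_le Hii eta0.
(* Combined with [<v, S^-1 v> <= c^-1 |v|^2], the threshold [(c eta^2)^-1] for [delta^2 lambda_min]
   gives [|b|^2 <= delta^2 eta^2 |M b|^2]. *)
have near_iii := near_inf_ge Hiii (1 + (c * eta ^+ 2)^-1).
have near_iv : \forall T \near \oo, forall P, P0 P -> forall s, nearT T s ->
    mxbound eta (Sigma P s s - Sigma P theta0 theta0).
  apply: filterS (near_sup_le Hiv eta0) => T h P PP s Ts.
  apply: mxbound_le (mxbound_opnorm _); rewrite -lee_fin.
  exact: le_trans (ereal_sup_ubound (imageP _ Ts)) (h P PP).
have near_iv' : \forall T \near \oo, forall P, P0 P -> forall s, nearT T s ->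
    mxbound eta (Sigma P s theta0 - Sigma P theta0 theta0).
  apply: filterS (near_sup_le Hiv' eta0) => T h P PP s Ts.
  apply: mxbound_le (mxbound_opnorm _); rewrite -lee_fin.
  exact: le_trans (ereal_sup_ubound (imageP _ Ts)) (h P PP).
near=> T => P PP.
have dT : `|delta T| < e by near: T.
have [t [Tt td]] : nearT T !=set0 by near: T.
have hi : (eta^-1%:E <= ereal_inf [set
      (qform (invmx (Sigma P theta theta)) (m P T theta))%:E
      | theta in farT T])%E by move: P PP; near: T; exact: near_i.
have hii : (ereal_sup [set (enorm (m P T theta - M P T *m (theta - theta0)))%:E
      | theta in nearT T] <= eta%:E)%E by move: P PP {hi}; near: T; exact: near_ii.
have hiii : ((1 + (c * eta ^+ 2)^-1)%:E <= (delta T ^+ 2 *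
      lambda_min ((M P T)^T *m invmx (Sigma P theta0 theta0) *m M P T))%:E)%E.
  by move: P PP {hi hii}; near: T; exact: near_iii.
have hiv s : nearT T s -> mxbound eta (Sigma P s s - Sigma P theta0 theta0).
  by move: P PP s {hi hii hiii}; near: T; exact: near_iv.
have hiv' s : nearT T s -> mxbound eta (Sigma P s theta0 - Sigma P theta0 theta0).
  by move: P PP s {hi hii hiii hiv}; near: T; exact: near_iv'.
have ce0 : 0 < (c * eta ^+ 2)^-1 by rewrite invr_gt0 mulr_gt0 ?exprn_gt0.
rewrite lee_fin in hiii.
(* The neighbourhood is nonempty, so [delta T] is nonnegative; it cannot vanish, since (iii) puts a
   positive number below [delta^2 lambda_min]. *)
have d0 : 0 < delta T.
  have : 0 <= delta T := le_trans (enorm_ge0 _) td.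
  rewrite le_eqVlt => /predU1P[d0|//]; move: hiii.
  by rewrite -d0 expr0n mul0r leNgt addr_gt0.
have deT : delta T < e by rewrite -(gtr0_norm d0).
have dsq : 0 < delta T ^+ 2 by rewrite exprn_gt0.
split=> //.
- by move=> s sd; apply: eTh; exact: le_lt_trans deT.
- exact: coer.
- exact: bnd.
- exact: m0.
- move=> s Ts sd; have := le_trans hi (ereal_inf_lbound (imageP _ (conj Ts sd))).
  by rewrite lee_fin qformE.
- move=> s Ts sd; have := le_trans (ereal_sup_ubound (imageP _ (conj Ts sd))) hii.
  by rewrite lee_fin.
- move=> b; set S := Sigma P theta0 theta0 in hiii *.
  set N := (M P T)^T *m invmx S *m M P T in hiii *.
  have sN : N^T = N.
    by rewrite /N !trmx_mul trmxK mulmxA trmx_inv (sym _ PP).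
  have Nb := lambda_min_coercive q0 sN b.
  set l := lambda_min N in hiii Nb.
  have NE : dot b (N *m b) = dot (M P T *m b) (invmx S *m (M P T *m b)).
    by rewrite /N -!mulmxA dot_mulmxr trmxK.
  rewrite NE in Nb; have := dot_inv_le (M P T *m b) c0 (coer _ PP _ Th0); rewrite -/S => Sb.
  have {Sb}Nb := le_trans Nb Sb; rewrite -!enorm_sqr in Nb.
  have A0 := enorm_ge0 b; have B0 := enorm_ge0 (M P T *m b).
  have e20 : 0 < eta ^+ 2 by rewrite exprn_gt0.
  rewrite -(@ler_pXn2r _ 2) ?nnegrE ?mulr_ge0 ?(ltW d0) ?(ltW eta0)// !exprMn.
  have h1 : (c * eta ^+ 2)^-1 * enorm b ^+ 2 <= delta T ^+ 2 * l * enorm b ^+ 2.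
    by rewrite ler_wpM2r ?sqr_ge0// (le_trans _ hiii)// lerDr.
  have h2 : delta T ^+ 2 * (l * enorm b ^+ 2) <=
      delta T ^+ 2 * (c^-1 * enorm (M P T *m b) ^+ 2) by rewrite ler_pM2l.
  rewrite -mulrA in h1; have := le_trans h1 h2.
  rewrite mulrC ler_pdivrMr ?mulr_gt0// => h3; apply: (le_trans h3).
  by rewrite le_eqVlt; apply/orP; left; apply/eqP; field; rewrite gt_eqF.
- by move=> s Ts sd; apply: hiv.
- by move=> s Ts sd; apply: hiv'.
Unshelve. all: by end_near. Qed.

(** The norm is used rather than its square because only the norm is globally Lipschitz. [B]
    contracts, as [|y|^2 - |B y|^2] is an attained squared norm, and [|A^-1 v|^2 = <v, S^-1 v>] is
    at most [|v|^2 / c]. *)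
Lemma projected_norm_lipschitz {R : realType} q k (A S : 'M[R]_k) (M : 'M[R]_(k, q))
    (B : 'M[R]_(q, k)) c u v :
  0 < c -> coercive c S -> A *m A^T = S -> projector_for (invmx A *m M) B ->
  `|enorm (B *m (invmx A *m u)) - enorm (B *m (invmx A *m v))|
  <= Num.sqrt c^-1 * enorm (u - v).
Proof.
move=> c0 cS AS [_ BP]; apply: (le_trans (ler_dist_enorm _ _)).
rewrite -!mulmxBr; set y := invmx A *m (u - v).
have By : enorm (B *m y) <= enorm y.
  rewrite !enormE ler_wsqrtr//; have [_ [b bE]] := BP y.
  by have := dot_ge0 (y + invmx A *m M *m b); rewrite bE subr_ge0.
apply: (le_trans By); rewrite -(@ler_pXn2r _ 2) ?nnegrE ?mulr_ge0 ?enorm_ge0 ?sqrtr_ge0//.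
rewrite exprMn !enorm_sqr sqr_sqrtr ?invr_ge0 ?(ltW c0)// /y.
rewrite -(dot_invmx_factor _ (coercive_unit c0 cS) AS).
exact: dot_inv_le.
Qed.

Theorem theorem2 (R : realType) (q k : nat)
  (Theta : set 'cV[R]_q) (theta0 : 'cV[R]_q)
  (Htheta0 : Theta theta0) (Hint : interior Theta theta0)
  (alpha : R) (Halpha : 0 < alpha < 1)
  (d d' : measure_display)
  (Omega : measurableType d) (Omega' : measurableType d')
  (P0 : set (probability Omega R))
  (g : nat -> Omega -> 'cV[R]_q -> 'cV[R]_k)
  (Hg : forall T, stochastic_process Theta (g T))
  (m : probability Omega R -> nat -> 'cV[R]_q -> 'cV[R]_k)
  (Hm : forall P, P0 P -> forall T, m P T theta0 = 0)
  (Q : probability Omega R -> probability Omega' R)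
  (G : probability Omega R -> Omega' -> 'cV[R]_q -> 'cV[R]_k)
  (Sigma : probability Omega R -> 'cV[R]_q -> 'cV[R]_q -> 'M[R]_k)
  (HG : forall P, P0 P ->
     centered_gaussian_process (Q P) Theta (G P) (Sigma P))
  (H1 : ereal_sup [set ereal_sup [set
            `|outer_expectation P (fun w => f (fun theta => (g T w theta - m P T theta)%R))
              - outer_expectation (Q P) (fun w => f (G P w))|%E
          | f in BL1 Theta] | P in P0] @[T --> \oo] --> 0%E)
  (H2 : exists lbar : R, 0 < lbar /\
     let lo := ereal_inf [set ereal_inf [set (lambda_min (Sigma P theta theta))%:E
                 | theta in Theta] | P in P0] in
     let hi := ereal_sup [set ereal_sup [set (lambda_max (Sigma P theta theta))%:E
                 | theta in Theta] | P in P0] in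
     [/\ ((1 / lbar)%:E <= lo)%E, (lo <= hi)%E & (hi <= lbar%:E)%E])
  (Sigmahat : nat -> Omega -> 'cV[R]_q -> 'cV[R]_q -> 'M[R]_k)
  (HSigmahat : forall T theta theta' i j, Theta theta -> Theta theta' ->
     measurable_fun setT (fun w => Sigmahat T w theta theta' i j))
  (HSigmahat0 : forall T w, covariance_matrix (Sigmahat T w theta0 theta0))
  (H3 : forall eps : R, 0 < eps ->
     ereal_sup [set outer_prob P [set w | (eps%:E <
         ereal_sup [set ereal_sup [set
             (opnorm (Sigmahat T w theta theta' - Sigma P theta theta')%R)%:E
           | theta' in Theta] | theta in Theta])%E]
       | P in P0] @[T --> \oo] --> 0%E)
  (H4 : exists delta : nat -> R, delta @ \oo --> 0 /\
     exists M : probability Omega R -> nat -> 'M[R]_(k, q),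
     let near T := [set theta | Theta theta /\ enorm (theta - theta0) <= delta T] in
     let far T := [set theta | Theta theta /\ delta T < enorm (theta - theta0)] in
     forall eps : R, 0 < eps ->
     (* (i) *)
     ereal_inf [set ereal_inf [set
         (qform (invmx (Sigma P theta theta)) (m P T theta))%:E
         | theta in far T] | P in P0] @[T --> \oo] --> +oo%E /\
     (* (ii) *)
     ereal_sup [set ereal_sup [set
         (enorm (m P T theta - M P T *m (theta - theta0)))%:E
         | theta in near T] | P in P0] @[T --> \oo] --> 0%E /\
     (* (iii) *)
     ereal_inf [set
         (delta T ^+ 2 *
          lambda_min ((M P T)^T *m invmx (Sigma P theta0 theta0) *m M P T))%:E
         | P in P0] @[T --> \oo] --> +oo%E /\
     (* (iv) *)
     ereal_sup [set ereal_sup [set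
         (opnorm (Sigma P theta theta - Sigma P theta0 theta0))%:E
         | theta in near T] | P in P0] @[T --> \oo] --> 0%E /\
     ereal_sup [set ereal_sup [set
         (opnorm (Sigma P theta theta0 - Sigma P theta0 theta0))%:E
         | theta in near T] | P in P0] @[T --> \oo] --> 0%E /\
     (* (v) *)
     ereal_sup [set outer_prob (Q P) [set w | (eps%:E <
         ereal_sup [set (enorm (G P w theta - G P w theta0)%R)%:E
           | theta in near T])%E]
         | P in P0] @[T --> \oo] --> 0%E /\
     (* (vi) *)
     exists C : R,
       (ereal_sup [set outer_prob (Q P) [set w | (C%:E <
          ereal_sup [set (enorm (G P w theta))%:E | theta in Theta])%E]
          | P in P0] < eps%:E)%E) :
  let qlr T w := QLR Theta theta0 (g T w) (Sigmahat T w) in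
  let c T w := critical_value Theta theta0 alpha
    (projected_process theta0 (g T w) (Sigmahat T w)) (Sigmahat T w) in
  let c_chi2 := quantile (chi2 q) (1 - alpha) in
  [/\ cvg_in_law_uniformly P0 qlr (chi2 q),
      cvg_in_prob_uniformly P0 c c_chi2
    & ereal_sup [set outer_prob P
          [set w | (c T w < qlr T w)%E != (c_chi2%:E < qlr T w)%E]
        | P in P0] @[T --> \oo] --> 0%E].
Proof.
move=> qlr c c_chi2.
have P0ne := cvg_sup0_ne H1.
have [P1 PP1] := P0ne.
have [lbar [lbar0 [Hlo _ Hhi]]] := H2.
have [delta [dcvg [M H4']]] := H4.
pose nearT T := [set theta | Theta theta /\ enorm (theta - theta0) <= delta T].
have [Hi [Hii [Hiii [Hiv [Hiv' _]]]]] := H4' 1 ltr01.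
have Hv eps (e0 : 0 < eps) := let: conj _ (conj _ (conj _ (conj _ (conj _ (conj h _))))) :=
  H4' eps e0 in h.
have Hvi eps (e0 : 0 < eps) := let: conj _ (conj _ (conj _ (conj _ (conj _ (conj _ h))))) :=
  H4' eps e0 in h.
have lmin P t : P0 P -> Theta t -> lbar^-1 <= lambda_min (Sigma P t t).
  move=> PP Tt; rewrite -lee_fin -div1r; apply: (le_trans Hlo).
  apply: (le_trans (ereal_inf_lbound (imageP _ PP))).
  exact: (ereal_inf_lbound (imageP _ Tt)).
have lmax P t : P0 P -> Theta t -> lambda_max (Sigma P t t) <= lbar.
  move=> PP Tt; rewrite -lee_fin; apply: (le_trans _ Hhi).
  apply: (le_trans _ (ereal_sup_ubound (imageP _ PP))).
  exact: (ereal_sup_ubound (imageP _ Tt)).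
have li0 : 0 < lbar^-1 by rewrite invr_gt0.
have k0 : (0 < k)%N.
  apply: (@lambda_min_neq0 R k (Sigma P1 theta0 theta0)).
  by rewrite gt_eqF// (lt_le_trans li0)// lmin.
(* Condition (iii) makes a smallest eigenvalue of a [q] by [q] matrix nonzero. *)
have q0 : (0 < q)%N.
  have [T _ /(_ T (leqnn T)) /(_ P1 PP1)] := near_inf_ge Hiii 1.
  rewrite lee_fin => h; apply: (@lambda_min_neq0 R q
    ((M P1 T)^T *m invmx (Sigma P1 theta0 theta0) *m M P1 T)).
  by apply: contraTneq h => ->; rewrite mulr0 -ltNge ltr01.
have sym P t : P0 P -> Theta t -> (Sigma P t t)^T = Sigma P t t.
  by move=> PP Tt; exact: (covariance_sym (HG P PP)).
have coer P : P0 P -> forall t, Theta t -> coercive lbar^-1 (Sigma P t t).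
  move=> PP t Tt v; apply: le_trans (lambda_min_coercive k0 (sym _ _ PP Tt) v).
  by rewrite ler_wpM2r ?dot_ge0// lmin.
(* Every entry of a cross-covariance is at most [lbar + lbar]; the multiplicity comes from
   [mxbound_entries]. *)
pose K := (lbar + lbar) *+ (k * k).
have K0 : 0 < K by rewrite pmulrn_lgt0 ?muln_gt0 ?k0// addr_gt0.
have diag P t i : P0 P -> Theta t -> Sigma P t t i i <= lbar.
  move=> PP Tt; apply: (le_trans _ (lmax P t PP Tt)).
  have := lambda_max_ge (delta_mx i 0) k0 (sym _ _ PP Tt).
  rewrite dotE (bigD1 i)//= big1 ?addr0 => [|j ji]; last first.
    by rewrite mxE (negbTE ji) mul0r.
  rewrite -colE !mxE !eqxx mul1r dotE (bigD1 i)//= big1 ?addr0 => [|j ji]; last first.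
    by rewrite mxE (negbTE ji) mul0r.
  by rewrite !mxE !eqxx !mulr1.
have bnd P : P0 P -> forall t s, Theta t -> Theta s -> mxbound K (Sigma P t s).
  move=> PP t s Tt Ts; apply: mxbound_entries => i j.
  apply: (le_trans (covariance_entry_le (HG P PP) i j Tt Ts)).
  by rewrite lerD// diag.
have reg eta : 0 < eta -> \forall T \near \oo, forall P, P0 P ->
    regular_design Theta theta0 lbar^-1 K eta (delta T) (m P T) (Sigma P) (M P T).
  exact: (near_regular_design q0 P0ne Hint li0 Hm coer
    (fun P PP => sym P theta0 PP Htheta0) bnd dcvg Hi Hii Hiii Hiv Hiv').
pose A P := mx_factor (Sigma P theta0 theta0).
have AA P : P0 P -> A P *m (A P)^T = Sigma P theta0 theta0.
  move=> PP; apply: (mx_factorP (sym _ _ PP Htheta0) li0).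
  exact: coer.
have Au P : P0 P -> A P \in unitmx.
  move=> PP; have := coercive_unit li0 (coer P PP _ Htheta0).
  by rewrite -AA// unitmx_mul unitmx_tr andbb.
(* Chosen separately for each measure and sample size, with default 0 when no projector exists; from
   some sample size on one exists for all measures at once. *)
pose B P T := xget 0 [set B | projector_for (invmx (A P) *m M P T) B].
have BP : \forall T \near \oo, forall P, P0 P ->
    projector_for (invmx (A P) *m M P T) (B P T).
  apply: filterS (reg 1 ltr01) => T RD P PP.
  have [B' B'P] := projector_exists (Au P PP) (rd_injective (RD P PP)).
  exact: (@xgetPex _ 0 [set B | projector_for (invmx (A P) *m M P T) B]
    (ex_intro _ B' B'P)).
pose Z P T (v : 'cV[R]_k) := enorm (B P T *m (invmx (A P) *m v)).
pose Y P T w := Z P T (g T w theta0) ^+ 2.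
pose x P T w theta := g T w theta - m P T theta.
have x0 P T w : P0 P -> x P T w theta0 = g T w theta0.
  by move=> PP; rewrite /x Hm// subr0.
have gE P T w : (fun t => x P T w t + m P T t) = g T w.
  by apply/funext => t; rewrite /x subrK.
have mY P T : measurable_fun setT (Y P T).
  rewrite (_ : Y P T = fun w => dot (B P T *m (invmx (A P) *m g T w theta0))
      (B P T *m (invmx (A P) *m g T w theta0))); last first.
    by apply/funext => w; rewrite /Y /Z enorm_sqr.
  have mB j : measurable_fun setT
      (fun w => (B P T *m (invmx (A P) *m g T w theta0)) j 0).
    by apply: measurable_mulmx_coord => i; apply: measurable_mulmx_coord => l;
      exact: Hg.
  exact: measurable_dot.
have BL e : 0 < e -> \forall T \near \oo, forall P, P0 P -> forall f, BL1 Theta f ->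
    (`|outer_expectation P (fun w => f (x P T w)) -
       outer_expectation (Q P) (fun w => f (G P w))| <= e%:E)%E.
  move=> e0; apply: filterS (near_sup_le H1 e0) => T h P PP f fBL.
  apply: (le_trans _ (h P PP)).
  exact: (ereal_sup_ubound (imageP _ fBL)).
have mZG P T (S : set (measurableTypeR R)) : P0 P -> measurable S ->
    measurable [set w | S (Z P T (G P w theta0) ^+ 2)].
  move=> PP mS; have [mG _ _ _] := HG P PP.
  have mN : measurable_fun setT (fun w => Z P T (G P w theta0) ^+ 2).
    rewrite (_ : (fun _ => _) = fun w => dot (B P T *m (invmx (A P) *m G P w theta0))
        (B P T *m (invmx (A P) *m G P w theta0))); last first.
      by apply/funext => w; rewrite /Z enorm_sqr.
    have mB j : measurable_fun setT
        (fun w => (B P T *m (invmx (A P) *m G P w theta0)) j 0).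
      by apply: measurable_mulmx_coord => i; apply: measurable_mulmx_coord => l;
        exact: mG.
    exact: measurable_dot.
  by rewrite -[X in measurable X]setTI; exact: mN.
have law P T b : P0 P -> projector_for (invmx (A P) *m M P T) (B P T) ->
    (Q P [set w | (Z P T (G P w theta0) ^+ 2 <= b)%R] = (chi2_cdf q b)%:E) /\
    (Q P [set w | (b < Z P T (G P w theta0) ^+ 2)%R] = (1 - chi2_cdf q b)%:E).
  move=> PP [BB _]; have mle : measurable [set y : measurableTypeR R | y <= b].
    by rewrite -set_itvNyc; exact: measurable_itv.
  have mgt : measurable [set y : measurableTypeR R | b < y].
    by rewrite -set_itvoy; exact: measurable_itv.
  have L := marginal_law (HG P PP) Htheta0 li0 (coer P PP _ Htheta0) BB.
  split.
    rewrite -chi2_cdfE -(L _ mle); congr (Q P _).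
    by apply/seteqP; split => w /=; rewrite /Z enorm_sqr.
  rewrite -chi2_cdf_gt -(L _ mgt); congr (Q P _).
  by apply/seteqP; split => w /=; rewrite /Z enorm_sqr.
(* Transfer at the single point [theta0]. The sign [(-1) ^+ s] covers both tails, and the factor
   multiplying [e] in the hypothesis cancels the one that [sup_transfer] divides by. *)
have tr P T e (a b : R) (s : bool) : P0 P -> a < b ->
    projector_for (invmx (A P) *m M P T) (B P T) ->
    (forall f, BL1 Theta f ->
    (`|outer_expectation P (fun w => f (x P T w)) -
       outer_expectation (Q P) (fun w => f (G P w))| <=
     (e * Num.min 1 ((b - a) / Num.sqrt lbar^-1^-1))%:E)%E) ->
    (outer_prob P [set w | (b < (-1) ^+ s * Z P T (g T w theta0))%R] <=
     outer_prob (Q P) [set w | (a < (-1) ^+ s * Z P T (G P w theta0))%R] + e%:E)%E.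
  move=> PP ab BPT XY.
  have L0 : 0 < Num.sqrt lbar^-1^-1 by rewrite sqrtr_gt0 invrK.
  have mn0 : 0 < Num.min 1 ((b - a) / Num.sqrt lbar^-1^-1).
    by rewrite lt_min ltr01 divr_gt0// subr_gt0.
  have Lip D (y z : 'cV[R]_q -> 'cV[R]_k) : 0 <= D ->
      (forall t, Theta t -> enorm (y t - z t) <= D) ->
      forall t, [set theta0] t ->
      `|(-1) ^+ s * Z P T (y t) - (-1) ^+ s * Z P T (z t)|
      <= Num.sqrt lbar^-1^-1 * D.
    move=> D0 yz t ->; rewrite -mulrBr normrM normrX normrN1 expr1n mul1r.
    apply: (le_trans (projected_norm_lipschitz _ _ li0 (coer P PP _ Htheta0)
      (AA P PP) BPT)).
    by rewrite ler_wpM2l ?sqrtr_ge0// yz.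
  have := sup_transfer (ex_intro _ _ Htheta0) (ex_intro _ theta0 erefl) L0 ab Lip XY.
  rewrite mulfK ?gt_eqF// => h; apply: (le_trans _ (le_trans h _)).
    apply: outer_prob_le => w /= bw; exists theta0 => //.
    by rewrite -/(x P T w) x0.
  by apply: leeD2r; apply: outer_prob_le => w /= [t ->].
(* Square roots translate levels of [Y] into levels of the norm. The midpoint of [a] and [b]
   separates the two levels and turns the weak inequality into the strict one that the transfer
   needs. *)
have law_le a b e : a < b -> 0 < e -> \forall T \near \oo, forall P, P0 P ->
    (outer_prob P [set w | (Y P T w <= a)%R] <= (chi2_cdf q b + e)%:E)%E.
  move=> ab e0; have [a0|a0] := ltP a 0.
    apply: filterE => T P PP; rewrite (_ : [set w | _] = set0).
      rewrite outer_prob_measurable// measure0 lee_fin addr_ge0 ?(ltW e0)//.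
      exact: chi2_cdf_ge0.
    by apply/seteqP; split => w //=; rewrite leNgt (lt_le_trans a0)// sqr_ge0.
  have b0 : 0 < b by exact: le_lt_trans ab.
  have [am mb] : a < (a + b) / 2 /\ (a + b) / 2 < b by rewrite !midf_lt.
  have sab : - Num.sqrt b < - Num.sqrt ((a + b) / 2) by rewrite ltrN2 ltr_sqrt.
  have sa : Num.sqrt a < Num.sqrt ((a + b) / 2).
    by rewrite ltr_sqrt// (le_lt_trans a0).
  pose mn := Num.min 1 ((- Num.sqrt ((a + b) / 2) - - Num.sqrt b) / Num.sqrt lbar^-1^-1).
  have mn0 : 0 < mn.
    by rewrite lt_min ltr01 divr_gt0// ?subr_gt0// sqrtr_gt0 invrK.
  near=> T => P PP.
  have BPT : projector_for (invmx (A P) *m M P T) (B P T).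
    by move: P PP; near: T.
  have XY : forall f, BL1 Theta f ->
    (`|outer_expectation P (fun w => f (x P T w)) -
       outer_expectation (Q P) (fun w => f (G P w))| <= (e * mn)%:E)%E.
    by move: P PP {BPT}; near: T; apply: BL; rewrite mulr_gt0.
  have h := tr P T e _ _ true PP sab BPT XY.
  have le1 : (outer_prob P [set w | (Y P T w <= a)%R] <= outer_prob P
      [set w | (- Num.sqrt ((a + b) / 2) < (-1) ^+ true * Z P T (g T w theta0))%R])%E.
    apply: outer_prob_le => w /= Ya; rewrite expr1 mulN1r ltrN2.
    apply: le_lt_trans sa; rewrite -[leLHS]ger0_norm ?enorm_ge0// -sqrtr_sqr.
    by rewrite ler_wsqrtr.
  apply: (le_trans le1); apply: (le_trans h); rewrite EFinD leeD2r//.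
  have [<- _] := law P T b PP BPT.
  have mS : measurable [set w | (Z P T (G P w theta0) ^+ 2 <= b)%R].
    apply: (mZG P T [set y | y <= b] PP).
    by rewrite -set_itvNyc; exact: measurable_itv.
  apply: outer_prob_leP => // w /=; rewrite expr1 mulN1r ltrN2 => Zb.
  rewrite -[b]sqr_sqrtr ?(ltW b0)// lerXn2r ?nnegrE ?sqrtr_ge0 ?enorm_ge0//.
  exact: ltW.
have law_ge a b e : a < b -> 0 < e -> \forall T \near \oo, forall P, P0 P ->
    (outer_prob P [set w | (b <= Y P T w)%R] <= (1 - chi2_cdf q a + e)%:E)%E.
  move=> ab e0; have [a0|a0] := ltP a 0.
    apply: filterE => T P PP; rewrite chi2_cdf_lt0// subr0.
    by rewrite (le_trans (outer_prob_le1 _ _))// lee_fin lerDl ltW.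
  have b0 : 0 < b by exact: le_lt_trans ab.
  have [am mb] : a < (a + b) / 2 /\ (a + b) / 2 < b by rewrite !midf_lt.
  have sab : Num.sqrt a < Num.sqrt ((a + b) / 2).
    by rewrite ltr_sqrt// (le_lt_trans a0).
  have sb : Num.sqrt ((a + b) / 2) < Num.sqrt b by rewrite ltr_sqrt.
  pose mn := Num.min 1 ((Num.sqrt ((a + b) / 2) - Num.sqrt a) / Num.sqrt lbar^-1^-1).
  have mn0 : 0 < mn.
    by rewrite lt_min ltr01 divr_gt0// ?subr_gt0// sqrtr_gt0 invrK.
  near=> T => P PP.
  have BPT : projector_for (invmx (A P) *m M P T) (B P T).
    by move: P PP; near: T.
  have XY : forall f, BL1 Theta f ->
    (`|outer_expectation P (fun w => f (x P T w)) -
       outer_expectation (Q P) (fun w => f (G P w))| <= (e * mn)%:E)%E.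
    by move: P PP {BPT}; near: T; apply: BL; rewrite mulr_gt0.
  have h := tr P T e _ _ false PP sab BPT XY.
  have le1 : (outer_prob P [set w | (b <= Y P T w)%R] <= outer_prob P
      [set w | (Num.sqrt ((a + b) / 2) < (-1) ^+ false * Z P T (g T w theta0))%R])%E.
    apply: outer_prob_le => w /= Yb; rewrite mul1r.
    apply: (lt_le_trans sb); rewrite -[leRHS]ger0_norm ?enorm_ge0// -sqrtr_sqr.
    by rewrite ler_wsqrtr.
  apply: (le_trans le1); apply: (le_trans h); rewrite EFinD leeD2r//.
  have [_ <-] := law P T a PP BPT.
  have mS : measurable [set w | (a < Z P T (G P w theta0) ^+ 2)%R].
    apply: (mZG P T [set y | a < y] PP).
    by rewrite -set_itvoy; exact: measurable_itv.
  apply: outer_prob_leP => // w /=; rewrite mul1r => Zb.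
  rewrite -[X in X < _]sqr_sqrtr// ltrXn2r ?nnegrE ?sqrtr_ge0 ?enorm_ge0//.
have approx e : 0 < e -> \forall T \near \oo, forall P, P0 P ->
    (outer_prob P [set w | ~ well_approximated q alpha qlr c Y e P T w] <= e%:E)%E.
  (* Three bad events: one [e / 8] for the covariance estimate, and for each path property one for
     [G] and one for the transfer, five in all. *)
  move=> e0; have e80 : 0 < e / 8 by rewrite divr_gt0.
  have [C HC] := Hvi _ e80.
  (* A level above [C] by at least 1, so that the transfer of (vi) has room and loses no
     constant. *)
  pose C' := `|C| + 1; have C'0 : 0 <= C' by rewrite addr_ge0.
  have [eta1 eta10 HQ] := QLR_approx li0 K0 C'0 e0.
  have [eta2 eta20 HCV] := critical_value_approx k li0 K0 C'0 Halpha e0 q0.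
  pose eta := Num.min eta1 eta2.
  have eta0 : 0 < eta by rewrite lt_min eta10.
  have etale1 : eta <= eta1 by rewrite ge_min lexx.
  have etale2 : eta <= eta2 by rewrite ge_min lexx orbT.
  have eta20' : 0 < eta / 2 by rewrite divr_gt0.
  (* The gap from [eta / 2] to [eta] is divided by 2 because the increment [x t - x theta0] is
     2-Lipschitz in [x]. As [mn <= 1], the same bounded-Lipschitz bound also serves the transfer of
     (vi). *)
  pose mn := Num.min 1 ((eta - eta / 2) / 2).
  have mn0 : 0 < mn by rewrite lt_min ltr01 divr_gt0// subr_gt0 gtr_pMr// invf_lt1// ltr1n.
  have mn1 : mn <= 1 by rewrite ge_min lexx.
  near=> T => P PP.
  have RD : regular_design Theta theta0 lbar^-1 K eta (delta T) (m P T) (Sigma P) (M P T).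
    by move: P PP; near: T; exact: reg.
  have BPT : projector_for (invmx (A P) *m M P T) (B P T).
    by move: P PP {RD}; near: T.
  have XY : forall f, BL1 Theta f ->
    (`|outer_expectation P (fun w => f (x P T w)) -
       outer_expectation (Q P) (fun w => f (G P w))| <= (e / 8 * mn)%:E)%E.
    by move: P PP {RD BPT}; near: T; apply: BL; rewrite mulr_gt0.
  have h1 : (outer_prob P [set w | (eta%:E < ereal_sup [set ereal_sup [set
     (opnorm (Sigmahat T w theta theta' - Sigma P theta theta')%R)%:E
      | theta' in Theta] | theta in Theta])%E] <= (e / 8)%:E)%E.
    by move: P PP {RD BPT XY}; near: T; exact: (near_sup_le (H3 _ eta0) e80).
  have h2 : (outer_prob P [set w | exists2 t, Theta t & (`|C| + 1 < enorm (x P T w t))%R]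
      <= (e / 8 + e / 8)%:E)%E.
    have C1 : `|C| < `|C| + 1 by rewrite ltrDl.
    have Lip D (y z : 'cV[R]_q -> 'cV[R]_k) : 0 <= D ->
        (forall t, Theta t -> enorm (y t - z t) <= D) ->
        forall t, Theta t -> `|enorm (y t) - enorm (z t)| <= 1 * D.
      by move=> D0 yz t Tt; rewrite mul1r (le_trans (ler_dist_enorm _ _))// yz.
    have := sup_transfer (ex_intro _ _ Htheta0) (ex_intro _ _ Htheta0) ltr01 C1 Lip XY.
    rewrite addrAC subrr add0r divr1 minxx divr1 => /le_trans; apply.
    rewrite EFinD; apply: leeD; last first.
      by rewrite lee_fin ler_piMr// ltW.
    apply: (@le_trans _ _ (outer_prob (Q P) [set w | (C%:E <
        ereal_sup [set (enorm (G P w theta))%:E | theta in Theta])%E])).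
      apply: outer_prob_le => w /= [t Tt Ct].
      apply: (@lt_le_trans _ _ (enorm (G P w t))%:E).
        by rewrite lte_fin (le_lt_trans (ler_norm _)).
      by apply: ereal_sup_ubound; exists t.
    by apply: le_trans (ltW HC); apply: ereal_sup_ubound; exists P.
  have h3 : (outer_prob P [set w | exists2 t, nearT T t &
      (eta < enorm (x P T w t - x P T w theta0))%R] <= (e / 8 + e / 8)%:E)%E.
    have eta2e : eta / 2 < eta by rewrite gtr_pMr// invf_lt1// ltr1n.
    have t00 : nearT T theta0.
      by split=> //; rewrite subrr enorm0 ltW// (rd_delta RD).
    have Lip D (y z : 'cV[R]_q -> 'cV[R]_k) : 0 <= D ->
        (forall t, Theta t -> enorm (y t - z t) <= D) ->
        forall t, nearT T t ->
        `|enorm (y t - y theta0) - enorm (z t - z theta0)| <= 2 * D.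
      move=> D0 yz t [Tt _]; rewrite (le_trans (ler_dist_enorm _ _))//.
      have -> : y t - y theta0 - (z t - z theta0) =
          (y t - z t) - (y theta0 - z theta0).
        by rewrite !opprD !opprK addrACA.
      rewrite (le_trans (ler_enormB _ _))//.
      by rewrite mulr_natl mulr2n lerD// yz.
    have := sup_transfer (ex_intro _ _ Htheta0) (ex_intro _ _ t00) (ltr0Sn R 1) eta2e Lip XY.
    rewrite -/mn mulfK ?(gt_eqF mn0)// => /le_trans; apply.
    rewrite EFinD leeD2r//.
    apply: (@le_trans _ _ (outer_prob (Q P) [set w | ((eta / 2)%:E <
        ereal_sup [set (enorm (G P w theta - G P w theta0))%:E
          | theta in nearT T])%E])).
      apply: outer_prob_le => w /= [t Tt Ct].
      apply: (@lt_le_trans _ _ (enorm (G P w t - G P w theta0))%:E).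
        by rewrite lte_fin.
      by apply: ereal_sup_ubound; exists t.
    by move: P PP {RD BPT XY h1 h2 Lip}; near: T; exact: (near_sup_le (Hv _ eta20') e80).
  apply: (@le_trans _ _ ((e / 8)%:E + ((e / 8 + e / 8)%:E + (e / 8 + e / 8)%:E))%E);
    last by rewrite -!EFinD lee_fin; move: e0; clear; lra.
  apply: (le_trans _ (leeD h1 (leeD h2 h3))).
  apply: (le_trans _ (leeD2l _ (outer_probU _ _ _))).
  apply: (le_trans _ (outer_probU _ _ _)).
  (* Off the three bad events the estimates are deterministic and hold at the fixed outcome [w]. *)
  apply: outer_prob_le => w; apply: contraPP => /not_orP[nb1 /not_orP[nb2 nb3]].
  apply; rewrite /well_approximated.
  have close : close_to Theta eta (Sigmahat T w) (Sigma P).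
    move=> t s Tt Ts; apply: (mxbound_le _ (mxbound_opnorm _)).
    move/negP: nb1; rewrite -leNgt -lee_fin => nb1; apply: (le_trans _ nb1).
    apply: (le_trans _ (ereal_sup_ubound (imageP _ Tt))).
    exact: (ereal_sup_ubound (imageP _ Ts)).
  have tm : tame Theta theta0 C' eta (delta T) (x P T w).
    split=> [t Tt|t Tt td]; rewrite leNgt; apply/negP => h.
      by apply: nb2; exists t.
    by apply: nb3; exists t.
  split.
    have Q1 := HQ q k Theta theta0 (delta T) (m P T) (Sigma P) (M P T) (x P T w)
      (Sigmahat T w) (A P) (B P T) (rd_weaken eta0 etale1 RD).
    rewrite gE x0// in Q1; apply: Q1 => //.
    - by case: tm => tm1 tm2; split=> // t Tt td; rewrite (le_trans (tm2 t Tt td)).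
    - by move=> t Tt; apply: mxbound_le (close t t Tt Tt).
    - by rewrite AA// => v; rewrite subrr mul0mx enorm0 mulr_ge0 ?enorm_ge0// ltW.
  have Q2 := HCV Theta theta0 (delta T) (m P T) (Sigma P) (M P T) (x P T w)
    (Sigmahat T w) (rd_weaken eta0 etale2 RD).
  rewrite gE in Q2; apply: Q2 => //.
    by case: tm => tm1 tm2; split=> // t Tt td; rewrite (le_trans (tm2 t Tt td)).
  by move=> t s Tt Ts; apply: mxbound_le (close t s Tt Ts).
split.
- exact: (conclusion_law P0ne q0 approx law_le law_ge).
- exact: (conclusion_critical_value P0ne approx).
- exact: (conclusion_test P0ne q0 mY approx law_le law_ge).
Unshelve. all: end_near. Qed.
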